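(* Let $\varepsilon>0$, $\delta>0$, $\kappa>0$, where $\delta$ and $\kappa$ may depend on $\varepsilon$, and let $(v_\varepsilon,\varphi_\varepsilon)$ be a minimizer of $G_{\varepsilon,\delta,\kappa}$ in $\mathcal I$ with $v_\varepsilon\ge0$. Then: (a) If $\kappa$ is bounded and $\delta$ is fixed, then for $\varepsilon>0$ small there exists $C>0$ independent of all parameters such that $\|v_\varepsilon-1\|_{L^\infty((0,1))}=o_\varepsilon(\varepsilon)$, $$\varphi_\varepsilon(1)=2\kappa\frac{\varepsilon}{\sqrt\delta}(1+o_\varepsilon(1)),\qquad \|\varphi_\varepsilon\|_{L^\infty((0,1))}\le C\kappa\frac{\varepsilon}{\sqrt\delta},$$ $$G_{\varepsilon,\delta,\kappa}(v_\varepsilon,\varphi_\varepsilon)=-\frac{\kappa^2\varepsilon}{2\sqrt\delta}(1+o_\varepsilon(1)).$$ Moreover, if $\Phi_\varepsilon(x)=\frac{\sqrt\delta}{2\kappa\varepsilon}\varphi_\varepsilon\left(1-\frac{\varepsilon x}{\sqrt\delta}\right)$, then $\Phi_\varepsilon\to e^{-x}$ in $\mathcal C^1_{loc}([0,+\infty))$. (b) If $\kappa=\frac{\tilde\kappa\sqrt\delta}{\varepsilon}$ with $\tilde\kappa<\frac1\pi$ independent of $\varepsilon$, $\delta=o_\varepsilon(\varepsilon)$ and $\varepsilon^2=o_\varepsilon(\delta)$, then $\|1-v_\varepsilon\|_{L^\infty((0,1))}=o_\varepsilon(\delta^{1/4})$, $\varphi_\varepsilon(1)=\arcsin(2\tilde\kappa)(1+o_\varepsilon(1))$,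 $$G_{\varepsilon,\delta,\kappa}(v_\varepsilon,\varphi_\varepsilon)=\frac{\sqrt\delta}{\varepsilon}\left(\frac{1-\sqrt{1-4\tilde\kappa^2}}{4}-\frac{\tilde\kappa}{2}\arcsin(2\tilde\kappa)\right)(1+o_\varepsilon(1)),$$ and $\|\varphi_\varepsilon\|_{L^\infty((0,1))}\le\arcsin(2\tilde\kappa)(1+o_\varepsilon(1))$. Setting $\psi_\varepsilon(x)=\varphi_\varepsilon\left(1-\frac{\varepsilon x}{\sqrt\delta}\right)$, we have $\psi_\varepsilon\to\psi_0$ in $\mathcal C^1_{loc}([0,+\infty))$ with $\psi_0(x)=2\arctan\left[\tan\left(\frac{\arcsin(2\tilde\kappa)}{2}\right)e^{-x}\right]$. (c) If $\kappa=\frac{\tilde\kappa\sqrt\delta}{\varepsilon}$ with $\tilde\kappa>\frac1\pi$ independent of $\varepsilon$, $\varepsilon^2=o_\varepsilon(\delta)$ and $\delta=o_\varepsilon(\varepsilon)$, then $\|v_\varepsilon-1\|_{L^\infty((0,1))}\le C\sqrt{\delta/\varepsilon}$ for some constant $C$ and $$G_{\varepsilon,\delta,\kappa}(v_\varepsilon,\varphi_\varepsilon)=-\frac{\tilde\alpha_0^2\delta}{8\varepsilon^2}(1+o_\varepsilon(1)),$$ where $\tilde\alpha_0$ is the unique number in $(0,2\tilde\kappa]$ with $\int_0^{\pi/2}\sqrt{\tilde\alpha_0^2+\sin^2y}\,dy=\tilde\kappa\pi$. Letting $\tilde\varphi_\varepsilon(x):=\varphi_\varepsilon\left(\frac{\varepsilon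 x}{\sqrt\delta}\right)$ on $[0,\frac{\sqrt\delta}{\varepsilon}]$, if moreover $\delta=O_\varepsilon(\varepsilon^{3/2})$ then $\tilde\varphi_\varepsilon$ converges in $\mathcal C^1_{loc}(\mathbb R^+)$ to the solution $\varphi_0$ of $\varphi_0''=\sin\varphi_0\cos\varphi_0$ in $\mathbb R^+$, $\varphi_0(0)=0$, $\varphi_0'(0)=\tilde\alpha_0$.
   Context: For $\varepsilon,\delta,\kappa>0$ and suitable $(v,\varphi)$ on $(0,1)$ let $$G_{\varepsilon,\delta,\kappa}(v,\varphi)=\frac12\int_0^1v'^2+\frac{1}{4\varepsilon^2}\int_0^1(1-v^2)^2+\frac18\int_0^1v^2\varphi'^2+\frac{\delta}{8\varepsilon^2}\int_0^1v^4\sin^2\varphi-\frac\kappa2\int_0^1v^2\varphi'.$$ Let $\mathcal S(v)=\{x\in[0,1]:v(x)=0\}$. The admissible class $\mathcal I$ consists of pairs $(v,\varphi)$ with $v\in H^1((0,1))$, $\varphi$ of class $H^1$ on $(0,1)\setminus\mathcal S(v)$, $\varphi(0)=0$ and $\int_0^1v^2=1$; on $\mathcal S(v)$ the quantities $v^2\varphi'^2$, $v^2\varphi'$ and $v^4\sin^2\varphi$ are set equal to $0$. The notations $o_\varepsilon$, $O_\varepsilon$ refer to the limit $\varepsilon\to0$. *)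

(* Defs.v *)
From HB Require Import structures.
From mathcomp Require Import all_boot all_order all_algebra.
From mathcomp Require Import all_classical all_reals all_analysis.
Set Implicit Arguments. Unset Strict Implicit. Unset Printing Implicit Defensive.
Import Order.TTheory GRing.Theory Num.Theory.
Import numFieldNormedType.Exports.
Local Open Scope classical_set_scope.
Local Open Scope ring_scope.

Definition Iint {R : realType} (a b : R) (f : R -> R) : R :=
  Rintegral (@lebesgue_measure R) `[a, b] f.

Definition zeroset {R : realType} (v : R -> R) : set R :=
  [set x | 0 <= x <= 1 /\ v x = 0].

Definition L2on {R : realType} (D : set R) (f : R -> R) : Prop :=
  measurable_fun D f /\
  (@lebesgue_measure R).-integrable D (fun x => ((f x) ^+ 2)%:E).

(* Admissible class I.  In dimension one, H^1 functions are (have a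
   representative that is) absolutely continuous with L^2 derivative; the
   derivative is carried explicitly (dv, dphi) and the functions v, phi are
   that continuous representative.
   - v in H^1((0,1)): dv in L^2(0,1) and v b - v a = int_a^b dv on [0,1];
   - phi of class H^1 on (0,1) \ S(v): phi, dphi in L^2((0,1)\S(v)) and
     phi b - phi a = int_a^b dphi on every segment [a,b] of [0,1] avoiding S(v);
   - phi(0) = 0 and int_0^1 v^2 = 1. *)
Definition admissible {R : realType} (v dv phi dphi : R -> R) : Prop :=
  [/\ L2on `[0, 1] dv,
      (forall a b : R, 0 <= a -> a <= b -> b <= 1 -> v b - v a = Iint a b dv),
      L2on (`]0, 1[ `\` zeroset v) dphi /\ L2on (`]0, 1[ `\` zeroset v) phi,
      (forall a b : R, 0 <= a -> a <= b -> b <= 1 ->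
          (forall x, a <= x <= b -> v x != 0) -> phi b - phi a = Iint a b dphi)
    & phi 0 = 0 /\ Iint 0 1 (fun x => v x ^+ 2) = 1].

(* The functional G_{eps,delta,kappa}.  On S(v) the integrands
   v^2 phi'^2, v^2 phi', v^4 sin^2 phi vanish automatically since v = 0 there. *)
Definition Gfun {R : realType} (eps delta kappa : R) (v dv phi dphi : R -> R) : R :=
  2^-1 * Iint 0 1 (fun x => dv x ^+ 2)
  + (4 * eps ^+ 2)^-1 * Iint 0 1 (fun x => (1 - v x ^+ 2) ^+ 2)
  + 8^-1 * Iint 0 1 (fun x => v x ^+ 2 * dphi x ^+ 2)
  + delta / (8 * eps ^+ 2) * Iint 0 1 (fun x => v x ^+ 4 * sin (phi x) ^+ 2)
  - kappa / 2 * Iint 0 1 (fun x => v x ^+ 2 * dphi x).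

Definition minimizer {R : realType} (eps delta kappa : R)
    (v dv phi dphi : R -> R) : Prop :=
  admissible v dv phi dphi /\
  forall w dw psi dpsi : R -> R, admissible w dw psi dpsi ->
    Gfun eps delta kappa v dv phi dphi <= Gfun eps delta kappa w dw psi dpsi.

Definition small_o0 {R : realType} (f g : R -> R) : Prop :=
  forall eta : R, 0 < eta -> \forall e \near 0^'+, `|f e| <= eta * `|g e|.

Definition asym_equiv {R : realType} (f g : R -> R) : Prop :=
  exists r : R -> R, r e @[e --> 0^'+] --> 0 /\
    \forall e \near 0^'+, f e = g e * (1 + r e).

(* || F_eps ||_{L^infty((0,1))} = o_eps(h)  (F_eps continuous on (0,1)) *)
Definition sup_littleo {R : realType} (F : R -> R -> R) (h : R -> R) : Prop :=
  forall eta : R, 0 < eta ->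
    \forall e \near 0^'+, forall x, 0 < x < 1 -> `|F e x| <= eta * `|h e|.

Definition C1loc_conv {R : realType} (F : R -> R -> R) (g : R -> R) : Prop :=
  forall M eta : R, 0 < M -> 0 < eta -> \forall e \near 0^'+,
    (forall x, 0 <= x <= M -> `|F e x - g x| <= eta) /\
    (forall x, 0 < x <= M ->
       derivable (F e) x 1 /\ `|derive1 (F e) x - derive1 g x| <= eta).

Definition ode_sol {R : realType} (a0 : R) (f : R -> R) : Prop :=
  [/\ f 0 = 0,
      (forall x, 0 <= x -> derivable f x 1 /\ derivable (derive1 f) x 1),
      derive1 f 0 = a0
    & forall x, 0 < x -> derive1 (derive1 f) x = sin (f x) * cos (f x)].

(* Main.v *)
Require Import Defs.
From HB Require Import structures.
From mathcomp Require Import all_boot all_order all_algebra.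
From mathcomp Require Import all_classical all_reals all_analysis.
From mathcomp Require Import measurable_realfun ring lra.
Import Order.TTheory GRing.Theory Num.Theory.
Import numFieldNormedType.Exports.
Local Open Scope classical_set_scope.
Local Open Scope ring_scope.

(* Comparison with (1, 0) and completion of the square bound the energy of [v] by
   [kappa^2/2], so [v] is uniformly close to 1 and in particular positive.  The
   Euler-Lagrange equation for the phase then holds classically, in the first order
   form [phi' = 2 kappa + P/v^2], [P' = delta/eps^2 v^4 sin phi cos phi], [P 1 = 0].
   With [L = sqrt delta/eps], decoupling [v] from the phase leaves, up to small
   relative errors, the one-dimensional functional
   [1/8 int (phi'^2 + L^2 sin^2 phi) - kappa/2 phi(1)], which is bounded below by the
   calibrations [phi'^2 + L^2 S(phi)^2 >= 2 L S(phi) phi'], with [S = |sin|] in (a), (b)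
   and [S = sqrt (a^2 + sin^2)] in (c).  The solutions of [psi' = - sin psi] in (b),
   [psi' = S psi] in (c), and an exponential in (a), make the bounds sharp, and
   stability of the lower bound locates [phi(1)] in (a), (b).  In (c) the quantity
   [(2 kappa + P)^2 - L^2 sin^2 phi] is almost conserved, whence the initial slope.
   C^1 convergence follows from Gronwall's lemma for the first order system. *)

(** * Derivatives and continuity *)

(** Only the phase is varied: the equation for [v] would bring in a Lagrange multiplier for
    [int v^2 = 1], whereas every estimate on [v] here is read off the energy. Half of the energy of
    [v] is kept aside in the lower bound; matching bounds squeeze it, which upgrades the crude
    estimate on [1 - v] to the rates of (a) and (b). The threshold [1/pi] compares two slopes: with
    [k = kappa/L], the twist term has slope [2 k], and a primitive of [|sin|] has mean slope [2/pi].
    Below the threshold the tilted primitive is coercive, with a unique lowest well at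
    [arcsin (2 k)]. Above it, [sqrt (a^2 + sin^2)] has mean slope exactly [2 k] for the [a] of the
    statement, so its tilted primitive is periodic, hence bounded, and costs [O(L)] against an
    energy of order [L^2]. In (a), [k] tends to 0 and the energy is of order [L k^2], so stability
    must be quantitative in [k]; in (b), [k] is fixed and a qualitative modulus suffices.
    [F = 2 kappa + P/V^2] is only as regular as [V], so the differential systems are written for the
    pair [(Phi, 2 kappa + P)]. *)

Lemma derD {R : realType} (f g : R -> R) (x a b : R) :
  is_derive x 1 f a -> is_derive x 1 g b ->
  is_derive x 1 (fun y => f y + g y) (a + b).
Proof. by move=> ? ?; exact: is_deriveD. Qed.

Lemma derN {R : realType} (f : R -> R) (x a : R) :
  is_derive x 1 f a -> is_derive x 1 (fun y => - f y) (- a).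
Proof. by move=> ?; exact: is_deriveN. Qed.

Lemma derM {R : realType} (f g : R -> R) (x a b : R) :
  is_derive x 1 f a -> is_derive x 1 g b ->
  is_derive x 1 (fun y => f y * g y) (f x * b + g x * a).
Proof. by move=> ? ?; exact: is_deriveM. Qed.

Lemma derX {R : realType} (f : R -> R) n (x a : R) :
  is_derive x 1 f a -> is_derive x 1 (fun y => f y ^+ n) (n%:R * f x ^+ n.-1 * a).
Proof.
move=> df; have -> : (fun y => f y ^+ n) = f ^+ n.
  by apply/funext => y; elim: n => [//|n IH]; rewrite exprS IH exprS.
exact: is_deriveX.
Qed.

Lemma derC {R : realType} (c x : R) : is_derive x 1 (fun=> c) 0.
Proof. exact: is_derive_cst. Qed.

Lemma derId {R : realType} (x : R) : is_derive x 1 (fun y => y) 1.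
Proof. exact: is_derive_id. Qed.

Lemma derO {R : realType} (F g : R -> R) (x a b : R) :
  is_derive (g x) 1 F a -> is_derive x 1 g b ->
  is_derive x 1 (fun y => F (g y)) (a * b).
Proof. by move=> ? ?; exact: (@is_derive1_comp _ F g). Qed.

Lemma derOf {R : realType} (F f g : R -> R) (x b : R) :
  (forall y : R, is_derive y 1 F (f y)) -> is_derive x 1 g b ->
  is_derive x 1 (fun y => F (g y)) (f (g x) * b).
Proof. by move=> ? ?; exact: derO. Qed.

Lemma der_eq {R : realType} (f : R -> R) (x a b : R) :
  is_derive x 1 f a -> a = b -> is_derive x 1 f b.
Proof. by move=> ? <-. Qed.

Lemma derE {R : realType} {f : R -> R} {x a : R} :
  is_derive x 1 f a -> derivable f x 1 /\ derive1 f x = a.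
Proof. by case=> df <-; rewrite derive1E. Qed.

(** Differentiation driven by the syntax of the goal: [notypeclasses refine] keeps instance search
    out, and an unknown function is handled through a hypothesis giving its derivative
    everywhere. *)
Ltac der := repeat first
  [ eassumption
  | notypeclasses refine (derC _ _) | notypeclasses refine (derId _)
  | notypeclasses refine (derD _ _ _ _ _ _ _) | notypeclasses refine (derN _ _ _ _)
  | notypeclasses refine (derM _ _ _ _ _ _ _) | notypeclasses refine (derX _ _ _ _ _)
  | notypeclasses refine (derO _ _ _ _ _ (is_derive_sin _) _)
  | notypeclasses refine (derO _ _ _ _ _ (is_derive_cos _) _)
  | notypeclasses refine (derO _ _ _ _ _ (is_derive_expR _) _)
  | match goal with H : forall y, is_derive y 1 ?F _ |- is_derive _ 1 ?F _ => exact: H end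
  | match goal with H : forall y, is_derive y 1 ?F _ |- is_derive _ 1 (fun z => ?F _) _ =>
      notypeclasses refine (derOf _ _ _ _ _ H _) end ].

Ltac derive_eq := eapply der_eq; [der | cbv beta].

Lemma der_cont {R : realType} (f : R -> R) (x a : R) :
  is_derive x 1 f a -> {for x, continuous f}.
Proof. by case=> df _; exact/differentiable_continuous/derivable1_diffP. Qed.

Lemma der_continuous {R : realType} (f df : R -> R) :
  (forall x : R, is_derive x 1 f (df x)) -> continuous f.
Proof. by move=> h x; exact: der_cont (h x). Qed.

Lemma contD {R : realType} (f g : R -> R) :
  continuous f -> continuous g -> continuous (fun x => f x + g x).
Proof. by move=> cf cg x; apply: cvgD; [exact: cf|exact: cg]. Qed.

Lemma contN {R : realType} (f : R -> R) : continuous f -> continuous (fun x => - f x).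
Proof. by move=> cf x; apply: cvgN; exact: cf. Qed.

Lemma contM {R : realType} (f g : R -> R) :
  continuous f -> continuous g -> continuous (fun x => f x * g x).
Proof. by move=> cf cg x; apply: cvgM; [exact: cf|exact: cg]. Qed.

Lemma contC {R : realType} (c : R) : continuous (fun _ : R => c).
Proof. by move=> x; exact: cvg_cst. Qed.

Lemma contId {R : realType} : continuous (fun x : R => x).
Proof. by move=> x; exact: cvg_id. Qed.

Lemma contX {R : realType} (f : R -> R) n :
  continuous f -> continuous (fun x => f x ^+ n).
Proof.
move=> cf; elim: n => [|n IH]; first by move=> x; exact: cvg_cst.
rewrite (_ : (fun x => _) = (fun x => f x * f x ^+ n)); first exact: contM.
by apply/funext => x; rewrite exprS.
Qed.

Lemma contO {R : realType} (f g : R -> R) :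
  continuous f -> continuous g -> continuous (fun x => f (g x)).
Proof. by move=> cf cg x; apply: (@continuous_comp _ _ _ g f); [exact: cg|exact: cf]. Qed.

Lemma contV {R : realType} (f : R -> R) :
  (forall x, f x != 0) -> continuous f -> continuous (fun x => (f x)^-1).
Proof. by move=> f0 cf x; apply: cvgV; [exact: f0|exact: cf]. Qed.

Lemma contAbs {R : realType} (f : R -> R) :
  continuous f -> continuous (fun x => `|f x|).
Proof. by move=> cf x; apply: cvg_norm; exact: cf. Qed.

Lemma contSqrt {R : realType} (f : R -> R) :
  continuous f -> continuous (fun x => Num.sqrt (f x)).
Proof. by move=> cf; apply: contO cf; exact: sqrt_continuous. Qed.

Ltac cont := repeat first
  [ match goal with
    | H : continuous ?f |- continuous ?f => exact H
    | |- continuous (fun x => x) => exact contId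
    | |- continuous (fun _ => ?c) => exact (contC c)
    | |- continuous (@sin _) => exact (continuous_sin _)
    | |- continuous (@cos _) => exact: continuous_cos
    | |- continuous (@expR _) => exact: continuous_expR
    | |- continuous (fun x => @?f x + @?g x) => refine (contD f g _ _)
    | |- continuous (fun x => - @?f x) => refine (contN f _)
    | |- continuous (fun x => @?f x * @?g x) => refine (contM f g _ _)
    | |- continuous (fun x => @?f x ^+ ?n) => refine (contX f n _)
    | |- continuous (fun x => `|@?f x|) => refine (contAbs f _)
    | |- continuous (fun x => Num.sqrt (@?f x)) => refine (contSqrt f _)
    | |- continuous (fun x => sin (@?f x)) => refine (contO _ f (@continuous_sin _) _)
    | |- continuous (fun x => cos (@?f x)) => refine (contO _ f (@continuous_cos _) _)
    | |- continuous (fun x => expR (@?f x)) => refine (contO _ f (@continuous_expR _) _)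
    | H : continuous ?F |- continuous (fun x => ?F (@?f x)) => refine (contO _ f H _)
    | H : forall y, is_derive y 1 ?F _ |- continuous ?F => exact (der_continuous _ _ H)
    | H : forall y, is_derive y 1 ?F _ |- continuous (fun x => ?F (@?f x)) =>
        refine (contO _ f (der_continuous _ _ H) _)
    end
  | assumption ].

(** * Mean value inequalities and Gronwall's lemma *)

Lemma mvt {R : realType} (f df : R -> R) (a b : R) : a <= b ->
  (forall x : R, a <= x <= b -> is_derive x 1 f (df x)) ->
  exists2 c, a <= c <= b & f b - f a = df c * (b - a).
Proof.
move=> ab dF.
have cf : {within `[a, b], continuous f}.
  apply: derivable_within_continuous => x; rewrite in_itv /= => xab.
  by case: (dF x xab).
have dF' x : x \in `]a, b[%R -> is_derive x 1 f (df x).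
  by rewrite in_itv /= => /andP[? ?]; apply: dF; rewrite !ltW.
have [c] := MVT_segment ab dF' cf.
by rewrite in_itv/= => ? ?; exists c.
Qed.

Lemma le_of_der {R : realType} (f df : R -> R) (a b : R) : a <= b ->
  (forall x : R, a <= x <= b -> is_derive x 1 f (df x)) ->
  (forall x, a <= x <= b -> 0 <= df x) -> f a <= f b.
Proof.
move=> ab dF dp; have [c cab E] := mvt _ _ _ _ ab dF.
by rewrite -subr_ge0 E mulr_ge0 ?dp// subr_ge0.
Qed.

Lemma lt_of_der {R : realType} (f df : R -> R) (a b : R) : a < b ->
  (forall x : R, a <= x <= b -> is_derive x 1 f (df x)) ->
  (forall x, a < x < b -> 0 < df x) -> f a < f b.
Proof.
move=> ab dF dp.
have cf : {within `[a, b], continuous f}.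
  apply: derivable_within_continuous => x; rewrite in_itv /= => xab.
  by case: (dF x xab).
have dF' x : x \in `]a, b[%R -> is_derive x 1 f (df x).
  by rewrite in_itv /= => /andP[? ?]; apply: dF; rewrite !ltW.
have [c] := MVT ab dF' cf.
by rewrite in_itv/= => cab E; rewrite -subr_gt0 E mulr_gt0 ?dp// subr_gt0.
Qed.

Lemma eq_of_der0 {R : realType} (f : R -> R) (a b : R) : a <= b ->
  (forall x : R, a <= x <= b -> is_derive x 1 f 0) -> f b = f a.
Proof.
move=> ab dF; have [c _] := mvt _ _ _ _ ab dF.
by rewrite mul0r => /eqP; rewrite subr_eq0 => /eqP.
Qed.

Lemma lip_of_der {R : realType} (f df : R -> R) (K : R) :
  (forall x : R, is_derive x 1 f (df x)) -> (forall x, `|df x| <= K) ->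
  forall a b, `|f b - f a| <= K * `|b - a|.
Proof.
move=> dF dK a b; wlog ab : a b / a <= b.
  move=> H; case: (leP a b) => [|/ltW] ab; first exact: H.
  by rewrite distrC (distrC b); exact: H.
have [c _ ->] := mvt _ _ _ _ ab (fun x _ => dF x).
by rewrite normrM ler_wpM2r.
Qed.

Lemma derivE_on {R : realType} (f g : R -> R) (x a b d : R) : a < x < b ->
  (forall y, a < y < b -> f y = g y) -> is_derive x 1 g d -> is_derive x 1 f d.
Proof.
move=> xab fg dg; apply: near_eq_is_derive dg.
have : \forall z \near x, z \in `]a, b[ by apply: near_in_itvoo; rewrite in_itv.
by apply: filterS => z; rewrite in_itv /= => /fg ->.
Qed.

Lemma le_of_der_oo {R : realType} (f df : R -> R) (a b : R) : a <= b ->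
  (forall x, a <= x <= b -> {for x, continuous f}) ->
  (forall x : R, a < x < b -> is_derive x 1 f (df x)) ->
  (forall x, a < x < b -> 0 <= df x) -> f a <= f b.
Proof.
rewrite le_eqVlt => /predU1P[-> //|ab cf dF dp].
have cf' : {within `[a, b], continuous f}.
  by apply: continuous_in_subspaceT => x; rewrite inE /= in_itv /= => /cf.
have dF' x : x \in `]a, b[%R -> is_derive x 1 f (df x) by rewrite in_itv /= => /dF.
have [c] := MVT ab dF' cf'.
by rewrite in_itv /= => cab E; rewrite -subr_ge0 E mulr_ge0 ?dp// subr_ge0 ltW.
Qed.

Lemma gronwall {R : realType} (f df : R -> R) (K eta M : R) : 0 < K -> 0 <= eta ->
  0 <= f 0 ->
  (forall x, 0 <= x <= M -> {for x, continuous f}) ->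
  (forall x : R, 0 < x <= M -> is_derive x 1 f (df x)) ->
  (forall x, 0 < x <= M -> df x <= K * f x + K * eta) ->
  forall x, 0 <= x <= M -> f x <= (f 0 + eta) * expR (K * M).
Proof.
move=> K0 eta0 f0 cf dF le x /andP[x0 xM].
(* The integrating factor turns the differential inequality into monotonicity; the sign is reversed
   to fit [le_of_der_oo]. *)
pose g y := - ((f y + eta) * expR (- (K * y))).
have dg (y : R) : 0 < y < x ->
    is_derive y 1 g ((K * (f y + eta) - df y) * expR (- (K * y))).
  move=> /andP[y0 yx].
  have dfy : is_derive y 1 f (df y) by apply: dF; rewrite y0 (le_trans (ltW yx)).
  by derive_eq; ring.
have cg y : 0 <= y <= x -> {for y, continuous g}.
  move=> /andP[y0 yx]; apply: cvgN; apply: cvgM.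
    by apply: cvgD; [apply: cf; rewrite y0 (le_trans yx)|exact: cvg_cst].
  have dexp : is_derive y 1 (fun z => expR (- (K * z))) (- K * expR (- (K * y))).
    by derive_eq; ring.
  exact: der_cont dexp.
have : g 0 <= g x.
  apply: (le_of_der_oo g _ _ _ x0 cg dg) => y /andP[y0 yx].
  rewrite mulr_ge0 ?expR_ge0// mulrDr subr_ge0; apply: le.
  by rewrite y0 (le_trans (ltW yx)).
rewrite /g mulr0 oppr0 expR0 mulr1 lerN2 expRN ler_pdivrMr ?expR_gt0// => h.
apply: le_trans (le_trans h _); first by rewrite lerDl.
by rewrite ler_wpM2l ?addr_ge0// ler_expR ler_pM2l.
Qed.

(** * Integrals over compact intervals *)

Definition itg {R : realType} (a b : R) (f : R -> R) : Prop :=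
  (@lebesgue_measure R).-integrable `[a, b] (EFin \o f).

Lemma itg_cont {R : realType} (a b : R) (f : R -> R) : continuous f -> itg a b f.
Proof.
move=> cf; apply: continuous_compact_integrable; first exact: segment_compact.
exact: continuous_subspaceT.
Qed.

Lemma itgD {R : realType} (a b : R) (f g : R -> R) :
  itg a b f -> itg a b g -> itg a b (fun x => f x + g x).
Proof.
move=> hf hg; have := @integrableD _ _ _ (@lebesgue_measure R) _ (measurable_itv `[a, b]) (EFin \o f) (EFin \o g) hf hg.
by apply: eq_integrable => // x _ /=.
Qed.

Lemma itgZ {R : realType} (a b k : R) (f : R -> R) :
  itg a b f -> itg a b (fun x => k * f x).
Proof.
move=> hf; have := @integrableZl _ _ _ (@lebesgue_measure R) _ (measurable_itv `[a, b]) k (EFin \o f) hf.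
by apply: eq_integrable => // x _ /=.
Qed.

Lemma itgN {R : realType} (a b : R) (f : R -> R) :
  itg a b f -> itg a b (fun x => - f x).
Proof.
move=> /(itgZ _ _ (-1)); rewrite (_ : (fun x => -1 * f x) = (fun x => - f x))//.
by apply/funext => x; rewrite mulN1r.
Qed.

Lemma itg_mfun {R : realType} (a b : R) (f : R -> R) :
  itg a b f -> measurable_fun `[a, b] f.
Proof. by case/integrableP => /measurable_EFinP. Qed.

Lemma itg_dom {R : realType} (a b : R) (f g : R -> R) : measurable_fun `[a, b] f ->
  itg a b g -> (forall x, a <= x <= b -> `|f x| <= g x) -> itg a b f.
Proof.
move=> mf hg le; apply: (@le_integrable _ _ _ (@lebesgue_measure R) _ (measurable_itv `[a, b])
  (EFin \o f) (EFin \o g)) => //; first exact/measurable_EFinP.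
move=> x; rewrite /= in_itv /= => xab.
by rewrite lee_fin (le_trans (le _ xab))// ler_norm.
Qed.

Lemma itg_sub {R : realType} (a b c d : R) (f : R -> R) : a <= c -> d <= b ->
  itg a b f -> itg c d f.
Proof.
move=> ac db; apply: integrableS => //; by apply: subset_itv; rewrite bnd_simp.
Qed.

Lemma IintE {R : realType} (a b : R) (f g : R -> R) :
  (forall x, a <= x <= b -> f x = g x) -> Iint a b f = Iint a b g.
Proof.
by move=> fg; apply: eq_Rintegral => x; rewrite inE /= in_itv /= => /fg.
Qed.

Lemma IintD {R : realType} (a b : R) (f g : R -> R) : itg a b f -> itg a b g ->
  Iint a b (fun x => f x + g x) = Iint a b f + Iint a b g.
Proof. by move=> hf hg; exact: RintegralD. Qed.

Lemma IintB {R : realType} (a b : R) (f g : R -> R) : itg a b f -> itg a b g ->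
  Iint a b (fun x => f x - g x) = Iint a b f - Iint a b g.
Proof. by move=> hf hg; exact: RintegralB. Qed.

Lemma IintZ {R : realType} (a b k : R) (f : R -> R) : itg a b f ->
  Iint a b (fun x => k * f x) = k * Iint a b f.
Proof. by move=> hf; exact: RintegralZl. Qed.

Lemma Iint_ge0 {R : realType} (a b : R) (f : R -> R) :
  (forall x, a <= x <= b -> 0 <= f x) -> 0 <= Iint a b f.
Proof. by move=> h; apply: Rintegral_ge0 => x; rewrite /= in_itv /= => /h. Qed.

Lemma Iint_le {R : realType} (a b : R) (f g : R -> R) : itg a b f -> itg a b g ->
  (forall x, a <= x <= b -> f x <= g x) -> Iint a b f <= Iint a b g.
Proof. by move=> hf hg h; apply: le_Rintegral => // x; rewrite /= in_itv /= => /h. Qed.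

Lemma Iint_abs {R : realType} (a b : R) (f : R -> R) : itg a b f ->
  `|Iint a b f| <= Iint a b (fun x => `|f x|).
Proof. by move=> hf; exact: le_normr_Rintegral. Qed.

Lemma Iint_cst {R : realType} (a b k : R) : a <= b -> Iint a b (fun=> k) = k * (b - a).
Proof.
move=> ab; rewrite /Iint Rintegral_cst//= lebesgue_measure_itv/= lte_fin.
by case: ltgtP ab => //= -> _; rewrite subrr mulr0.
Qed.

Lemma Iint_pt {R : realType} (a : R) (f : R -> R) : Iint a a f = 0.
Proof. by rewrite /Iint set_itv1 Rintegral_set1. Qed.

Lemma Iint_chasles {R : realType} (a b c : R) (f : R -> R) : a <= b -> b <= c ->
  itg a c f -> Iint a c f = Iint a b f + Iint b c f.
Proof.
move=> ab bc hf.
have h := @Rintegral_itvB _ f (BLeft a) (BRight c) b hf.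
have h1 : Rintegral (@lebesgue_measure R) `]b, c] f = Iint b c f.
  apply: Rintegral_itv_obnd_cbnd; apply: integrableS hf => //.
  by apply: subset_itv; rewrite bnd_simp.
by move: h; rewrite h1 !bnd_simp => /(_ ab bc) <-; rewrite addrC subrK.
Qed.

Lemma Iint_FTC_on {R : realType} (a b : R) (F f : R -> R) : a <= b ->
  (forall x : R, a <= x <= b -> is_derive x 1 F (f x)) -> continuous f ->
  Iint a b f = F b - F a.
Proof.
rewrite le_eqVlt => /predU1P[-> _ _|ab dF cf]; first by rewrite Iint_pt subrr.
have dF' x : x \in `]a, b[ -> is_derive x 1 F (f x).
  by rewrite in_itv /= => /andP[? ?]; apply: dF; rewrite !ltW.
rewrite /Iint /Rintegral (@continuous_FTC2 _ f F)//=.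
- exact: continuous_subspaceT.
- split; first by move=> x /dF'; case.
  + by apply: cvg_at_right_filter; apply: der_cont (dF a _); rewrite lexx ltW.
  + by apply: cvg_at_left_filter; apply: der_cont (dF b _); rewrite lexx ltW.
- by move=> x /dF' /derE[].
Qed.

Lemma Iint_FTC {R : realType} (a b : R) (F f : R -> R) : a <= b ->
  (forall x : R, is_derive x 1 F (f x)) -> continuous f -> Iint a b f = F b - F a.
Proof. by move=> ab dF; apply: Iint_FTC_on. Qed.

Lemma prim_ex {R : realType} (f : R -> R) : continuous f ->
  exists F : R -> R, forall x : R, is_derive x 1 F (f x).
Proof.
move=> cf.
(* One of the two integrals runs over an empty interval or a point, so this is the oriented integral
   from 0 to [x]. *)
pose F x := Iint 0 x f - Iint x 0 f.
have FE a x : a <= 0 -> a <= x -> F x = Iint a x f - Iint a 0 f.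
  move=> a0 ax; rewrite /F; case: (leP 0 x) => x0.
    rewrite (Iint_chasles a 0 x)//; last exact: itg_cont.
    suff -> : Iint x 0 f = 0 by ring.
    move: x0; rewrite le_eqVlt => /predU1P[<-|x0]; first exact: Iint_pt.
    by rewrite /Iint set_itv_ge ?Rintegral_set0// bnd_simp -ltNge.
  rewrite (Iint_chasles a x 0)// ?(ltW x0)//; last exact: itg_cont.
  suff -> : Iint 0 x f = 0 by ring.
  by rewrite /Iint set_itv_ge ?Rintegral_set0// bnd_simp -ltNge.
exists F => x.
(* A base point to the left of both 0 and [x]: near [x], [FE] makes [F] an ordinary integral from
   [a] up to a constant. *)
pose a := Num.min 0 x - 1.
have a0 : a <= 0 by rewrite /a lerBlDr ge_min add0r ler01.
have ax : a < x by rewrite /a ltrBlDr gt_min ltrDl ltr01 orbT.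
have x1 : x < x + 1 by rewrite ltrDl ltr01.
have [d1 d2] := @continuous_FTC1_closed _ f a x (x + 1) x1 (itg_cont _ _ _ cf) ax (cf x).
apply: (derivE_on _ (fun y => Iint a y f - Iint a 0 f) _ a (x + 1)).
- by rewrite ax x1.
- by move=> y /andP[ay _]; exact: FE a0 (ltW ay).
- have dI : is_derive x 1 (fun y => Iint a y f) (f x).
    by rewrite -d2 derive1E; exact: derivableP.
  by derive_eq; rewrite addr0.
Qed.

(** * Square-integrable functions *)

Lemma discr_le {R : realType} (A B C : R) : 0 <= C ->
  (forall t, 0 <= A + 2 * t * B + t ^+ 2 * C) -> B ^+ 2 <= A * C.
Proof.
rewrite le_eqVlt => /predU1P[<-|C0] h.
  have [->|B0] := eqVneq B 0; first by rewrite mulr0 expr0n.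
  have := h (- (A + 1) / (2 * B)); rewrite mulr0 addr0.
  have -> : A + 2 * (- (A + 1) / (2 * B)) * B = -1 by field.
  by rewrite ler0N1.
have Cn0 : C != 0 by rewrite gt_eqF.
have := h (- B / C).
have -> : A + 2 * (- B / C) * B + (- B / C) ^+ 2 * C = A - B ^+ 2 / C by field.
by rewrite subr_ge0 ler_pdivrMr.
Qed.

Lemma itg_measurable_ext {R : realType} (a b : R) (f g : R -> R) :
  (forall x, a < x < b -> f x = g x) -> measurable_fun `[a, b] g ->
  measurable_fun `[a, b] f.
Proof.
move=> fg mg; apply: (@measurable_fun_itv_cc _ a b false true).
have mg' : measurable_fun `]a, b[ g.
  by apply: measurable_funS mg => //; apply: subset_itv; rewrite bnd_simp.
by apply: eq_measurable_fun mg' => x; rewrite inE /= in_itv /= => /fg.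
Qed.

Lemma IintE_oo {R : realType} (a b : R) (f g : R -> R) :
  (forall x, a < x < b -> f x = g x) -> measurable_fun `[a, b] g ->
  Iint a b f = Iint a b g.
Proof.
move=> fg mg; have mf := itg_measurable_ext _ _ _ _ fg mg.
have E h : measurable_fun `[a, b] h ->
    Iint a b h = Rintegral (@lebesgue_measure R) `]a, b[ h.
  move=> mh; rewrite /Iint /Rintegral; congr fine; apply: integral_itv_bndoo.
  apply/measurable_EFinP.
  by apply: measurable_funS mh => //; apply: subset_itv; rewrite bnd_simp.
rewrite !E//; apply: eq_Rintegral => x; rewrite inE /= in_itv /= => xab.
exact: fg.
Qed.

Lemma itg_bmul {R : realType} (a b K : R) (f g : R -> R) : measurable_fun `[a, b] g ->
  (forall x, a <= x <= b -> `|g x| <= K) -> itg a b f -> itg a b (fun x => g x * f x).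
Proof.
move=> mg gK hf.
apply: (itg_dom _ _ _ (fun x => K * `|f x|)).
- by apply: measurable_funM => //; exact: itg_mfun.
- by apply: itgZ; have := integrable_norm hf.
- by move=> x xab; rewrite normrM ler_wpM2r// gK.
Qed.

Lemma L2on_mul {R : realType} (a b : R) (f g : R -> R) :
  L2on `[a, b] f -> L2on `[a, b] g -> itg a b (fun x => f x * g x).
Proof.
move=> [mf hf] [mg hg]; apply: itg_dom (itgD _ _ _ _ hf hg) _.
  exact: measurable_funM.
move=> x _; rewrite ler_norml; have := sqr_ge0 (f x - g x); have := sqr_ge0 (f x + g x).
by move=> h1 h2; apply/andP; split; nra.
Qed.

Lemma L2on_itg {R : realType} (a b : R) (f : R -> R) : L2on `[a, b] f -> itg a b f.
Proof.
move=> [mf hf]; apply: itg_dom (itgD _ _ _ (fun=> 1) hf (itg_cont _ _ _ (contC _))) _ => //.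
move=> x _; rewrite ler_norml; have := sqr_ge0 (f x - 1); have := sqr_ge0 (f x + 1).
by move=> h1 h2; apply/andP; split; nra.
Qed.

Lemma L2on_cont {R : realType} (a b : R) (f : R -> R) : continuous f -> L2on `[a, b] f.
Proof.
move=> cf; split; last by apply: itg_cont; exact: contX.
by apply: itg_mfun; exact: itg_cont.
Qed.

Lemma L2on_add {R : realType} (a b : R) (f g : R -> R) :
  L2on `[a, b] f -> L2on `[a, b] g -> L2on `[a, b] (fun x => f x + g x).
Proof.
move=> hf hg; have [mf f2] := hf; have [mg g2] := hg.
split; first exact: measurable_funD.
have -> : (fun x => ((f x + g x) ^+ 2)%:E) =
          EFin \o (fun x => (f x ^+ 2 + 2 * (f x * g x)) + g x ^+ 2).
  by apply/funext => x /=; congr EFin; ring.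
by apply: itgD => //; apply: itgD => //; apply: itgZ; exact: L2on_mul.
Qed.

Lemma L2on_bmul {R : realType} (a b K : R) (f g : R -> R) : measurable_fun `[a, b] g ->
  (forall x, a <= x <= b -> `|g x| <= K) -> L2on `[a, b] f ->
  L2on `[a, b] (fun x => g x * f x).
Proof.
move=> mg gK [mf f2]; split; first exact: measurable_funM.
have -> : (fun x => ((g x * f x) ^+ 2)%:E) = EFin \o (fun x => g x ^+ 2 * f x ^+ 2).
  by apply/funext => x /=; congr EFin; ring.
apply: (itg_bmul _ _ (K ^+ 2)) => //; first exact: measurable_funX.
by move=> x /gK gx; rewrite normrX lerXn2r// nnegrE// (le_trans _ gx).
Qed.

Lemma L2on_scale {R : realType} (a b k : R) (f : R -> R) :
  L2on `[a, b] f -> L2on `[a, b] (fun x => k * f x).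
Proof. by move=> hf; apply: (L2on_bmul _ _ `|k|) => //; exact: measurable_cst. Qed.

Lemma L2on_sub {R : realType} (a b c d : R) (f : R -> R) : a <= c -> d <= b ->
  L2on `[a, b] f -> L2on `[c, d] f.
Proof.
move=> ac db [mf f2]; split; last exact: itg_sub ac db f2.
by apply: measurable_funS mf => //; apply: subset_itv; rewrite bnd_simp.
Qed.

Lemma cauchy_schwarz {R : realType} (a b : R) (f g : R -> R) :
  L2on `[a, b] f -> L2on `[a, b] g ->
  Iint a b (fun x => f x * g x) ^+ 2 <=
  Iint a b (fun x => f x ^+ 2) * Iint a b (fun x => g x ^+ 2).
Proof.
move=> hf hg; have [mf f2] := hf; have [mg g2] := hg.
have fg := L2on_mul _ _ _ _ hf hg.
apply: discr_le; first by apply: Iint_ge0 => x _; exact: sqr_ge0.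
move=> t.
have -> : Iint a b (fun x => f x ^+ 2) + 2 * t * Iint a b (fun x => f x * g x)
   + t ^+ 2 * Iint a b (fun x => g x ^+ 2) = Iint a b (fun x => (f x + t * g x) ^+ 2).
  rewrite -IintZ// -IintZ// -IintD//; last exact: itgZ.
  rewrite -IintD//; [|by apply: itgD => //; exact: itgZ|exact: itgZ].
  by apply: IintE => x _; ring.
by apply: Iint_ge0 => x _; exact: sqr_ge0.
Qed.

(** * Continuous representatives *)

Lemma Iint_sqr_le {R : realType} (a b : R) (f : R -> R) : 0 <= a -> a <= b -> b <= 1 ->
  L2on `[0, 1] f ->
  Iint a b f ^+ 2 <= (b - a) * Iint 0 1 (fun x => f x ^+ 2).
Proof.
move=> a0 ab b1 hf; have hab := L2on_sub _ _ _ _ _ a0 b1 hf.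
have := cauchy_schwarz _ _ _ _ (L2on_cont a b _ (contC 1)) hab.
have -> : Iint a b (fun x => 1 * f x) = Iint a b f by apply: IintE => x _; rewrite mul1r.
have -> : Iint a b (fun x => 1 ^+ 2) = b - a.
  by rewrite -[RHS]mul1r -Iint_cst//; apply: IintE => x _; rewrite expr1n.
move=> h; apply: le_trans h _; rewrite ler_wpM2l ?subr_ge0//.
have [_ f2] := hf.
rewrite (Iint_chasles 0 a 1)// ?(le_trans ab)//.
rewrite (Iint_chasles a b 1)//; last exact: (itg_sub 0 1).
by rewrite addrCA lerDl addr_ge0//; apply: Iint_ge0 => x _; exact: sqr_ge0.
Qed.

(** Projection onto [0, 1]. Composing with it extends a function controlled only on the interval to
    a continuous function on the line, where continuity goals are solved automatically. *)
Definition clamp {R : realType} (x : R) : R := Num.max 0 (Num.min 1 x).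

Lemma clamp_id {R : realType} (x : R) : 0 <= x <= 1 -> clamp x = x.
Proof. by move=> /andP[x0 x1]; rewrite /clamp (min_idPr x1) (max_idPr x0). Qed.

Lemma clamp_in {R : realType} (x : R) : 0 <= clamp x <= 1.
Proof. by rewrite /clamp le_max lexx ge_max ler01 ge_min lexx. Qed.

Lemma clamp_lip {R : realType} (x y : R) : `|clamp x - clamp y| <= `|x - y|.
Proof.
have C (z : R) : [\/ z <= 0 /\ clamp z = 0, (0 <= z /\ z <= 1) /\ clamp z = z
    | 1 <= z /\ clamp z = 1].
  have [z0|/ltW z0] := leP z 0.
    apply: Or31; split => //; apply/eqP; rewrite /clamp eq_le le_max lexx ge_max lexx.
    by rewrite ge_min z0 orbT.
  have [z1|/ltW z1] := leP z 1; first by apply: Or32; rewrite clamp_id// z0 z1.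
  by apply: Or33; rewrite /clamp (min_idPl z1) (max_idPr ler01).
wlog xy : x y / x <= y.
  move=> H; case: (leP x y) => [|/ltW] xy; first exact: H.
  by rewrite distrC (distrC x); exact: H.
rewrite distrC (distrC x) (ger0_norm (_ : 0 <= y - x)) ?subr_ge0// ler_norml.
by apply/andP; case: (C x) => -[? ->]; case: (C y) => -[? ->]; split; lra.
Qed.

(** The hypothesis is Hölder continuity of exponent 1/2, the regularity that Cauchy-Schwarz gives to
    a primitive of a square-integrable function. *)
Lemma clamp_cont {R : realType} (K : R) (g : R -> R) :
  (forall a b, 0 <= a -> a <= b -> b <= 1 -> (g b - g a) ^+ 2 <= (b - a) * K) ->
  continuous (fun x => g (clamp x)).
Proof.
move=> hg x; apply/cvgrPdist_le => e e0.
pose d := e ^+ 2 / (`|K| + 1).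
have K1 : 0 < `|K| + 1 by rewrite ltr_wpDl.
have d0 : 0 < d by rewrite divr_gt0// exprn_gt0.
have : \forall t \near x, `|x - t| < d by exact: (nbhsx_ballx x d d0).
apply: filterS => t xt /=.
have H a b : `|a - b| < d -> 0 <= a -> a <= b -> b <= 1 -> `|g b - g a| <= e.
  move=> abd a0 ab b1; rewrite -(@ler_pXn2r _ 2)// ?nnegrE ?(ltW e0)//.
  rewrite -normrX ger0_norm ?sqr_ge0//.
  apply: le_trans (hg _ _ a0 ab b1) _.
  have ba : b - a < d by rewrite distrC ger0_norm ?subr_ge0 in abd.
  have bK : (b - a) * K <= (b - a) * (`|K| + 1).
    by rewrite ler_wpM2l ?subr_ge0// ler_wpDr// ler_norm.
  by apply: le_trans bK _; rewrite -ler_pdivlMr// ltW.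
have cd := le_lt_trans (clamp_lip x t) xt.
have /andP[x0 x1] := clamp_in x; have /andP[t0 t1] := clamp_in t.
have [xt'|/ltW xt'] := leP (clamp x) (clamp t).
  by rewrite distrC; exact: H.
by apply: H => //; rewrite distrC.
Qed.

Lemma cont_ext {R : realType} (g dg : R -> R) : L2on `[0, 1] dg ->
  (forall a b, 0 <= a -> a <= b -> b <= 1 -> g b - g a = Iint a b dg) ->
  continuous (fun x => g (clamp x)).
Proof.
move=> hd hg; apply: (clamp_cont (Iint 0 1 (fun x => dg x ^+ 2))) => a b a0 ab b1.
by rewrite hg//; exact: Iint_sqr_le.
Qed.

Lemma cont_measurable {R : realType} (a b : R) (f g : R -> R) : continuous g ->
  (forall x, a <= x <= b -> f x = g x) -> measurable_fun `[a, b] f.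
Proof.
move=> cg fg; apply: (itg_measurable_ext _ _ _ g) => [x /andP[ax xb]|].
  by rewrite fg// !ltW.
by apply: itg_mfun; exact: itg_cont.
Qed.

Lemma cont_bounded {R : realType} (a b : R) (f : R -> R) : continuous f ->
  exists2 K, 0 <= K & forall x, a <= x <= b -> `|f x| <= K.
Proof.
move=> cf; have [ab|ab] := leP a b; last first.
  by exists 0 => // x /andP[ax xb]; move: (le_trans ax xb); rewrite leNgt ab.
have [c _ cm] := EVT_max ab (continuous_subspaceT (contAbs _ cf)).
by exists `|f c| => // x xab; apply: cm; rewrite in_itv.
Qed.

(** Off []0, 1[] minus the zero set, [dphi] is arbitrary and possibly not measurable. Extending it
    by zero gives a square-integrable function on [0, 1] with the same energy, because every phase
    term carries a power of [v] and the endpoints are negligible. *)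
Lemma patch_dphi {R : realType} (v dv phi dphi : R -> R) :
  admissible v dv phi dphi -> exists w,
  [/\ L2on `[0, 1] w,
      (forall x, 0 < x < 1 -> v x != 0 -> w x = dphi x),
      (forall a b, 0 <= a -> a <= b -> b <= 1 ->
         (forall x, a <= x <= b -> v x != 0) -> phi b - phi a = Iint a b w)
    & forall eps delta kappa,
        Gfun eps delta kappa v dv phi dphi = Gfun eps delta kappa v dv phi w].
Proof.
move=> [hdv hv [[mdphi dphi2] _] hphi _].
set D := (`]0, 1[ `\` zeroset v) in mdphi dphi2.
have cv := cont_ext v dv hdv hv.
have mv : measurable_fun `[0 : R, 1] v.
  by apply: (cont_measurable _ _ _ _ cv) => x x01; rewrite clamp_id.
have mD : measurable D.
  apply: measurableD => //.
  have -> : zeroset v = `[0, 1] `&` v @^-1` [set 0].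
    by apply/seteqP; split => x /=; rewrite in_itv.
  exact: mv.
pose w := dphi \_ D.
have mw : measurable_fun setT w by exact: ((measurable_restrictT dphi mD).1 mdphi).
have wE x : 0 < x < 1 -> v x != 0 -> w x = dphi x.
  move=> x01 vx; rewrite /w patchE ifT// inE; split; first by rewrite /= in_itv.
  by case=> _ /eqP; rewrite (negbTE vx).
have hw : L2on `[0, 1] w.
  split; first exact: measurable_funS mw.
  have := (@integrable_restrict _ _ _ (@lebesgue_measure R) D mD `[0, 1] (measurable_itv _)
    (fun x => (dphi x ^+ 2)%:E)).1.
  rewrite setIidr; last first.
    by move=> x [] /=; rewrite !in_itv /= => /andP[? ?] _; rewrite !ltW.
  move=> /(_ dphi2); apply: eq_integrable => // x _.
  by rewrite /w !patchE; case: ifP => // _; rewrite expr0n.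
exists w; split => //.
- move=> a b a0 ab b1 vn; rewrite hphi//; apply: IintE_oo => [x xab|].
    rewrite wE//; last by apply: vn; case/andP: xab => ? ?; rewrite !ltW.
    by case/andP: xab => ax xb; rewrite (le_lt_trans a0)// (lt_le_trans xb).
  exact: measurable_funS mw.
- move=> eps delta kappa; rewrite /Gfun.
  have E x : 0 < x < 1 -> v x = 0 \/ w x = dphi x.
    by move=> x01; have [|vx] := eqVneq (v x) 0; [left|right; exact: wE].
  have mw' : measurable_fun `[0 : R, 1] w by exact: measurable_funS mw.
  congr (_ + 8^-1 * _ + _ - _ * _); apply: IintE_oo.
  + by move=> x /E[->|->//]; rewrite expr0n /= !mul0r.
  + by apply: measurable_funM; exact: measurable_funX.
  + by move=> x /E[->|->//]; rewrite expr0n /= !mul0r.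
  + by apply: measurable_funM => //; exact: measurable_funX.
Qed.

(** * Energy bounds *)

Definition Ev {R : realType} (eps : R) (v dv : R -> R) : R :=
  2^-1 * Iint 0 1 (fun x => dv x ^+ 2)
  + (4 * eps ^+ 2)^-1 * Iint 0 1 (fun x => (1 - v x ^+ 2) ^+ 2).

Lemma L2on_subset {R : realType} (D E : set R) (f : R -> R) :
  measurable D -> measurable E -> E `<=` D -> L2on D f -> L2on E f.
Proof.
move=> mD mE ED [mf f2]; split; first exact: measurable_funS mf.
exact: integrableS f2.
Qed.

Lemma admissible_pos {R : realType} (v dv phi dphi : R -> R) :
  L2on `[0, 1] dv ->
  (forall a b, 0 <= a -> a <= b -> b <= 1 -> v b - v a = Iint a b dv) ->
  (forall x, 0 <= x <= 1 -> v x != 0) ->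
  L2on `[0, 1] dphi ->
  (forall a b, 0 <= a -> a <= b -> b <= 1 -> phi b - phi a = Iint a b dphi) ->
  phi 0 = 0 -> Iint 0 1 (fun x => v x ^+ 2) = 1 ->
  admissible v dv phi dphi.
Proof.
move=> hdv hv vn hdphi hphi phi0 v1.
have DE : `]0, 1[ `\` zeroset v = `]0, 1[%classic.
  rewrite setDidl//; apply/seteqP; split => x //= -[]; rewrite in_itv /= => x01.
  by case=> /vn /eqP.
have sub : `]0 : R, 1[%classic `<=` `[0, 1]%classic by apply: subset_itv; rewrite bnd_simp.
have cphi := cont_ext _ _ hdphi hphi.
split => //; last first.
- by move=> a b a0 ab b1 _; exact: hphi.
- rewrite DE; split; apply: (L2on_subset `[0, 1]%classic) => //.
  have [m i] := L2on_cont 0 1 _ cphi; split.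
    by apply: (cont_measurable _ _ _ _ cphi) => x x01; rewrite clamp_id.
  apply: eq_integrable i => // x; rewrite inE /= in_itv /= => x01.
  by rewrite clamp_id.
Qed.

(** The modulus 1 satisfies the constraint and annihilates the first two terms. All upper bounds
    below come from this one by choosing [psi]. *)
Lemma competitor {R : realType} (eps delta kappa : R) (v dv phi dphi psi dpsi : R -> R) :
  minimizer eps delta kappa v dv phi dphi ->
  (forall x : R, is_derive x 1 psi (dpsi x)) -> continuous dpsi -> psi 0 = 0 ->
  Gfun eps delta kappa v dv phi dphi <=
  8^-1 * Iint 0 1 (fun x => dpsi x ^+ 2)
  + delta / (8 * eps ^+ 2) * Iint 0 1 (fun x => sin (psi x) ^+ 2)
  - kappa / 2 * psi 1.
Proof.
move=> [_ hmin] dP cdP P0.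
have adm : admissible (fun=> 1) (fun=> 0) psi dpsi.
  apply: admissible_pos => //.
  - by apply: L2on_cont; exact: contC.
  - by move=> a b a0 ab b1; rewrite subrr Iint_cst// mul0r.
  - by apply: L2on_cont; assumption.
  - by move=> a b _ ab _; rewrite (Iint_FTC _ _ psi).
  - by rewrite (IintE _ _ _ (fun=> 1)) ?Iint_cst// ?subr0 ?mulr1// => x _; rewrite expr1n.
apply: le_trans (hmin _ _ _ _ adm) _; rewrite /Gfun le_eqVlt; apply/orP; left; apply/eqP.
have -> : Iint 0 1 (fun=> (0 : R) ^+ 2) = 0 by rewrite Iint_cst// expr0n mul0r.
have -> : Iint 0 1 (fun=> ((1 : R) - 1 ^+ 2) ^+ 2) = 0.
  by rewrite Iint_cst// expr1n subrr expr0n mul0r.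
have -> : Iint 0 1 (fun x : R => 1 ^+ 2 * dpsi x ^+ 2) = Iint 0 1 (fun x => dpsi x ^+ 2).
  by apply: IintE => x _; rewrite expr1n mul1r.
have -> : Iint 0 1 (fun x : R => 1 ^+ 4 * sin (psi x) ^+ 2) = Iint 0 1 (fun x => sin (psi x) ^+ 2).
  by apply: IintE => x _; rewrite expr1n mul1r.
have -> : Iint 0 1 (fun x : R => 1 ^+ 2 * dpsi x) = psi 1.
  have := Iint_FTC 0 1 psi dpsi ler01 dP cdP; rewrite P0 subr0 => <-.
  by apply: IintE => x _; rewrite expr1n mul1r.
by rewrite !mulr0 !add0r.
Qed.

Lemma Gfun_le0 {R : realType} (eps delta kappa : R) (v dv phi dphi : R -> R) :
  minimizer eps delta kappa v dv phi dphi -> Gfun eps delta kappa v dv phi dphi <= 0.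
Proof.
move=> hm; have := competitor _ _ _ _ _ _ _ (fun=> 0) (fun=> 0) hm (derC 0) (contC 0) erefl.
have -> : Iint 0 1 (fun=> (0 : R) ^+ 2) = 0 by rewrite Iint_cst// expr0n mul0r.
have -> : Iint 0 1 (fun=> sin (0 : R) ^+ 2) = 0 by rewrite Iint_cst// sin0 expr0n mul0r.
by rewrite !mulr0 subr0 addr0.
Qed.

Lemma Ev_le {R : realType} (eps delta kappa : R) (v dv phi dphi : R -> R) :
  0 < delta ->
  minimizer eps delta kappa v dv phi dphi -> Ev eps v dv <= kappa ^+ 2 / 2.
Proof.
move=> d0 hm; have [adm _] := hm.
have := Gfun_le0 _ _ _ _ _ _ _ hm.
have [w [hw _ _ ->]] := patch_dphi _ _ _ _ adm.
have [hdv hv _ _ [_ v1]] := adm.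
have cv := cont_ext v dv hdv hv.
have vE x : 0 <= x <= 1 -> v (clamp x) = v x by move=> x01; rewrite clamp_id.
have [K K0 vK] := cont_bounded 0 1 _ cv.
have v2 : itg 0 1 (fun x => v x ^+ 2).
  have := itg_cont 0 1 _ (contX _ 2 cv); apply: eq_integrable => // x.
  by rewrite inE /= in_itv /= => x01; rewrite vE.
have mv2 := itg_mfun _ _ _ v2.
have v2K x : 0 <= x <= 1 -> `|v x ^+ 2| <= K ^+ 2.
  move=> x01; rewrite normrX lerXn2r// ?nnegrE//.
  by have := vK x x01; rewrite vE.
have i1 : itg 0 1 (fun x => v x ^+ 2 * w x ^+ 2).
  by apply: (itg_bmul _ _ (K ^+ 2)) => //; case: hw.
have i2 : itg 0 1 (fun x => v x ^+ 2 * w x).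
  by apply: (itg_bmul _ _ (K ^+ 2)) => //; exact: L2on_itg.
rewrite /Gfun -/(Ev eps v dv) => G0.
have s0 : 0 <= delta / (8 * eps ^+ 2) * Iint 0 1 (fun x => v x ^+ 4 * sin (phi x) ^+ 2).
  rewrite mulr_ge0//; last first.
    by apply: Iint_ge0 => x _; rewrite mulr_ge0// ?sqr_ge0// exprn_even_ge0.
  by rewrite divr_ge0 ?(ltW d0)// mulr_ge0// sqr_ge0.
(* Expanding this square reproduces the kinetic and twist terms; the constraint [int v^2 = 1] makes
   what remains a constant. *)
have : 0 <= Iint 0 1 (fun x => v x ^+ 2 * (w x - 2 * kappa) ^+ 2).
  by apply: Iint_ge0 => x _; rewrite mulr_ge0// sqr_ge0.
have -> : Iint 0 1 (fun x => v x ^+ 2 * (w x - 2 * kappa) ^+ 2) =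
   Iint 0 1 (fun x => v x ^+ 2 * w x ^+ 2) - 4 * kappa * Iint 0 1 (fun x => v x ^+ 2 * w x)
   + 4 * kappa ^+ 2.
  have -> : 4 * kappa ^+ 2 = 4 * kappa ^+ 2 * Iint 0 1 (fun x => v x ^+ 2).
    by rewrite v1 mulr1.
  rewrite -!IintZ//.
  rewrite -IintB//; last exact: itgZ.
  rewrite -IintD//; last exact: itgZ; last first.
    by apply: itgD => //; apply: itgN; exact: itgZ.
  by apply: IintE => x _; ring.
by move: G0 s0; set p := _ / _ * _; lra.
Qed.

Lemma Ev_ge0 {R : realType} (eps : R) (v dv : R -> R) : 0 <= Ev eps v dv.
Proof.
have e20 : 0 <= (4 * eps ^+ 2)^-1 by rewrite invr_ge0 mulr_ge0// sqr_ge0.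
by apply: addr_ge0; apply: mulr_ge0 => //; apply: Iint_ge0 => x _; exact: sqr_ge0.
Qed.

(** Let [t = |1 - v x|]. On a window of length [eps/2] next to [x], [v] moves by at most
    [sqrt (eps Ev)], which is below [t/2] if the claim fails. The potential integral is then at
    least [(t^2/4)(eps/2)], while it is at most [4 eps^2 Ev]; this is where 32 comes from. Since
    [v >= 0], [(1 - v^2)^2] dominates [(1 - v)^2]. *)
Lemma sup_sqr_le {R : realType} (eps : R) (v dv phi dphi : R -> R) :
  0 < eps <= 1 -> admissible v dv phi dphi -> (forall x, 0 <= x <= 1 -> 0 <= v x) ->
  forall x, 0 <= x <= 1 -> (1 - v x) ^+ 2 <= 32 * (eps * Ev eps v dv).
Proof.
move=> /andP[e0 e1] [hdv hv _ _ _] vp x /andP[x0 x1].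
rewrite leNgt; apply/negP => lt.
have cv := cont_ext v dv hdv hv.
have vE y : 0 <= y <= 1 -> v (clamp y) = v y by move=> y01; rewrite clamp_id.
set A := Iint 0 1 (fun x => dv x ^+ 2).
set B := Iint 0 1 (fun x => (1 - v x ^+ 2) ^+ 2).
have A0 : 0 <= A by apply: Iint_ge0 => y _; exact: sqr_ge0.
have B0 : 0 <= B by apply: Iint_ge0 => y _; exact: sqr_ge0.
have iB : itg 0 1 (fun x => (1 - v x ^+ 2) ^+ 2).
  have cB : continuous (fun x => (1 - v (clamp x) ^+ 2) ^+ 2).
    apply: (contX (fun x => 1 - v (clamp x) ^+ 2)); apply: contD; first exact: contC.
    by apply: contN; exact: contX.
  have := itg_cont 0 1 _ cB; apply: eq_integrable => // y.
  by rewrite inE /= in_itv /= => y01; rewrite vE.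
have AE : A / 2 <= Ev eps v dv.
  by rewrite /Ev -/A -/B mulrC lerDl mulr_ge0// invr_ge0 mulr_ge0// sqr_ge0.
have BE : B <= 4 * eps ^+ 2 * Ev eps v dv.
  rewrite -ler_pdivrMl ?mulr_gt0 ?exprn_gt0// /Ev -/A -/B lerDr.
  by rewrite mulr_ge0// invr_ge0.
pose t := `|1 - v x|.
have tE : (1 - v x) ^+ 2 = t ^+ 2 by rewrite /t -normrX ger0_norm ?sqr_ge0.
rewrite tE in lt.
have key a b : 0 <= a -> b <= 1 -> b - a = eps / 2 -> a <= x <= b -> False.
  move=> a0 b1 ab /andP[ax xb].
  have ab' : a <= b by exact: le_trans xb.
  have far y : a <= y <= b -> t / 2 <= `|1 - v y|.
    move=> /andP[ay yb].
    have near : (v y - v x) ^+ 2 <= (eps / 2) * A.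
      have [xy|/ltW yx] := leP x y.
        rewrite hv ?(le_trans yb)//.
        apply: le_trans (Iint_sqr_le _ _ _ _ xy _ hdv) _ => //; first exact: le_trans yb _.
        by rewrite ler_wpM2r//; lra.
      rewrite -[_ ^+ 2]sqrrN opprB hv ?(le_trans a0)//.
      apply: le_trans (Iint_sqr_le _ _ _ _ yx _ hdv) _ => //; first exact: le_trans a0 _.
      by rewrite ler_wpM2r//; lra.
    have near2 : `|v y - v x| <= t / 2.
      rewrite -(@ler_pXn2r _ 2)// ?nnegrE ?divr_ge0 ?normr_ge0//.
      rewrite -normrX ger0_norm ?sqr_ge0//; apply: le_trans near _.
      have := ler_wpM2l (ltW e0) AE.
      have := mulr_ge0 (ltW e0) A0; have -> : (t / 2) ^+ 2 = t ^+ 2 / 4 by field.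
      by lra.
    have : t <= `|1 - v y| + `|v y - v x|.
      by rewrite /t (le_trans _ (ler_normD _ _))// addrA subrK.
    by lra.
  have lowB : (t ^+ 2 / 4) * (eps / 2) <= B.
    rewrite -ab -Iint_cst//.
    apply: (@le_trans _ _ (Iint a b (fun x => (1 - v x ^+ 2) ^+ 2))).
      apply: Iint_le; first by apply: itg_cont; cont.
        exact: (itg_sub 0 1).
      move=> y yab; have /andP[ay yb] := yab.
      have vy : 0 <= v y by apply: vp; rewrite (le_trans a0)// (le_trans yb).
      have -> : (1 - v y ^+ 2) ^+ 2 = (1 - v y) ^+ 2 * (1 + v y) ^+ 2 by ring.
      have h1 : t ^+ 2 / 4 <= (1 - v y) ^+ 2.
        have -> : t ^+ 2 / 4 = (t / 2) ^+ 2 by field.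
        rewrite -[leRHS]ger0_norm ?sqr_ge0// normrX.
        by rewrite lerXn2r ?nnegrE ?divr_ge0 ?normr_ge0//; exact: far.
      apply: le_trans h1 _; rewrite ler_peMr ?sqr_ge0// exprn_ege1//.
      by rewrite lerDl.
    rewrite /B (Iint_chasles 0 a 1)// ?(le_trans ab')//.
    rewrite (Iint_chasles a b 1)//; last exact: (itg_sub 0 1).
    by rewrite addrCA lerDl addr_ge0//; apply: Iint_ge0 => y _; exact: sqr_ge0.
  have : eps * (32 * (eps * Ev eps v dv)) < eps * t ^+ 2 by rewrite ltr_pM2l.
  by move: BE lowB; rewrite expr2; nra.
(* The window is laid towards the farther endpoint; it fits because [eps <= 1]. *)
have [xh|xh] := leP x 2^-1.
  by apply: (key x (x + eps / 2)) => //; [lra|ring|rewrite lexx; lra].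
by apply: (key (x - eps / 2) x) => //; [lra|ring|rewrite lexx andbT; lra].
Qed.

(** * The Euler-Lagrange equation for the phase *)

Lemma itg_cmul {R : realType} (a b : R) (f g : R -> R) : continuous g -> itg a b f ->
  itg a b (fun x => g x * f x).
Proof.
move=> cg hf; have [K _ gK] := cont_bounded a b _ cg.
by apply: (itg_bmul _ _ K) => //; apply: itg_mfun; exact: itg_cont.
Qed.

Lemma lin_eq0 {R : realType} (A B : R) :
  (forall t, 0 <= t * A + t ^+ 2 * B) -> A = 0.
Proof.
move=> h; apply/eqP; rewrite -sqrf_eq0 eq_le sqr_ge0 andbT.
have B1 : 0 < `|B| + 1 by rewrite ltr_wpDl.
(* A step small enough for the linear term to beat the quadratic one, with no division by [B]. *)
have := h (- A / (`|B| + 1)).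
have -> : - A / (`|B| + 1) * A + (- A / (`|B| + 1)) ^+ 2 * B =
   (- (`|B| + 1 - B) * A ^+ 2) / (`|B| + 1) ^+ 2 by field; rewrite gt_eqF.
rewrite pmulr_lge0 ?invr_gt0 ?exprn_gt0// mulNr oppr_ge0 pmulr_rle0//.
by have := ler_norm B; lra.
Qed.

Lemma sin_lip {R : realType} (x y : R) : `|sin x - sin y| <= `|x - y|.
Proof.
rewrite -[leRHS]mul1r.
exact: (lip_of_der _ _ 1 (@is_derive_sin R) (@cos_max R)).
Qed.

(** An expansion with explicit quadratic remainder, the second derivative [2 cos (2 x)] of [sin^2]
    being at most 2. The one-sided form suffices for the first variation, since minimality only
    calls for an upper bound on the energy of competitors; no limit under the integral is taken. *)
Lemma sin_sqr_le {R : realType} (x h : R) :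
  sin (x + h) ^+ 2 <= sin x ^+ 2 + 2 * h * (sin x * cos x) + h ^+ 2.
Proof.
wlog h0 : x h / 0 <= h => [H|].
  have [|/ltW h0] := leP 0 h; first exact: H.
  have := H (- x) (- h); rewrite -opprD !sinN cosN oppr_ge0 => /(_ h0).
  by rewrite !sqrrN mulrN !mulNr mulrN opprK.
pose g y := sin x ^+ 2 + 2 * y * (sin x * cos x) + y ^+ 2 - sin (x + y) ^+ 2.
pose dg y := 2 * (sin x * cos x) + 2 * y - 2 * (sin (x + y) * cos (x + y)).
have dg' (y : R) : 0 <= y <= h -> is_derive y 1 g (dg y).
  by move=> _; rewrite /g /dg; derive_eq; rewrite /=; ring.
have : g 0 <= g h.
  apply: (le_of_der _ _ _ _ h0 dg') => y /andP[y0 _].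
  have s2 z : 2 * (sin z * cos z) = sin (z + z) :> R by rewrite sinD; ring.
  rewrite /dg !s2; have := ler_norm (sin (x + y + (x + y)) - sin (x + x)).
  have := sin_lip (x + y + (x + y)) (x + x).
  have -> : x + y + (x + y) - (x + x) = 2 * y by ring.
  by rewrite (ger0_norm (mulr_ge0 _ y0))//; lra.
by rewrite /g !addr0 !mulr0 !mul0r expr0n /=; lra.
Qed.

(** Indicator of the half-line up to [b]: it stops a test function at [b], so that the weak equation
    is obtained on every interval [0, b]. *)
Definition chi {R : realType} (b x : R) : R := (x <= b)%R%:R.

Lemma chi_mfun {R : realType} (a b c : R) : measurable_fun `[a, c] (chi b).
Proof.
apply: (@measurable_funS _ _ _ _ setT) => //.
have -> : chi b = \1_(`]-oo, b]%classic) :> (R -> R).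
  by apply/funext => x; rewrite indicE /chi mem_setE in_itv.
exact: measurable_indic.
Qed.

Lemma chi_bd {R : realType} (b x : R) : `|chi b x| <= 1.
Proof. by rewrite /chi; case: (x <= b); rewrite ?normr1 ?normr0. Qed.

Lemma itg_chi {R : realType} (a c b : R) (f : R -> R) : itg a c f ->
  itg a c (fun x => chi b x * f x).
Proof. by apply: itg_bmul => [|x _]; [exact: chi_mfun|exact: chi_bd]. Qed.

Lemma Iint_chi {R : realType} (a b c : R) (f : R -> R) : a <= b -> b <= c ->
  itg a c f -> Iint a c (fun x => chi b x * f x) = Iint a b f.
Proof.
move=> ab bc hf; rewrite (Iint_chasles a b c)//; last exact: itg_chi.
have -> : Iint b c (fun x => chi b x * f x) = 0.
  rewrite (IintE_oo _ _ _ (fun=> 0)) ?Iint_cst ?mul0r// => x /andP[bx _].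
  by rewrite /chi leNgt bx mul0r.
by rewrite addr0; apply: IintE => x /andP[_ xb]; rewrite /chi xb mul1r.
Qed.

(** The minimum of [x] and [b], written with an absolute value so that continuity is found
    automatically. *)
Definition cut {R : realType} (b x : R) : R := (x + b - `|x - b|) / 2.

Lemma cut_le {R : realType} (b x : R) : x <= b -> cut b x = x.
Proof. by move=> xb; rewrite /cut distrC ger0_norm ?subr_ge0//; field. Qed.

Lemma cut_ge {R : realType} (b x : R) : b <= x -> cut b x = b.
Proof. by move=> xb; rewrite /cut ger0_norm ?subr_ge0//; field. Qed.

Lemma cut_cont {R : realType} (b : R) : continuous (cut b).
Proof. by rewrite /cut; cont. Qed.

Lemma Iint_cut {R : realType} (N c : R -> R) (a' b b' : R) : a' <= b' ->
  (forall x : R, is_derive x 1 N (c x)) -> continuous c ->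
  N (cut b b') - N (cut b a') = Iint a' b' (fun x => chi b x * c x).
Proof.
move=> ab dN cc.
have [bb|/ltW bb] := leP b' b.
  rewrite !cut_le// ?(le_trans ab)// -(Iint_FTC _ _ N c)//.
  by apply: IintE => x /andP[_ xb]; rewrite /chi (le_trans xb)// mul1r.
rewrite (cut_ge b b')//; have [ba|/ltW ba] := leP a' b.
  by rewrite cut_le// -(Iint_FTC _ _ N c)// Iint_chi//; exact: itg_cont.
rewrite cut_ge// subrr (IintE_oo _ _ _ (fun=> 0)) ?Iint_cst ?mul0r// => x /andP[bx _].
by rewrite /chi leNgt (le_lt_trans ba bx) mul0r.
Qed.

Lemma Gfun_ext {R : realType} (eps delta kappa : R) (v dv phi dphi V Phi : R -> R) :
  (forall x, 0 <= x <= 1 -> v x = V x) -> (forall x, 0 <= x <= 1 -> phi x = Phi x) ->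
  Gfun eps delta kappa v dv phi dphi = Gfun eps delta kappa V dv Phi dphi.
Proof.
move=> vV pP; rewrite /Gfun.
congr (_ + _ + _ + _ - _); congr (_ * _); apply: IintE => x x01.
- by rewrite vV.
- by rewrite vV.
- by rewrite vV// pP.
- by rewrite vV.
Qed.

(** The phase is perturbed by the primitive of [chi b * c] vanishing at 0; the modulus, hence the
    constraint, is untouched. The end 1 is free, and [P 1 = 0] is the resulting natural boundary
    condition. Letting [b] vary replaces the usual du Bois-Reymond argument. *)
Lemma euler_lagrange_weak {R : realType} (eps delta kappa : R)
    (v dv phi w V Phi P : R -> R) :
  0 < eps -> 0 < delta ->
  L2on `[0, 1] dv ->
  (forall a b, 0 <= a -> a <= b -> b <= 1 -> v b - v a = Iint a b dv) ->
  L2on `[0, 1] w ->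
  (forall a b, 0 <= a -> a <= b -> b <= 1 -> phi b - phi a = Iint a b w) ->
  phi 0 = 0 -> Iint 0 1 (fun x => v x ^+ 2) = 1 ->
  (forall x, 0 <= x <= 1 -> v x != 0) ->
  (forall u du psi dpsi : R -> R, admissible u du psi dpsi ->
    Gfun eps delta kappa v dv phi w <= Gfun eps delta kappa u du psi dpsi) ->
  continuous V -> (forall x, 0 <= x <= 1 -> v x = V x) ->
  continuous Phi -> (forall x, 0 <= x <= 1 -> phi x = Phi x) ->
  (forall x : R, is_derive x 1 P (delta / eps ^+ 2 *
     (V x ^+ 4 * (sin (Phi x) * cos (Phi x))))) -> P 1 = 0 ->
  forall b c, 0 <= b <= 1 -> continuous c ->
  Iint 0 b (fun x => V x ^+ 2 * c x * w x) =
  Iint 0 b (fun x => (2 * kappa * V x ^+ 2 + P x) * c x).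
Proof.
move=> e0 d0 hdv hv hw hphi phi0 v1 vn hmin cV vV cPhi pPhi dP P1 b c /andP[b0 b1] cc.
have [N dN] := prim_ex c cc.
pose eta x := N (cut b x) - N (cut b 0).
have ceta : continuous eta.
  apply: contD; last exact: contC.
  exact: (contO _ _ (der_continuous _ _ dN) (cut_cont b)).
have hchi : L2on `[0, 1] (fun x => chi b x * c x).
  apply: (L2on_bmul _ _ 1); [exact: chi_mfun|by move=> x _; exact: chi_bd|].
  exact: L2on_cont.
have adm t : admissible v dv (fun x => phi x + t * eta x)
                             (fun x => w x + t * (chi b x * c x)).
  apply: admissible_pos => //.
  - by apply: L2on_add => //; exact: L2on_scale.
  - move=> a b' a0 ab b'1; rewrite IintD; last 2 first.
    + exact: (itg_sub 0 1 _ _ _ _ _ (L2on_itg _ _ _ hw)).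
    + exact: (itg_sub 0 1 _ _ _ _ _ (L2on_itg _ _ _ (L2on_scale _ _ t _ hchi))).
    rewrite IintZ; last exact: (itg_sub 0 1 _ _ _ _ _ (L2on_itg _ _ _ hchi)).
    rewrite -hphi// -(Iint_cut N)// /eta; ring.
  - by rewrite phi0 /eta subrr mulr0 addr0.
have w2 : itg 0 1 (fun x => w x ^+ 2) by case: hw.
have w1 := L2on_itg _ _ _ hw.
have x2 : itg 0 1 (fun x => (chi b x * c x) ^+ 2) by case: hchi.
have x1 := L2on_itg _ _ _ hchi.
have wx := L2on_mul _ _ _ _ hw hchi.
have cPhi' : continuous (fun x => V x ^+ 4 * (sin (Phi x) * cos (Phi x))) by cont.
pose c4 := delta / (8 * eps ^+ 2).
have c40 : 0 < c4 by rewrite divr_gt0// mulr_gt0// exprn_gt0.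
pose I1 := Iint 0 1 (fun x => V x ^+ 2 * (w x * (chi b x * c x))).
pose I2 := Iint 0 1 (fun x => V x ^+ 4 * (sin (Phi x) * cos (Phi x)) * eta x).
pose I3 := Iint 0 1 (fun x => V x ^+ 2 * (chi b x * c x)).
pose J1 := Iint 0 1 (fun x => V x ^+ 2 * (chi b x * c x) ^+ 2).
pose J2 := Iint 0 1 (fun x => V x ^+ 4 * eta x ^+ 2).
have A0 : 4^-1 * I1 + 2 * c4 * I2 - kappa / 2 * I3 = 0.
  apply: (lin_eq0 _ (8^-1 * J1 + c4 * J2)) => t.
  have := hmin _ _ _ _ (adm t); rewrite -subr_ge0.
  rewrite (Gfun_ext _ _ _ _ _ (fun x => phi x + t * eta x) _ V
           (fun x => Phi x + t * eta x)) => [||x x01]; [|exact: vV|by rewrite pPhi].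
  rewrite (Gfun_ext _ _ _ v _ phi _ V Phi)// /Gfun.
  have -> : Iint 0 1 (fun x => V x ^+ 2 * (w x + t * (chi b x * c x)) ^+ 2) =
     Iint 0 1 (fun x => V x ^+ 2 * w x ^+ 2) + 2 * t * I1 + t ^+ 2 * J1.
  { rewrite /I1 /J1 -!IintZ; [|exact: (itg_cmul _ _ _ _ (contX _ 2 cV))..].
    rewrite -!IintD; first by apply: IintE => x _; ring.
    all: do ?[apply: itgD | apply: itgZ]; exact: (itg_cmul _ _ _ _ (contX _ 2 cV)). }
  have -> : Iint 0 1 (fun x => V x ^+ 2 * (w x + t * (chi b x * c x))) =
     Iint 0 1 (fun x => V x ^+ 2 * w x) + t * I3.
  { rewrite /I3 -!IintZ; [|exact: (itg_cmul _ _ _ _ (contX _ 2 cV))..].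
    rewrite -!IintD; first by apply: IintE => x _; ring.
    all: do ?[apply: itgD | apply: itgZ]; exact: (itg_cmul _ _ _ _ (contX _ 2 cV)). }
  have : Iint 0 1 (fun x => V x ^+ 4 * sin (Phi x + t * eta x) ^+ 2) <=
     Iint 0 1 (fun x => V x ^+ 4 * sin (Phi x) ^+ 2) + 2 * t * I2 + t ^+ 2 * J2.
    rewrite /I2 /J2 -!IintZ; [|by apply: itg_cont; cont..].
    rewrite -!IintD; [|by apply: itg_cont; cont..].
    apply: Iint_le; [by apply: itg_cont; cont..|move=> x _].
    have := ler_wpM2l (exprn_even_ge0 (V x) (erefl : ~~ odd 4))
              (sin_sqr_le (Phi x) (t * eta x)).
    by move/le_trans; apply; rewrite le_eqVlt; apply/orP; left; apply/eqP; ring.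
  move=> /(ler_wpM2l (ltW c40)) h4 h; apply: le_trans h _; rewrite -/c4.
  by move: h4; lra.
have E1 : I1 = Iint 0 b (fun x => V x ^+ 2 * c x * w x).
  rewrite -(Iint_chi 0 b 1)//; last by apply: itg_cmul w1; cont.
  by apply: IintE => x _; ring.
have E3 : I3 = Iint 0 b (fun x => V x ^+ 2 * c x).
  rewrite -(Iint_chi 0 b 1)//; last by apply: itg_cont; cont.
  by apply: IintE => x _; ring.
have c4E : delta / eps ^+ 2 = 8 * c4 by rewrite /c4; field; rewrite gt_eqF.
(* Integration by parts against [P], split at [b] because [eta] is constant beyond it; the boundary
   terms at [b] cancel and [P 1 = 0] removes the one at 1. *)
have E2 : 8 * c4 * I2 = - Iint 0 b (fun x => P x * c x).
  have cP := der_continuous _ _ dP.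
  rewrite /I2 -IintZ; last by apply: itg_cont; cont.
  rewrite (Iint_chasles 0 b 1)//; last by apply: itg_cont; cont.
  have -> : Iint b 1 (fun x => 8 * c4 * (V x ^+ 4 * (sin (Phi x) * cos (Phi x)) * eta x)) =
      - P b * (N b - N 0).
    have d1 (x : R) : is_derive x 1 (fun y => P y * (N b - N 0))
        (8 * c4 * (V x ^+ 4 * (sin (Phi x) * cos (Phi x))) * (N b - N 0)).
      by rewrite -c4E; derive_eq; ring.
    transitivity (Iint b 1 (fun x => 8 * c4 * (V x ^+ 4 * (sin (Phi x) * cos (Phi x)))
        * (N b - N 0))).
      apply: IintE => x /andP[bx _]; rewrite /eta cut_ge// cut_le//; ring.
    rewrite (Iint_FTC _ _ _ _ b1 d1); last by cont.
    by rewrite P1; ring.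
  have -> : Iint 0 b (fun x => 8 * c4 * (V x ^+ 4 * (sin (Phi x) * cos (Phi x)) * eta x)) =
      P b * (N b - N 0) - Iint 0 b (fun x => P x * c x).
    have cN := der_continuous _ _ dN.
    have d1 (x : R) : is_derive x 1 (fun y => P y * (N y - N 0))
        (8 * c4 * (V x ^+ 4 * (sin (Phi x) * cos (Phi x))) * (N x - N 0) + P x * c x).
      by rewrite -c4E; derive_eq; ring.
    apply/eqP; rewrite eq_sym subr_eq eq_sym -IintD; last 2 first.
    - by apply: itg_cont; cont.
    - by apply: itg_cont; cont.
    apply/eqP; transitivity (Iint 0 b (fun x => 8 * c4 * (V x ^+ 4 *
        (sin (Phi x) * cos (Phi x))) * (N x - N 0) + P x * c x)).
      by apply: IintE => x /andP[_ xb]; rewrite /eta !cut_le//; ring.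
    by rewrite (Iint_FTC _ _ _ _ b0 d1); [ring|cont].
  ring.
have cP := der_continuous _ _ dP.
have -> : Iint 0 b (fun x => (2 * kappa * V x ^+ 2 + P x) * c x) =
   2 * kappa * Iint 0 b (fun x => V x ^+ 2 * c x) + Iint 0 b (fun x => P x * c x).
  rewrite -IintZ; last by apply: itg_cont; cont.
  rewrite -IintD; [|by apply: itg_cont; cont..].
  by apply: IintE => x _; ring.
by rewrite -E1 -E3; lra.
Qed.

(* [V] and [Phi] extend [v] and [phi] to the line; [F] is the continuous derivative
   of the phase and [P] the flux [V^2 (F - 2 kappa)]. *)
Record reduced {R : realType} (eps delta kappa : R) (v dv phi dphi : R -> R)
    (V F Phi P : R -> R) : Prop := Reduced {
  red_contV : continuous V;
  red_Vgt0 : forall x, 0 < V x;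
  red_vE : forall x, 0 <= x <= 1 -> v x = V x;
  red_contF : continuous F;
  red_derPhi : forall x : R, is_derive x 1 Phi (F x);
  red_Phi0 : Phi 0 = 0;
  red_phiE : forall x, 0 <= x <= 1 -> phi x = Phi x;
  red_contP : continuous P;
  red_P1 : P 1 = 0;
  red_derP : forall x : R, 0 <= x <= 1 -> is_derive x 1 P
    (delta / eps ^+ 2 * (V x ^+ 4 * (sin (Phi x) * cos (Phi x))));
  red_FE : forall x, F x = 2 * kappa + P x / V x ^+ 2;
  red_GE : Gfun eps delta kappa v dv phi dphi = Gfun eps delta kappa V dv Phi F }.

Lemma minimizer_reduced {R : realType} (eps delta kappa : R) (v dv phi dphi : R -> R) :
  0 < eps -> 0 < delta -> minimizer eps delta kappa v dv phi dphi ->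
  (forall x, 0 <= x <= 1 -> 0 < v x) ->
  exists V F Phi P, reduced eps delta kappa v dv phi dphi V F Phi P.
Proof.
move=> e0 d0 [adm hmin] vp.
have [w [hw _ hphi GE]] := patch_dphi _ _ _ _ adm.
have [hdv hv _ _ [phi0 v1]] := adm.
have vn x : 0 <= x <= 1 -> v x != 0 by move=> /vp /lt0r_neq0.
have hphi' a b : 0 <= a -> a <= b -> b <= 1 -> phi b - phi a = Iint a b w.
  move=> a0 ab b1; apply: hphi => // x /andP[ax xb].
  by apply: vn; rewrite (le_trans a0)// (le_trans xb).
pose V x := v (clamp x).
have cV : continuous V := cont_ext _ _ hdv hv.
have Vp x : 0 < V x by apply: vp; exact: clamp_in.
have vV x : 0 <= x <= 1 -> v x = V x by move=> x01; rewrite /V clamp_id.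
pose Phi0 x := phi (clamp x).
have cPhi0 : continuous Phi0 := cont_ext _ _ hw hphi'.
have pPhi0 x : 0 <= x <= 1 -> phi x = Phi0 x by move=> x01; rewrite /Phi0 clamp_id.
have [Q dQ] := prim_ex (fun x => delta / eps ^+ 2 *
     (V x ^+ 4 * (sin (Phi0 x) * cos (Phi0 x)))) ltac:(cont).
pose P x := Q x - Q 1.
have dP (x : R) : is_derive x 1 P (delta / eps ^+ 2 *
     (V x ^+ 4 * (sin (Phi0 x) * cos (Phi0 x)))).
  by rewrite /P; derive_eq; ring.
have P1 : P 1 = 0 by rewrite /P subrr.
have cP := der_continuous _ _ dP.
have V2n x : V x ^+ 2 != 0 by rewrite expf_neq0// gt_eqF.
have cV2 : continuous (fun x => (V x ^+ 2)^-1).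
  by apply: (contV (fun x => V x ^+ 2)) => //; exact: contX.
pose F x := 2 * kappa + P x / V x ^+ 2.
have cF : continuous F.
  by rewrite /F; apply: contD; [cont|exact: (contM P)].
have hmin' u du psi dpsi : admissible u du psi dpsi ->
    Gfun eps delta kappa v dv phi w <= Gfun eps delta kappa u du psi dpsi.
  by rewrite -GE; exact: hmin.
have EL b c : 0 <= b <= 1 -> continuous c ->
   Iint 0 b (fun x => V x ^+ 2 * c x * w x) = Iint 0 b (fun x => V x ^+ 2 * F x * c x).
  move=> b01 cc.
  rewrite (euler_lagrange_weak eps delta kappa v dv phi w V Phi0 P)//.
  by apply: IintE => x _; rewrite /F; field; rewrite gt_eqF.
have [Phi1 dPhi1] := prim_ex F cF.
pose Phi x := Phi1 x - Phi1 0.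
have dPhi (x : R) : is_derive x 1 Phi (F x) by rewrite /Phi; derive_eq; ring.
have Phi00 : Phi 0 = 0 by rewrite /Phi subrr.
have pPhi x : 0 <= x <= 1 -> phi x = Phi x.
  move=> x01; have /andP[x0 x1] := x01.
  rewrite -[LHS]subr0 -phi0 hphi'// -[RHS]subr0 -[X in _ - X]Phi00.
  rewrite -(Iint_FTC _ _ Phi F)//.
  (* The test function [V^-2] leaves the bare integral of [w], so [phi] coincides with the primitive
     of [F] at every point. *)
  have := EL x _ x01 cV2.
  rewrite (IintE _ _ (fun y => V y ^+ 2 * (V y ^+ 2)^-1 * w y) w); last first.
    by move=> y _; rewrite divff// mul1r.
  move=> ->; apply: IintE => y _.
  by rewrite mulrAC divff// mul1r.
have w1 := L2on_itg _ _ _ hw.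
have w2 : itg 0 1 (fun x => w x ^+ 2) by case: hw.
have cV2' : continuous (fun x => V x ^+ 2) by exact: contX.
have l01 : 0 <= (1 : R) <= 1 by rewrite ler01 lexx.
have E1 : Iint 0 1 (fun x => V x ^+ 2 * w x) = Iint 0 1 (fun x => V x ^+ 2 * F x).
  have := EL 1 (fun=> 1) l01 (contC _).
  rewrite (IintE _ _ _ (fun x => V x ^+ 2 * w x)); last by move=> x _; rewrite mulr1.
  by move=> ->; apply: IintE => x _; rewrite mulr1.
have E2 : Iint 0 1 (fun x => V x ^+ 2 * F x * w x) = Iint 0 1 (fun x => V x ^+ 2 * F x ^+ 2).
  rewrite (EL 1 F l01 cF); apply: IintE => x _; ring.
have hadm : admissible v dv phi F.
  apply: admissible_pos => //; first exact: L2on_cont.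
  move=> a b a0 ab b1; rewrite !pPhi ?a0 ?b1 ?(le_trans a0)// ?(le_trans ab)//.
  by rewrite (Iint_FTC _ _ Phi).
(* Almost everywhere equality of [w] and [F] is bypassed. Minimality gives one inequality; the weak
   equation tested with [F] makes the difference of kinetic terms equal to [int V^2 (w - F)^2],
   which gives the other. *)
have GE' : Gfun eps delta kappa v dv phi w = Gfun eps delta kappa v dv phi F.
  apply/eqP; rewrite eq_le hmin'//=.
  rewrite !(Gfun_ext eps delta kappa v dv phi _ V Phi)// /Gfun E1.
  rewrite lerD2r lerD2r lerD2l ler_wpM2l//.
  rewrite -subr_ge0.
  have -> : Iint 0 1 (fun x => V x ^+ 2 * w x ^+ 2) - Iint 0 1 (fun x => V x ^+ 2 * F x ^+ 2)
     = Iint 0 1 (fun x => V x ^+ 2 * (w x - F x) ^+ 2).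
    have -> : Iint 0 1 (fun x => V x ^+ 2 * w x ^+ 2) - Iint 0 1 (fun x => V x ^+ 2 * F x ^+ 2)
      = Iint 0 1 (fun x => V x ^+ 2 * w x ^+ 2)
        - 2 * Iint 0 1 (fun x => V x ^+ 2 * F x * w x)
        + Iint 0 1 (fun x => V x ^+ 2 * F x ^+ 2) by rewrite E2; ring.
    have i1 : itg 0 1 (fun x => V x ^+ 2 * w x ^+ 2) by exact: (itg_cmul _ _ _ _ cV2' w2).
    have i2 : itg 0 1 (fun x => V x ^+ 2 * F x * w x).
      by apply: itg_cmul w1; exact: (contM _ _ cV2' cF).
    have i3 : itg 0 1 (fun x => V x ^+ 2 * F x ^+ 2).
      by apply: itg_cont; exact: (contM _ _ cV2' (contX _ 2 cF)).
    rewrite -IintZ// -IintB//; last exact: itgZ.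
    rewrite -IintD//; last by apply: itgD => //; apply: itgN; exact: itgZ.
    by apply: IintE => x _; ring.
  by apply: Iint_ge0 => x _; rewrite mulr_ge0// sqr_ge0.
exists V, F, Phi, P; split => //.
(* [P] was built from the clamped phase [Phi0], which is known to agree with [Phi] only on [0, 1];
   hence the restriction in [red_derP]. *)
- by move=> x x01; rewrite -pPhi// pPhi0.
- by rewrite GE GE'; exact: Gfun_ext.
Qed.

(** * Lower bounds by calibration *)

(** Feeding [Ev <= kappa^2/2] into [sup_sqr_le] gives [(1 - v)^2 <= 16 eps kappa^2], and [s <= 1/2]
    then keeps [v] away from 0. The sharper bound through [Ev] is kept for when [Ev] is known to be
    smaller. *)
Lemma small_eps_reduced {R : realType} (eps delta kappa s : R) (v dv phi dphi : R -> R) :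
  0 < eps <= 1 -> 0 < delta -> 0 <= s <= 2^-1 ->
  minimizer eps delta kappa v dv phi dphi -> (forall x, 0 <= x <= 1 -> 0 <= v x) ->
  16 * (eps * kappa ^+ 2) <= s ^+ 2 ->
  exists V F Phi P, [/\ reduced eps delta kappa v dv phi dphi V F Phi P,
    (forall x, 0 <= x <= 1 -> `|1 - V x| <= s),
    (forall x, 0 <= x <= 1 -> (1 - V x) ^+ 2 <= 32 * (eps * Ev eps V dv)) &
    Ev eps V dv <= kappa ^+ 2 / 2].
Proof.
move=> e01 d0 /andP[s0 s1] hm vp es; have /andP[e0 e1] := e01.
have [adm _] := hm.
have EL := Ev_le _ _ _ _ _ _ _ d0 hm.
have sv := sup_sqr_le _ _ _ _ _ e01 adm vp.
have vs x : 0 <= x <= 1 -> `|1 - v x| <= s.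
  move=> x01; rewrite -(@ler_pXn2r _ 2)// ?nnegrE// -normrX ger0_norm ?sqr_ge0//.
  apply: le_trans (sv x x01) _; apply: le_trans es.
  by have := ler_wpM2l (ltW e0) EL; lra.
have vp' x : 0 <= x <= 1 -> 0 < v x.
  by move=> x01; have := vs x x01; rewrite ler_norml => /andP[_]; lra.
have [V [F [Phi [P hred]]]] := minimizer_reduced _ _ _ _ _ _ _ e0 d0 hm vp'.
have vE := red_vE _ _ _ _ _ _ _ _ _ _ _ hred.
have EE : Ev eps V dv = Ev eps v dv.
  by rewrite /Ev; congr (_ + _ * _); apply: IintE => x /vE ->.
exists V, F, Phi, P; split => //.
- by move=> x x01; rewrite -vE//; exact: vs.
- by move=> x x01; rewrite EE -vE//; exact: sv.
- by rewrite EE.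
Qed.

(** Replacing [V] by 1 in the twist term leaves [kappa/2 (1 - V^2) F]. Young's inequality charges it
    to [theta/16 F^2] and to half of the potential term, affordable since
    [8 kappa^2 eps^2 <= theta]. Another [theta/16 F^2] is lost through [V^2 >= 1 - theta/2], whence
    the factor [1 - theta]. The other half of [Ev] survives. *)
Lemma coupling {R : realType} (eps delta kappa s theta : R)
    (v dv phi dphi V F Phi P : R -> R) :
  0 < eps -> 0 < delta -> reduced eps delta kappa v dv phi dphi V F Phi P ->
  0 < theta <= 1 -> 0 <= s -> 4 * s <= theta ->
  (forall x, 0 <= x <= 1 -> `|1 - V x| <= s) ->
  8 * (kappa ^+ 2 * eps ^+ 2) <= theta ->
  Ev eps V dv / 2 + (1 - theta) / 8 *
    Iint 0 1 (fun x => F x ^+ 2 + delta / eps ^+ 2 * sin (Phi x) ^+ 2)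
  - kappa / 2 * Phi 1 <= Gfun eps delta kappa v dv phi dphi.
Proof.
move=> e0 d0 hred /andP[t0 t1] s0 st Vs ke.
have [cV Vp _ cF dPhi Phi0 _ _ _ _ _ ->] := hred.
have cPhi := der_continuous _ _ dPhi.
have e20 : 0 < eps ^+ 2 by rewrite exprn_gt0.
set c := delta / eps ^+ 2.
have c0 : 0 < c by rewrite divr_gt0.
have -> : Phi 1 = Iint 0 1 F by rewrite (Iint_FTC _ _ Phi F)// Phi0 subr0.
rewrite /Gfun /Ev.
have -> : delta / (8 * eps ^+ 2) = c / 8 by rewrite /c; field; rewrite gt_eqF.
set A := Iint 0 1 (fun x => dv x ^+ 2).
have A0 : 0 <= A by apply: Iint_ge0 => x _; exact: sqr_ge0.
have : Iint 0 1 (fun x => (1 - theta) / 8 * (F x ^+ 2 + c * sin (Phi x) ^+ 2)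
                  + - (kappa / 2) * F x) <=
  Iint 0 1 (fun x => (8 * eps ^+ 2)^-1 * (1 - V x ^+ 2) ^+ 2
     + 8^-1 * (V x ^+ 2 * F x ^+ 2) + c / 8 * (V x ^+ 4 * sin (Phi x) ^+ 2)
     + - (kappa / 2) * (V x ^+ 2 * F x)).
  apply: Iint_le; [by apply: itg_cont; cont..|move=> x x01].
  have := Vs x x01; rewrite ler_norml => /andP[h1 h2].
  have V0 := Vp x.
  set u := V x in h1 h2 V0 *; set f := F x; set z := sin (Phi x) ^+ 2.
  have z0 : 0 <= z by exact: sqr_ge0.
  have u2 : 1 - theta / 2 <= u ^+ 2 by nra.
  have u4 : 1 - theta <= u ^+ 4.
    have -> : u ^+ 4 = (u ^+ 2) ^+ 2 by ring.
    by have := sqr_ge0 (u ^+ 2 - 1); nra.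
  have f2 := sqr_ge0 f.
  set m := 1 - u ^+ 2.
  have hm : - (theta / 16 * f ^+ 2 + (8 * eps ^+ 2)^-1 * m ^+ 2) <= kappa / 2 * (m * f).
    have k8 : kappa ^+ 2 / theta <= (8 * eps ^+ 2)^-1.
      by rewrite ler_pdivrMr// ler_pdivlMl ?mulr_gt0//; lra.
    have := ler_wpM2r (sqr_ge0 m) k8.
    have : 0 <= (theta * f + 4 * kappa * m) ^+ 2 / (16 * theta).
      by rewrite divr_ge0 ?sqr_ge0// mulr_ge0// ltW.
    have -> : (theta * f + 4 * kappa * m) ^+ 2 / (16 * theta) =
       theta / 16 * f ^+ 2 + kappa / 2 * (m * f) + kappa ^+ 2 / theta * m ^+ 2.
      by field; rewrite gt_eqF.
    by lra.
  have p1 := ler_wpM2r f2 u2.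
  have p2 := ler_wpM2l (ltW c0) (ler_wpM2r z0 u4).
  have p3 : 0 <= theta * f ^+ 2 by rewrite mulr_ge0 ?(ltW t0).
  have -> : - (kappa / 2) * (u ^+ 2 * f) = - (kappa / 2) * f + kappa / 2 * (m * f).
    by rewrite /m; ring.
  by move: hm p1 p2 p3; set e8 := _^-1 * m ^+ 2; set kmf := kappa / 2 * (m * f); lra.
rewrite IintD; [|by apply: itg_cont; cont..].
rewrite IintZ; last by apply: itg_cont; cont.
rewrite IintZ; last by apply: itg_cont; cont.
rewrite !IintD; [|by apply: itg_cont; cont..].
rewrite !IintZ; [|by apply: itg_cont; cont..].
set B := Iint 0 1 (fun x => (1 - V x ^+ 2) ^+ 2).
have -> : (8 * eps ^+ 2)^-1 = (4 * eps ^+ 2)^-1 / 2 by field; rewrite gt_eqF.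
by lra.
Qed.

Lemma calibration {R : realType} (a b L : R) (F Phi S T : R -> R) : a <= b -> 0 <= L ->
  continuous F -> continuous S ->
  (forall x : R, is_derive x 1 Phi (F x)) -> (forall x : R, is_derive x 1 T (S x)) ->
  2 * L * `|T (Phi b) - T (Phi a)| <=
  Iint a b (fun x => F x ^+ 2 + L ^+ 2 * S (Phi x) ^+ 2).
Proof.
move=> ab L0 cF cS dPhi dT.
have cPhi := der_continuous _ _ dPhi.
have dTP (x : R) : is_derive x 1 (fun y => T (Phi y)) (S (Phi x) * F x).
  exact: (derOf _ _ _ _ _ dT (dPhi x)).
rewrite -(Iint_FTC _ _ _ _ ab dTP); last by cont.
have iS : itg a b (fun x => S (Phi x) * F x) by apply: itg_cont; cont.
have h : `|Iint a b (fun x => S (Phi x) * F x)| <= Iint a b (fun x => `|S (Phi x) * F x|).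
  exact: Iint_abs.
apply: le_trans (ler_wpM2l _ h) _; first by rewrite mulr_ge0.
rewrite -IintZ; last by apply: itg_cont; cont.
apply: Iint_le; [by apply: itg_cont; cont..|move=> x _].
rewrite normrM -[F x ^+ 2]ger0_norm ?sqr_ge0// -[S (Phi x) ^+ 2]ger0_norm ?sqr_ge0//.
rewrite !normrX; have := sqr_ge0 (`|F x| - L * `|S (Phi x)|).
by move=> {}h; nra.
Qed.

(** Splitting at [x] makes an interior excursion of the phase pay for both the way out and the way
    back; the sup bounds on the phase in (a) and (b) come from here. *)
Lemma calibration_split {R : realType} (x L : R) (F Phi S T : R -> R) : 0 <= x <= 1 ->
  0 <= L -> continuous F -> continuous S ->
  (forall x : R, is_derive x 1 Phi (F x)) -> (forall x : R, is_derive x 1 T (S x)) ->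
  Phi 0 = 0 -> T 0 = 0 ->
  2 * L * (`|T (Phi x)| + `|T (Phi 1) - T (Phi x)|) <=
  Iint 0 1 (fun x => F x ^+ 2 + L ^+ 2 * S (Phi x) ^+ 2).
Proof.
move=> /andP[x0 x1] L0 cF cS dPhi dT Phi0 T0.
have cPhi := der_continuous _ _ dPhi.
rewrite (Iint_chasles 0 x 1)//; last by apply: itg_cont; cont.
have h1 := calibration _ _ _ _ _ _ _ x0 L0 cF cS dPhi dT.
have h2 := calibration _ _ _ _ _ _ _ x1 L0 cF cS dPhi dT.
by rewrite Phi0 T0 subr0 in h1; lra.
Qed.

(** * The primitive of the absolute value of the sine *)

(** The calibration potential of (a) and (b): odd, equal to [1 - cos] on [0, pi], and increasing by
    2 over each interval of length pi. *)
Definition abs_sin_prim {R : realType} (C : R -> R) : Prop :=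
  (forall x : R, is_derive x 1 C `|sin x|) /\ C 0 = 0.

Lemma abs_sin_prim_ex (R : realType) : exists C : R -> R, abs_sin_prim C.
Proof.
have [C dC] := prim_ex (fun x : R => `|sin x|) ltac:(cont).
exists (fun x => C x - C 0); split; last by rewrite subrr.
by move=> x; derive_eq; ring.
Qed.

Lemma asp_nd {R : realType} (C : R -> R) a b : abs_sin_prim C -> a <= b -> C a <= C b.
Proof. by move=> [dC _] ab; apply: (le_of_der C _ _ _ ab) => x _ //; exact: dC. Qed.

Lemma asp_ge0 {R : realType} (C : R -> R) x : abs_sin_prim C -> 0 <= x -> 0 <= C x.
Proof. by move=> hC x0; have [_ <-] := hC; exact: asp_nd. Qed.

Lemma asp_odd {R : realType} (C : R -> R) x : abs_sin_prim C -> C (- x) = - C x.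
Proof.
move=> hC; have [dC C0] := hC.
wlog x0 : x / 0 <= x => [H|].
  have [/H//|/ltW x0] := leP 0 x.
  by have := H (- x); rewrite oppr_ge0 opprK => /(_ x0) ->; rewrite opprK.
apply/eqP; rewrite -addr_eq0; apply/eqP.
have d (y : R) : 0 <= y <= x -> is_derive y 1 (fun z => C (- z) + C z) 0.
  by move=> _; derive_eq; rewrite sinN normrN; ring.
by rewrite (eq_of_der0 _ _ _ x0 d) oppr0 C0 addr0.
Qed.

Lemma asp_norm {R : realType} (C : R -> R) x : abs_sin_prim C -> `|C x| = C `|x|.
Proof.
move=> hC; have [x0|/ltW x0] := leP 0 x; first by rewrite !ger0_norm ?asp_ge0.
by rewrite (ler0_norm x0) asp_odd// ler0_norm// -oppr_ge0 -asp_odd// asp_ge0// oppr_ge0.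
Qed.

Lemma asp_cos {R : realType} (C : R -> R) x : abs_sin_prim C -> 0 <= x <= pi ->
  C x = 1 - cos x.
Proof.
move=> [dC C0] /andP[x0 xpi].
have d (y : R) : 0 <= y <= x -> is_derive y 1 (fun z => C z + cos z) 0.
  move=> /andP[y0 yx]; derive_eq.
  by rewrite ger0_norm ?sin_ge0_pi ?y0 ?(le_trans yx)//; ring.
have := eq_of_der0 _ _ _ x0 d; rewrite C0 cos0 add0r => <-; ring.
Qed.

Lemma asp_Dpi {R : realType} (C : R -> R) x : abs_sin_prim C -> C (x + pi) = C x + 2.
Proof.
move=> hC; have [dC C0] := hC.
have d (y : R) : is_derive y 1 (fun z => C (z + pi) - C z) 0.
  by derive_eq; rewrite sinDpi normrN; ring.
have E : C (x + pi) - C x = C (0 + pi) - C 0.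
  have [x0|/ltW x0] := leP 0 x; first by have := eq_of_der0 _ _ _ x0 (fun y _ => d y).
  by have := eq_of_der0 _ _ _ x0 (fun y _ => d y).
have cpi : C pi = 2 by rewrite (asp_cos _ _ hC) ?cospi ?pi_ge0 ?lexx//; ring.
by move: E; rewrite add0r C0 subr0 cpi; lra.
Qed.

Lemma sin_le_halfpi {R : realType} (x y : R) : - (pi / 2) <= x -> x <= y -> y <= pi / 2 ->
  sin x <= sin y.
Proof.
move=> x0; rewrite le_eqVlt => /predU1P[-> //|xy] yp.
apply/ltW; rewrite ltr_sin// in_itv /=; apply/andP; split => //.
  by rewrite (le_trans (ltW xy)).
by rewrite (le_trans x0)// ltW.
Qed.

(** The function [C y - 2 k y] falls on [0, p], rises on [p, pi - p] and falls again to its next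
    local minimum [p + pi], which lies higher by [2 (1 - k pi) > 0]; later wells are higher still by
    the same shift. For negative [y] both terms [|C y|] and [- 2 k y] are nonnegative. Hence [p] is
    the strict global minimum, with a definite gap at distance [eta]. *)
Lemma asp_tangent {R : realType} (C : R -> R) (k p eta : R) : abs_sin_prim C ->
  0 < p < pi / 2 -> sin p = 2 * k -> 0 < k -> k < pi^-1 -> 0 < eta ->
  exists2 c, 0 < c &
    (forall y, C p - 2 * k * p <= `|C y| - 2 * k * y) /\
    (forall y, eta <= `|y - p| -> C p - 2 * k * p + c <= `|C y| - 2 * k * y).
Proof.
move=> hC /andP[p0 p2] sp k0 kpi eta0; have [dC C0] := hC.
have pi0 := pi_gt0 R.
pose j y := C y - 2 * k * y - (C p - 2 * k * p).
have dj (y : R) : is_derive y 1 j (`|sin y| - 2 * k) by rewrite /j; derive_eq; ring.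
have djN (y : R) : is_derive y 1 (fun z => - j z) (- (`|sin y| - 2 * k)).
  by apply: derN; exact: dj.
have jp : j p = 0 by rewrite /j subrr.
have jpi y : j (y + pi) = j y + 2 * (1 - k * pi).
  by rewrite /j asp_Dpi//; ring.
have c2p : 0 < 2 * (1 - k * pi).
  by rewrite mulr_gt0// subr_gt0 -ltr_pdivlMr ?div1r.
set c2 := 2 * (1 - k * pi) in jpi c2p.
have sin_lt x y : 0 <= x -> x < y -> y <= pi / 2 -> sin x < sin y.
  move=> x0 xy yp; rewrite ltr_sin// in_itv /=; apply/andP; split; lra.
have sin_pib x : sin (pi - x) = sin x :> R.
  by rewrite sinB sinpi cospi; ring.
have dec1 y z : 0 <= y -> y <= z -> z <= p -> j z <= j y.
  move=> y0 yz zp; rewrite -lerN2; apply: (le_of_der _ _ _ _ yz (fun x _ => djN x)).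
  move=> x /andP[yx xz]; rewrite oppr_ge0 subr_le0 -sp.
  have x0 := le_trans y0 yx; have xp := le_trans xz zp.
  rewrite ger0_norm; last by apply: sin_ge0_pi; rewrite x0; lra.
  by apply: sin_le_halfpi; lra.
have dec1s y : 0 <= y -> y < p -> 0 < j y.
  move=> y0 yp; rewrite -jp -ltrN2; apply: (lt_of_der _ _ _ _ yp (fun x _ => djN x)).
  move=> x /andP[yx xp]; rewrite oppr_gt0 subr_lt0 -sp.
  have x0 := le_trans y0 (ltW yx).
  rewrite ger0_norm; last by apply: sin_ge0_pi; rewrite x0; lra.
  by apply: sin_lt; lra.
have inc_sin x : p < x -> x < pi - p -> sin p < sin x.
  move=> px xp; have [xh|/ltW xh] := leP x (pi / 2); first by apply: sin_lt => //; lra.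
  by rewrite -(sin_pib x); apply: sin_lt; lra.
have inc2s y z : p <= y -> y < z -> z <= pi - p -> j y < j z.
  move=> py yz zp; apply: (lt_of_der _ _ _ _ yz (fun x _ => dj x)).
  move=> x /andP[yx xz]; rewrite subr_gt0 -sp.
  apply: lt_le_trans (ler_norm _); apply: inc_sin; lra.
have dec3 y z : pi - p <= y -> y <= z -> z <= pi + p -> j z <= j y.
  move=> y0 yz zp; rewrite -lerN2; apply: (le_of_der _ _ _ _ yz (fun x _ => djN x)).
  move=> x /andP[yx xz]; rewrite oppr_ge0 subr_le0 -sp.
  have -> : `|sin x| = `|sin (x - pi)|.
    by rewrite -{1}[x](subrK pi) sinDpi normrN.
  by rewrite ler_norml -sinN; apply/andP; split; apply: sin_le_halfpi; lra.
pose y1 := Num.max 0 (p - eta).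
have y10 : 0 <= y1 by rewrite /y1 le_max lexx.
have y1p : y1 < p by rewrite /y1 gt_max p0 gtrBl.
pose y2 := Num.min (p + eta) (pi - p).
have py2 : p < y2 by rewrite /y2 lt_min ltrDl eta0 /=; lra.
have y2p : y2 <= pi - p by rewrite /y2 ge_min lexx orbT.
have j1 : 0 < j y1 by exact: dec1s.
have j2 : 0 < j y2 by rewrite -jp; exact: inc2s.
have jpip : j (pi + p) = c2 by rewrite addrC jpi jp add0r.
have up1 y : p <= y -> y <= pi + p -> 0 <= j y.
  move=> py ypi; have [yh|/ltW yh] := leP y (pi - p).
    move: py; rewrite le_eqVlt => /predU1P[<-|py]; first by rewrite jp.
    by rewrite -jp ltW// inc2s.
  by apply: le_trans (dec3 _ _ yh ypi (lexx _)); rewrite jpip ltW.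
have upn n y : p <= y -> y <= p + n%:R * pi -> 0 <= j y.
  elim: n y => [|n IH] y py; first by rewrite mul0r addr0 => yp; apply: up1; lra.
  rewrite -natr1 mulrDl mul1r => yn.
  have [yh|/ltW yh] := leP y (pi + p); first exact: up1.
  rewrite -[y](subrK pi) jpi addr_ge0 ?(ltW c2p)// IH//; lra.
have upa y : p <= y -> 0 <= j y.
  move=> py; have ypi : 0 <= (y - p) / pi by rewrite divr_ge0 ?subr_ge0// ltW.
  apply: (upn (Num.truncn ((y - p) / pi)).+1) => //.
  rewrite -lerBlDl -ler_pdivrMr// ltW//.
  by have /andP[] := truncn_itv ypi.
(* The three barriers: left of the well, on its right slope, and at the bottom of the next well. *)
pose c := Num.min (j y1) (Num.min (j y2) c2).
have c0 : 0 < c by rewrite /c !lt_min j1 j2 c2p.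
have cj1 : c <= j y1 by rewrite /c ge_min lexx.
have cj2 : c <= j y2 by rewrite /c !ge_min lexx orbT.
have cc2 : c <= c2 by rewrite /c !ge_min lexx !orbT.
have neg y : y <= 0 -> j y1 <= `|C y| - 2 * k * y - (C p - 2 * k * p).
  move=> y0; apply: (@le_trans _ _ (j 0)); first by apply: dec1 => //; exact: ltW.
  rewrite /j C0 mulr0 subr0 lerD2r.
  by rewrite addr_ge0// -mulrN mulr_ge0 ?oppr_ge0//; lra.
have pos y : 0 <= y -> `|C y| - 2 * k * y - (C p - 2 * k * p) = j y.
  by move=> y0; rewrite ger0_norm ?asp_ge0.
exists c => //; split => y.
  rewrite -subr_ge0; have [/neg h|/ltW y0] := leP y 0; first exact: le_trans (ltW j1) h.
  rewrite pos//; have [yp|/ltW yp] := leP y p; last exact: upa.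
  by rewrite -jp; exact: dec1.
move=> yeta; rewrite addrC -lerBrDr.
have [/neg h|/ltW y0] := leP y 0; first exact: le_trans cj1 h.
rewrite pos//; have [yp|/ltW yp] := leP y p.
  apply: le_trans cj1 _; apply: dec1 => //; last exact: ltW.
  by move: yeta; rewrite distrC ger0_norm ?subr_ge0// /y1 le_max => ?; apply/orP; right; lra.
have yeta' : p + eta <= y by move: yeta; rewrite ger0_norm ?subr_ge0//; lra.
have y2y : y2 <= y by rewrite /y2 ge_min yeta'.
have [yh|/ltW yh] := leP y (pi - p).
  apply: le_trans cj2 _; move: y2y; rewrite le_eqVlt => /predU1P[->//|y2y].
  by apply/ltW/inc2s => //; exact: ltW.
apply: le_trans cc2 _.
have [yh2|/ltW yh2] := leP y (pi + p); first by rewrite -jpip; exact: dec3.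
by rewrite -[y](subrK pi) jpi lerDr upa//; lra.
Qed.

Lemma asin_in {R : realType} (k : R) : 0 < k -> k < pi^-1 ->
  0 < asin (2 * k) < pi / 2 /\ sin (asin (2 * k)) = 2 * k.
Proof.
move=> k0 kpi; have k1 : 2 * k < 1.
  have p2 := pi_ge2 R; have : k * pi < 1 by rewrite -ltr_pdivlMr ?pi_gt0// div1r.
  by have := ler_wpM2l (ltW k0) p2; lra.
have sk : sin (asin (2 * k)) = 2 * k by rewrite asinK// in_itv /=; apply/andP; split; lra.
have i1 : -1 <= 2 * k < 1 by apply/andP; split; lra.
split => //; rewrite asin_ltpi2// andbT ltNge; apply/negP => h.
have i2 : -1 <= 2 * k <= 1 by apply/andP; split; lra.
have := sin_le_halfpi _ _ (asin_geNpi2 i2) h (ltW _).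
by rewrite sk sin0 => /(_ (divr_gt0 (pi_gt0 R) (ltr0n _ 2))); lra.
Qed.

(** [|C Y| + |C y - C Y|] is the cost of the path from 0 through [Y] to [y]. The multiplicative
    error [theta] is harmless only once this cost is bounded, and this is where strict
    subcriticality is used. *)
Lemma well_stability {R : realType} (C : R -> R) (k p eta : R) : abs_sin_prim C ->
  0 < p < pi / 2 -> sin p = 2 * k -> 0 < k -> k < pi^-1 -> 0 < eta ->
  exists2 rho, 0 < rho & forall theta r E y Y, 0 <= theta <= rho -> r <= rho -> 0 <= E ->
    E + (1 - theta) / 4 * (`|C Y| + `|C y - C Y|) - k / 2 * y
      <= C p / 4 - k / 2 * p + r ->
    [/\ `|y - p| <= eta, `|Y| <= p + eta, E <= eta &
      C p / 4 - k / 2 * p - eta <=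
        (1 - theta) / 4 * (`|C Y| + `|C y - C Y|) - k / 2 * y].
Proof.
move=> hC p02 sp k0 kpi eta0; have [dC C0] := hC.
set w := C p / 4 - k / 2 * p.
(* A slope strictly between [k] and the critical one: the tangent bound for [k'] dominates the twist
   term with slope [k] by the fraction [q = k/k' < 1] of the cost, up to a constant. *)
pose k' := (k + pi^-1) / 2.
have kk' : k < k' by rewrite /k'; lra.
have k'pi : k' < pi^-1 by rewrite /k'; lra.
have k'0 : 0 < k' by exact: lt_trans kk'.
have [p'02 sp'] := asin_in _ k'0 k'pi.
have [_ _ [T' _]] := asp_tangent _ _ _ _ hC p'02 sp' k'0 k'pi eta0.
set D' := C _ - _ in T'.
have /andP[p0 _] := p02.
pose c3 := C (p + eta) - C p.
have c30 : 0 < c3.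
  have pe : p < Num.min (p + eta) pi.
    by rewrite lt_min ltrDl eta0 /=; move: p02 => /andP[_]; have := pi_gt0 R; lra.
  rewrite subr_gt0; apply: (@lt_le_trans _ _ (C (Num.min (p + eta) pi))).
    apply: (lt_of_der _ _ _ _ pe (fun x _ => dC x)) => x /andP[px].
    rewrite lt_min => /andP[_ xpi]; rewrite normr_gt0 gt_eqF// sin_gt0_pi//.
    by rewrite (lt_trans p0).
  by apply: asp_nd => //; rewrite ge_min lexx.
(* Pinning [y] this closely limits the gain [2 k (y - p)] to half of [c3], the extra cost of an
   excursion beyond [p + eta]. *)
pose eta' := Num.min eta (c3 / (4 * k)).
have eta'0 : 0 < eta' by rewrite lt_min eta0 divr_gt0// mulr_gt0.
have eta'1 : eta' <= eta by rewrite ge_min lexx.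
have eta'2 : 4 * k * eta' <= c3.
  by rewrite mulrC -ler_pdivlMr ?mulr_gt0// ge_min lexx orbT.
have [c c0 [T1 T2]] := asp_tangent _ _ _ _ hC p02 sp k0 kpi eta'0.
pose q := k / k'.
have q0 : 0 < q by rewrite divr_gt0.
have q1 : q < 1 by rewrite ltr_pdivrMr// mul1r.
have qE : k = q * k' by rewrite /q divfK// gt_eqF.
(* The a priori bound on the cost: for [theta <= (1 - q)/2], a fraction [(1 - q)/8] of it remains
   after absorbing the twist term. *)
pose M := 2 * (4 * `|w| + 4 + `|D'|) / (1 - q).
have M0 : 0 <= M.
  by apply: divr_ge0; [have := normr_ge0 w; have := normr_ge0 D'; lra|lra].
have M1 : 0 < 1 + M / 4 by lra.
pose mm := Num.min eta (Num.min (c / 8) (c3 / 16)).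
have mm0 : 0 < mm by rewrite /mm !lt_min eta0 /= !divr_gt0.
have mm1 : mm <= eta by rewrite ge_min lexx.
have mm2 : mm <= c / 8 by rewrite !ge_min lexx orbT.
have mm3 : mm <= c3 / 16 by rewrite !ge_min lexx !orbT.
pose rho := Num.min ((1 - q) / 2) (Num.min 1 (mm / (1 + M / 4))).
have rho0 : 0 < rho by rewrite /rho !lt_min ltr01 /= !divr_gt0// subr_gt0.
have rho1 : rho <= (1 - q) / 2 by rewrite ge_min lexx.
have rho2 : rho <= 1 by rewrite !ge_min lexx orbT.
have rho3 : rho * (1 + M / 4) <= mm by rewrite -ler_pdivlMr// !ge_min lexx !orbT.
exists rho => // theta r E y Y /andP[t0 tr] rr E0 main.
set X := `|C Y| + `|C y - C Y| in main *.
have XCy : `|C y| <= X.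
  by rewrite /X; have := ler_normD (C Y) (C y - C Y); rewrite addrC subrK addrC.
have X0 : 0 <= X by rewrite addr_ge0.
have XCY : `|C Y| <= X by rewrite lerDl.
have ybd : k * y <= q / 2 * (X - D').
  have := T' y; rewrite qE => h; have := ler_wpM2l (ltW q0) h.
  by have := ler_wpM2l (ltW q0) XCy; lra.
have XM : X <= M.
  rewrite /M ler_pdivlMr ?subr_gt0//.
  have h1 : theta * X <= (1 - q) / 2 * X by rewrite ler_wpM2r// (le_trans tr).
  have h2 : - (q * D') <= `|D'|.
    by rewrite -mulrN (le_trans (ler_norm _))// normrM normrN ger0_norm ?(ltW q0)// ler_piMl// ltW.
  by have := ler_norm w; lra.
have tXM : theta * X <= rho * M by exact: ler_pM.
have lowX : w <= X / 4 - k / 2 * y by have := T1 y; rewrite /w; lra.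
have upX : E + X / 4 - k / 2 * y <= w + mm by lra.
have yp : `|y - p| <= eta'.
  rewrite leNgt; apply/negP => /ltW /T2 h.
  by move: upX; rewrite /w; lra.
split.
- exact: le_trans eta'1.
- rewrite leNgt; apply/negP => lt.
  have : C (p + eta) <= `|C Y| by rewrite asp_norm// asp_nd// ltW.
  have : k * (y - p) <= k * eta'.
    by rewrite ler_wpM2l ?(ltW k0)// (le_trans (ler_norm _)).
  by move: upX; rewrite /w -/c3 => h1 h2 h3; have : c3 = C (p + eta) - C p by []; lra.
- by lra.
- by lra.
Qed.

(** * Convergence of trajectories *)

Lemma system_close {R : realType} (G0 y1 y2 z1 z2 e1 e2 : R -> R) (M eta : R) :
  0 <= eta -> (forall a b, `|G0 a - G0 b| <= `|a - b|) ->
  (forall x, 0 <= x <= M -> {for x, continuous y1}) ->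
  (forall x, 0 <= x <= M -> {for x, continuous y2}) ->
  (forall x, 0 <= x <= M -> {for x, continuous z1}) ->
  (forall x, 0 <= x <= M -> {for x, continuous z2}) ->
  (forall x : R, 0 < x <= M -> is_derive x 1 y1 (y2 x + e1 x)) ->
  (forall x : R, 0 < x <= M -> is_derive x 1 y2 (G0 (y1 x) + e2 x)) ->
  (forall x : R, 0 < x <= M -> is_derive x 1 z1 (z2 x)) ->
  (forall x : R, 0 < x <= M -> is_derive x 1 z2 (G0 (z1 x))) ->
  (forall x, 0 < x <= M -> `|e1 x| <= eta /\ `|e2 x| <= eta) ->
  `|y1 0 - z1 0| <= eta -> `|y2 0 - z2 0| <= eta ->
  forall x, 0 <= x <= M -> `|y1 x - z1 x| <= 2 * eta * expR (2 * M) /\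
                           `|y2 x - z2 x| <= 2 * eta * expR (2 * M).
Proof.
move=> eta0 lip cy1 cy2 cz1 cz2 dy1 dy2 dz1 dz2 he i1 i2 x xM.
pose u t := (y1 t - z1 t) ^+ 2 + (y2 t - z2 t) ^+ 2.
pose du t := 2 * (y1 t - z1 t) * (y2 t + e1 t - z2 t)
             + 2 * (y2 t - z2 t) * (G0 (y1 t) + e2 t - G0 (z1 t)).
have sq_le (a : R) : `|a| <= eta -> a ^+ 2 <= eta ^+ 2.
  by move=> h; rewrite -[a ^+ 2]ger0_norm ?sqr_ge0// normrX lerXn2r// nnegrE.
have Du (t : R) : 0 < t <= M -> is_derive t 1 u (du t).
  move=> tM; have := dy1 t tM; have := dy2 t tM; have := dz1 t tM; have := dz2 t tM.
  by move=> h1 h2 h3 h4; rewrite /u /du; derive_eq; ring.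
have cu t : 0 <= t <= M -> {for t, continuous u}.
  move=> tM; apply: cvgD.
    apply: (@continuous_comp _ _ _ (fun t => y1 t - z1 t) (fun s => s ^+ 2)).
      by apply: cvgB; [exact: cy1|exact: cz1].
    exact: (contX (fun s : R => s) 2 contId).
  apply: (@continuous_comp _ _ _ (fun t => y2 t - z2 t) (fun s => s ^+ 2)).
    by apply: cvgB; [exact: cy2|exact: cz2].
  exact: (contX (fun s : R => s) 2 contId).
have le t : 0 < t <= M -> du t <= 3 * u t + 3 * eta ^+ 2.
  move=> tM; have [/sq_le h1 /sq_le h2] := he t tM.
  set a := y1 t - z1 t; set b := y2 t - z2 t; set g := G0 (y1 t) - G0 (z1 t).
  have ga : g ^+ 2 <= a ^+ 2.
    rewrite -[g ^+ 2]ger0_norm ?sqr_ge0// -[a ^+ 2]ger0_norm ?sqr_ge0// !normrX.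
    by rewrite lerXn2r ?nnegrE//; exact: lip.
  have -> : du t = 2 * a * (b + e1 t) + 2 * b * (g + e2 t).
    by rewrite /du /a /b /g; ring.
  have -> : u t = a ^+ 2 + b ^+ 2 by [].
  have := sqr_ge0 (a - b); have := sqr_ge0 (a - e1 t); have := sqr_ge0 (b - g).
  have := sqr_ge0 (b - e2 t); have := sqr_ge0 eta; clear -h1 h2 ga; nra.
have u0 : 0 <= u 0 by rewrite addr_ge0// sqr_ge0.
have K3 : (0 : R) < 3 by [].
have h := gronwall u du 3 (eta ^+ 2) M K3 (sqr_ge0 _) u0 cu Du le x xM.
have u02 : u 0 <= 2 * eta ^+ 2 by have := sq_le _ i1; have := sq_le _ i2; rewrite /u; lra.
have M0 : 0 <= M by case/andP: xM => x0 /(le_trans x0).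
have ux : u x <= (2 * eta * expR (2 * M)) ^+ 2.
  apply: le_trans h _.
  (* Gronwall gives [3 eta^2 exp (3 M)]; rounding 3 up to 4 makes the bound a perfect square. *)
  apply: (@le_trans _ _ (4 * eta ^+ 2 * expR (4 * M))).
    apply: ler_pM; rewrite ?addr_ge0 ?sqr_ge0 ?expR_ge0//.
      by have := sqr_ge0 eta; lra.
    by rewrite ler_expR; lra.
  have -> : 4 * M = 2 * M + 2 * M by ring.
  rewrite expRD le_eqVlt; apply/orP; left; apply/eqP; ring.
have B0 : 0 <= 2 * eta * expR (2 * M) by rewrite !mulr_ge0 ?expR_ge0.
by split; rewrite -(@ler_pXn2r _ 2)// ?nnegrE// -normrX ger0_norm ?sqr_ge0//;
  apply: le_trans ux; rewrite ?lerDl ?lerDr sqr_ge0.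
Qed.

(** * Asymptotics at zero *)

Lemma asym_equivP {R : realType} (f g : R -> R) :
  (\forall e \near 0^'+, g e != 0) ->
  (forall eta, 0 < eta -> \forall e \near 0^'+, `|f e - g e| <= eta * `|g e|) ->
  asym_equiv f g.
Proof.
move=> g0 h; exists (fun e => f e / g e - 1); split.
  apply/cvgr0Pnorm_le => eta eta0; near=> e.
  have ge0 : g e != 0 by near: e.
  have -> : f e / g e - 1 = (f e - g e) / g e by field.
  rewrite normrM normfV ler_pdivrMr ?normr_gt0//.
  by near: e; exact: h.
by apply: filterS g0 => e ge0; field.
Unshelve. all: by end_near. Qed.

(** The remainder must not depend on [x], so it is read off the supremum over (0, 1). *)
Lemma sup_ratio {R : realType} (phi : R -> R -> R) (p : R) : 0 < p ->
  (forall eta, 0 < eta -> \forall e \near 0^'+, forall x, 0 < x < 1 ->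
     `|phi e x| <= p + eta) ->
  exists r : R -> R, r e @[e --> 0^'+] --> 0 /\
    \forall e \near 0^'+, forall x, 0 < x < 1 -> `|phi e x| <= p * (1 + r e).
Proof.
move=> p0 h.
pose S e := [set `|phi e x| | x in [set x | 0 < x < 1]].
pose m e := sup (S e).
have Sn e : S e !=set0.
  by exists `|phi e 2^-1|; exists 2^-1 => //=; apply/andP; split; lra.
have mle e b : (forall x, 0 < x < 1 -> `|phi e x| <= b) ->
    m e <= b /\ forall x, 0 < x < 1 -> `|phi e x| <= m e.
  move=> hb; have ub : ubound (S e) b by move=> _ [x /= x01 <-]; exact: hb.
  split; first by apply: ge_sup.
  by move=> x x01; apply: ub_le_sup; [exists b|exists x].
(* The maximum with 0 leaves only an upper bound on the supremum to prove. For small [e] the set is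
   bounded; for other [e] the value of [sup] is immaterial. *)
exists (fun e => Num.max 0 (m e / p - 1)); split.
  apply/cvgr0Pnorm_le => eta eta0; near=> e.
  rewrite ger0_norm ?le_max ?lexx// ge_max (ltW eta0) /=.
  rewrite lerBlDr ler_pdivrMr//.
  have : forall x, 0 < x < 1 -> `|phi e x| <= p + eta * p.
    by near: e; apply: h; rewrite mulr_gt0.
  by move=> /mle [+ _]; lra.
near=> e => x x01.
have hp : forall x, 0 < x < 1 -> `|phi e x| <= p + 1 by near: e; exact: h.
have [_ /(_ x x01) mx] := mle _ _ hp.
apply: le_trans mx _; rewrite mulrC -ler_pdivrMr// addrC -lerBlDr.
by rewrite le_max lexx orbT.
Unshelve. all: by end_near. Qed.

Lemma near1_bounds {R : realType} (s u : R) : s <= 8^-1 -> `|1 - u| <= s ->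
  [/\ `|1 - (u ^+ 2)^-1| <= 4 * s, `|u ^+ 4 - 1| <= 5 * s, u ^+ 4 <= 2,
      `|1 - u ^+ 2| <= 3 * s & 2^-1 <= u <= 3 / 2].
Proof.
move=> s8 us; have s0 : 0 <= s by exact: le_trans us.
have /andP[h1 h2] : - s <= 1 - u <= s by rewrite -ler_norml.
have u0 : 0 < u by lra.
have u2 : `|1 - u ^+ 2| <= 17 / 8 * s.
  have -> : 1 - u ^+ 2 = (1 - u) * (1 + u) by ring.
  rewrite normrM mulrC (ger0_norm (_ : 0 <= 1 + u)); last by lra.
  by apply: ler_pM => //; lra.
have uu : 49 / 64 <= u ^+ 2 by nra.
have uu' : u ^+ 2 <= 81 / 64 by nra.
have u4 : `|u ^+ 4 - 1| <= 5 * s.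
  have -> : u ^+ 4 - 1 = - ((1 - u ^+ 2) * (1 + u ^+ 2)) by ring.
  rewrite normrN normrM (ger0_norm (_ : 0 <= 1 + u ^+ 2)); last by lra.
  apply: (@le_trans _ _ (17 / 8 * s * (145 / 64))); last by lra.
  by apply: ler_pM => //; lra.
split => //.
- have -> : 1 - (u ^+ 2)^-1 = - (1 - u ^+ 2) / u ^+ 2 by field; rewrite gt_eqF.
  rewrite normrM normfV normrN ler_pdivrMr ?normr_gt0 ?expf_neq0 ?gt_eqF//.
  rewrite (ger0_norm (_ : 0 <= u ^+ 2)) ?sqr_ge0//.
  by apply: le_trans u2 _; nra.
- by move: u4; rewrite ler_norml => /andP[_]; lra.
- by lra.
- by apply/andP; split; lra.
Qed.

(** Blow-up at an endpoint: [(sg, x0)] is (1, 0) at the left end and (-1, 1) at the right one,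
    lengths are measured in units of [1/L] and the phase in units of [sc]. [G0] is the limit
    nonlinearity, the identity in (a) and [sin * cos] in (b) and (c). The error [e1] comes from
    replacing [F] by [2 kappa + P], and [e2] from [V^4] and from passing to [G0]. The extra [eta] in
    [B] is due to [e1], since [Psi' = y2 + e1]. *)
Lemma layer {R : realType} (eps delta kappa s sc sg x0 M eta : R)
    (v dv phi dphi V F Phi P G0 z1 z2 : R -> R) :
  0 < eps -> 0 < delta -> reduced eps delta kappa v dv phi dphi V F Phi P ->
  let L := Num.sqrt delta / eps in
  s <= 8^-1 -> (forall x, 0 <= x <= 1 -> `|1 - V x| <= s) ->
  0 < sc -> 0 <= eta -> 0 < M -> M < L ->
  (sg = 1 /\ x0 = 0) \/ (sg = -1 /\ x0 = 1) ->
  (forall a b, `|G0 a - G0 b| <= `|a - b|) ->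
  (forall t, 0 <= t <= M -> {for t, continuous z1}) ->
  (forall t, 0 <= t <= M -> {for t, continuous z2}) ->
  (forall t : R, 0 < t <= M -> is_derive t 1 z1 (z2 t)) ->
  (forall t : R, 0 < t <= M -> is_derive t 1 z2 (G0 (z1 t))) ->
  (forall t, 0 <= t <= M -> `|P (x0 + sg * (t / L))| * (4 * s) <= eta * (L * sc)) ->
  (forall x, 0 <= x <= 1 ->
     `|V x ^+ 4 * (sin (Phi x) * cos (Phi x)) / sc - G0 (Phi x / sc)| <= eta) ->
  `|Phi x0 / sc - z1 0| <= eta ->
  `|sg * (2 * kappa + P x0) / (L * sc) - z2 0| <= eta ->
  let Psi := fun t => sc^-1 * phi (x0 + sg * (eps * t / Num.sqrt delta)) in
  let B := 2 * eta * expR (2 * M) + eta in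
  (forall t, 0 <= t <= M -> `|Psi t - z1 t| <= B) /\
  (forall t, 0 < t <= M -> derivable Psi t 1 /\ `|derive1 Psi t - z2 t| <= B).
Proof.
move=> e0 d0 hred L s8 Vs sc0 eta0 M0 ML hsg lip cz1 cz2 dz1 dz2 hP hE i1 i2 Psi B.
have [cV Vp vE cF dPhi Phi0 phiE cP P1 dP FE _] := hred.
have sd0 : 0 < Num.sqrt delta by rewrite sqrtr_gt0.
have L0 : 0 < L by rewrite divr_gt0.
have Ln0 : L != 0 by rewrite gt_eqF.
have scn0 : sc != 0 by rewrite gt_eqF.
have L2 : delta / eps ^+ 2 = L ^+ 2 by rewrite /L expr_div_n sqr_sqrtr// ltW.
pose X t := x0 + sg * (t / L).
have XE t : x0 + sg * (eps * t / Num.sqrt delta) = X t.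
  by rewrite /X /L; congr (_ + _ * _); field; rewrite !gt_eqF.
have sg2 : sg ^+ 2 = 1 by case: hsg => -[-> _]; ring.
have Xin t : 0 <= t <= M -> 0 <= X t <= 1.
  move=> /andP[t0 tM]; have tL0 : 0 <= t / L by rewrite divr_ge0// ltW.
  have tL1 : t / L <= 1 by rewrite ler_pdivrMr// mul1r ltW// (le_lt_trans tM).
  by rewrite /X; case: hsg => -[-> ->]; clear -tL0 tL1; apply/andP; split; lra.
have Xoo t : 0 < t <= M -> 0 < X t < 1.
  move=> /andP[t0 tM]; have tL0 : 0 < t / L by rewrite divr_gt0.
  have tL1 : t / L < 1 by rewrite ltr_pdivrMr// mul1r (le_lt_trans tM).
  by rewrite /X; case: hsg => -[-> ->]; clear -tL0 tL1; apply/andP; split; lra.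
have dX (t : R) : is_derive t 1 X (sg / L) by rewrite /X; derive_eq; ring.
pose y1 t := Phi (X t) / sc.
pose y2 t := sg * (2 * kappa + P (X t)) / (L * sc).
pose e1 t := sg * (F (X t) - (2 * kappa + P (X t))) / (L * sc).
pose e2 t := V (X t) ^+ 4 * (sin (Phi (X t)) * cos (Phi (X t))) / sc - G0 (Phi (X t) / sc).
have dy1 (t : R) : is_derive t 1 y1 (y2 t + e1 t).
  have d := derOf _ _ _ _ _ dPhi (dX t).
  by rewrite /y1 /y2 /e1; derive_eq; field; rewrite ?Ln0 ?scn0.
have dy2 (t : R) : 0 < t <= M -> is_derive t 1 y2 (G0 (y1 t) + e2 t).
  move=> tM; have t01 : 0 <= X t <= 1 by apply: Xin; case/andP: tM => /ltW -> ->.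
  have d := derO _ _ _ _ _ (dP _ t01) (dX t).
  rewrite /y1 /y2 /e2 [G0 _ + _]addrC subrK; derive_eq.
  rewrite L2; set T := V _ ^+ 4 * _.
  transitivity (sg ^+ 2 * T / sc); last by rewrite sg2 mul1r.
  by field; rewrite ?Ln0 ?scn0.
have he t : 0 < t <= M -> `|e1 t| <= eta /\ `|e2 t| <= eta.
  move=> /andP[t0 tM]; have t0M : 0 <= t <= M by rewrite ltW.
  have X01 := Xin t t0M; split; last exact: hE.
  have [h1 _ _ _ _] := near1_bounds _ _ s8 (Vs _ X01).
  have -> : e1 t = - sg * (P (X t) * (1 - (V (X t) ^+ 2)^-1)) / (L * sc).
    by rewrite /e1 FE; field; rewrite ?Ln0 ?scn0 ?gt_eqF.
  have Lsc : 0 < L * sc by rewrite mulr_gt0.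
  rewrite normrM normfV (ger0_norm (ltW Lsc)) ler_pdivrMr// !normrM normrN.
  have -> : `|sg| = 1 by case: hsg => -[-> _]; rewrite ?normrN normr1.
  rewrite mul1r; apply: le_trans (hP t t0M).
  by rewrite ler_wpM2l.
have X0 : X 0 = x0 by rewrite /X mul0r mulr0 addr0.
have cy2' : continuous (fun t : R => sg * (2 * kappa + P (x0 + sg * (t * L^-1))) * (L * sc)^-1).
  by cont.
have cy2 t : {for t, continuous y2} by exact: cy2'.
have main := system_close G0 y1 y2 z1 z2 e1 e2 M eta eta0 lip
  (fun t _ => der_cont _ _ _ (dy1 t)) (fun t _ => cy2 t) cz1 cz2
  (fun t _ => dy1 t) dy2 dz1 dz2 he.
rewrite {}/y1 {}/y2 in main dy1 dy2 cy2 cy2' *.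
rewrite !X0 in main; have {}main := main i1 i2.
have PsiE t : 0 <= t <= M -> Psi t = Phi (X t) / sc.
  by move=> tM; rewrite /Psi XE phiE ?Xin// mulrC.
split=> t tM.
  by rewrite PsiE//; have [h _] := main t tM; rewrite /B (le_trans h)// lerDl.
have t0M : 0 <= t <= M by case/andP: tM => /ltW -> ->.
have dPsi : is_derive t 1 Psi (sg * F (X t) / (L * sc)).
  have dpx : is_derive (X t) 1 phi (F (X t)).
    apply: (derivE_on phi Phi _ 0 1 _ (Xoo t tM)) => // y /andP[y0 y1].
    by apply: phiE; rewrite !ltW.
  have d := derO _ _ _ _ _ dpx (dX t).
  have -> : Psi = (fun t => sc^-1 * phi (X t)) by apply/funext => y; rewrite /Psi XE.
  by derive_eq; field; rewrite ?Ln0 ?scn0.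
have [dd ->] := derE dPsi; split => //.
have [_ h] := main t t0M; have [h1 _] := he t tM.
have -> : sg * F (X t) / (L * sc) - z2 t =
   (sg * (2 * kappa + P (X t)) / (L * sc) - z2 t) + e1 t.
  by rewrite /e1; field; rewrite ?Ln0 ?scn0.
by apply: le_trans (ler_normD _ _) _; exact: lerD.
Qed.

(** * Bounded twist *)

Lemma cos_le_taylor {R : realType} (x : R) : 0 <= x ->
  cos x <= 1 - x ^+ 2 / 2 + x ^+ 4 / 24.
Proof.
have s1 (y : R) : 0 <= y -> 0 <= y - sin y.
  move=> y0; pose g z : R := z - sin z.
  have dg (z : R) : is_derive z 1 g (1 - cos z) by rewrite /g; derive_eq; ring.
  have -> : 0 = g 0 by rewrite /g sin0 subrr.
  by apply: (le_of_der _ _ _ _ y0 (fun z _ => dg z)) => z _; rewrite subr_ge0 cos_le1.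
have c2 (y : R) : 0 <= y -> 0 <= cos y - 1 + y ^+ 2 / 2.
  move=> y0; pose g z : R := cos z - 1 + z ^+ 2 / 2.
  have dg (z : R) : is_derive z 1 g (z - sin z).
    by rewrite /g; derive_eq; rewrite /=; field.
  have -> : 0 = g 0 by rewrite /g cos0 expr0n /=; ring.
  by apply: (le_of_der _ _ _ _ y0 (fun z _ => dg z)) => z /andP[z0 _]; exact: s1.
have s3 (y : R) : 0 <= y -> 0 <= sin y - y + y ^+ 3 / 6.
  move=> y0; pose g z : R := sin z - z + z ^+ 3 / 6.
  have dg (z : R) : is_derive z 1 g (cos z - 1 + z ^+ 2 / 2).
    by rewrite /g; derive_eq; rewrite /=; field.
  have -> : 0 = g 0 by rewrite /g sin0 expr0n /=; ring.
  by apply: (le_of_der _ _ _ _ y0 (fun z _ => dg z)) => z /andP[z0 _]; exact: c2.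
move=> x0; rewrite -subr_ge0; pose g z : R := 1 - z ^+ 2 / 2 + z ^+ 4 / 24 - cos z.
have dg (z : R) : is_derive z 1 g (sin z - z + z ^+ 3 / 6).
  by rewrite /g; derive_eq; rewrite /=; field.
have <- : g 0 = 0 by rewrite /g cos0 !expr0n /=; ring.
by apply: (le_of_der _ _ _ _ x0 (fun z _ => dg z)) => z /andP[z0 _]; exact: s3.
Qed.

Lemma asp_quad {R : realType} (C : R -> R) (y : R) : abs_sin_prim C -> 0 <= y <= 1 ->
  y ^+ 2 / 2 - y ^+ 4 / 24 <= C y /\ 11 / 24 * y ^+ 2 <= C y.
Proof.
move=> hC /andP[y0 y1].
rewrite (asp_cos _ _ hC); last by rewrite y0 (le_trans y1)// (le_trans _ (pi_ge2 R))// ler1n.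
have h := cos_le_taylor _ y0; split; first by lra.
have y2 : y ^+ 2 <= 1 by rewrite expr_le1.
have : y ^+ 4 <= y ^+ 2.
  have -> : y ^+ 4 = y ^+ 2 * y ^+ 2 by ring.
  by rewrite ler_piMr// sqr_ge0.
lra.
Qed.

(** Counterpart of [well_stability] for [k] tending to 0. All errors must be small relative to
    [k^2], so the well is handled through the expansion [C y = y^2/2 + O(y^4)], for which
    [C y / 4 - k y / 2] has its minimum [- k^2/2] at [2 k]. *)
Lemma weak_twist_stability {R : realType} (C : R -> R) (k theta r E y Y : R) :
  abs_sin_prim C -> 0 < k <= 100^-1 -> 0 <= theta <= 2^-1 -> 0 <= r <= 2^-1 -> 0 <= E ->
  E + (1 - theta) / 4 * (`|C Y| + `|C y - C Y|) - k / 2 * y <= - k ^+ 2 / 2 + k ^+ 2 * r ->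
  let omega := r + 9 * theta + 69 * k ^+ 2 in
  [/\ `|Y| <= 9 * k, E + (y - 2 * k) ^+ 2 / 8 <= k ^+ 2 * omega &
    - k ^+ 2 / 2 - k ^+ 2 * omega <=
      (1 - theta) / 4 * (`|C Y| + `|C y - C Y|) - k / 2 * y].
Proof.
move=> hC /andP[k0 k1] /andP[t0 t1] /andP[r0 r1] E0 main omega.
set X := `|C Y| + `|C y - C Y| in main *.
have XCy : `|C y| <= X.
  by rewrite /X; have := ler_normD (C Y) (C y - C Y); rewrite addrC subrK addrC.
have X0 : 0 <= X by rewrite addr_ge0.
have XCY : `|C Y| <= X by rewrite lerDl.
have tX : theta * X <= 2^-1 * X by rewrite ler_wpM2r.
have kr : k ^+ 2 * r <= k ^+ 2 / 2 by rewrite ler_wpM2l ?sqr_ge0.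
have X4 : X <= 4 * (k * y) by clear -E0 main tX kr; lra.
have y0 : 0 <= y.
  have ky0 : 0 <= k * y by clear -X0 X4; lra.
  by rewrite pmulr_rge0 in ky0.
have Cy : C y <= 4 * (k * y) by apply: le_trans X4; rewrite (le_trans _ XCy)// ler_norm.
have k8 : (8^-1 : R) < pi^-1.
  by rewrite ltf_pV2 ?posrE ?pi_gt0//; have := pihalf_lt2 R; lra.
have C1 : 11 / 24 <= C 1.
  by have [|_] := asp_quad C 1 hC; rewrite ?ler01 ?lexx// expr1n mulr1.
have big z : 1 < z -> 11 / 24 <= C z.
  by move=> z1; apply: le_trans C1 _; apply: asp_nd => //; exact: ltW.
(* A crude confinement that makes the expansion available: the tangent bound with slope 1/4 keeps
   [y] below a multiple of [p < pi/2], so that [C y <= y/25] falls below [C 1 >= 11/24]. *)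
have y1 : y <= 1.
  have [p02 sp] := asin_in (8^-1 : R) (ltac:(lra)) k8.
  have [_ _ [/(_ y) T _]] := asp_tangent _ _ _ _ hC p02 sp (ltac:(lra)) k8 (@ltr01 R).
  set p := asin _ in p02 T; have /andP[p0 p2] := p02.
  have Cp := asp_ge0 _ _ hC (ltW p0).
  rewrite (ger0_norm (asp_ge0 _ _ hC y0)) in T.
  have ky : k * y <= 100^-1 * y by rewrite ler_wpM2r.
  have pi4 := pihalf_lt2 R.
  rewrite leNgt; apply/negP => /big; clear -T Cp ky Cy p2 pi4 y0; lra.
have y01 : 0 <= y <= 1 by rewrite y0.
have [q1 q2] := asp_quad C y hC y01.
have y9 : y <= 9 * k.
  have h : y * (11 / 24 * y) <= y * (4 * k).
    by move: q2 Cy; rewrite expr2; clear; lra.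
  move: y0; rewrite le_eqVlt => /predU1P[<-|yp]; first by rewrite mulr_ge0// ltW.
  by rewrite ler_pM2l// in h; clear -h k0; lra.
have ky9 : k * y <= 9 * k ^+ 2.
  by have := ler_wpM2l (ltW k0) y9; rewrite expr2; clear; lra.
have X36 : X <= 36 * k ^+ 2 by clear -X4 ky9; lra.
have k2 : k ^+ 2 <= 10000^-1 by clear -k0 k1; nra.
have Y9 : `|Y| <= 9 * k.
  have CY : C `|Y| <= 36 * k ^+ 2 by rewrite -asp_norm// (le_trans XCY).
  have Y1 : `|Y| <= 1.
    by rewrite leNgt; apply/negP => /big; clear -CY k2; lra.
  have [|_ q3] := asp_quad C `|Y| hC; first by rewrite normr_ge0.
  rewrite -(@ler_pXn2r _ 2)// ?nnegrE ?mulr_ge0 ?(ltW k0)//.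
  by rewrite exprMn; clear -q3 CY k0; have := sqr_ge0 k; lra.
have y4 : y ^+ 4 <= 6561 * k ^+ 4.
  have -> : 6561 * k ^+ 4 = (9 * k) ^+ 4 by ring.
  by rewrite lerXn2r// nnegrE// mulr_ge0// ltW.
have tX2 : theta * X <= theta * (36 * k ^+ 2) by rewrite ler_wpM2l.
have Xlow : y ^+ 2 / 2 - y ^+ 4 / 24 <= X.
  by apply: le_trans q1 (le_trans (ler_norm _) XCy).
have k4 : 0 <= k ^+ 4 by rewrite exprn_even_ge0.
have k2r : 0 <= k ^+ 2 * r by rewrite mulr_ge0 ?sqr_ge0.
(* Here [9 theta k^2] bounds [theta X / 4], and 69 rounds up 6561/96, coming from [y^4/96] with
   [y <= 9 k]. *)
have low : y ^+ 2 / 8 - k * y / 2 - 9 * (theta * k ^+ 2) - 69 * k ^+ 4 <=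
    (1 - theta) / 4 * X - k / 2 * y.
  by clear -y4 tX2 Xlow k4; lra.
have oE : k ^+ 2 * omega = k ^+ 2 * r + 9 * (theta * k ^+ 2) + 69 * k ^+ 4.
  by rewrite /omega; ring.
have sqE : (y - 2 * k) ^+ 2 / 8 = y ^+ 2 / 8 - k * y / 2 + k ^+ 2 / 2 by field.
split => //; first by rewrite sqE oE; clear -main low; lra.
have := sqr_ge0 (y - 2 * k); rewrite oE; clear -low sqE k2r; lra.
Qed.

(** The competitor solves the linearized equation [psi'' = L^2 psi] with the natural slope [2 kappa]
    at 1, and is shifted to vanish at 0. The shift lowers [psi 1] and costs the exponentially small
    term. *)
Lemma upper_weak {R : realType} (eps delta kappa L k : R) (v dv phi dphi : R -> R) :
  0 < eps -> 0 < L -> 0 < k ->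
  delta / eps ^+ 2 = L ^+ 2 -> kappa = k * L -> minimizer eps delta kappa v dv phi dphi ->
  Gfun eps delta kappa v dv phi dphi <= L * (- k ^+ 2 / 2 + k ^+ 2 * expR (- L)).
Proof.
move=> e0 L0 k0 dE kE hm.
pose psi x := 2 * k * (expR (L * (x - 1)) - expR (- L)).
pose dpsi x := 2 * k * L * expR (L * (x - 1)).
have dP (x : R) : is_derive x 1 psi (dpsi x) by rewrite /psi /dpsi; derive_eq; ring.
have cd : continuous dpsi by rewrite /dpsi; cont.
have cpsi := der_continuous _ _ dP.
have P0 : psi 0 = 0 by rewrite /psi sub0r mulrN1 subrr mulr0.
apply: le_trans (competitor _ _ _ _ _ _ _ _ _ hm dP cd P0) _.
have -> : delta / (8 * eps ^+ 2) = L ^+ 2 / 8 by rewrite -dE; field; rewrite gt_eqF.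
pose E2 x := expR (2 * L * (x - 1)) : R.
have dE2 (x : R) : is_derive x 1 (fun x => E2 x / (2 * L)) (E2 x).
  by rewrite /E2; derive_eq; field; rewrite gt_eqF.
have cE2 : continuous E2 by rewrite /E2; cont.
have E2sq x : expR (L * (x - 1)) ^+ 2 = E2 x.
  by rewrite expr2 -expRD /E2; congr expR; ring.
have I1 : Iint 0 1 (fun x => dpsi x ^+ 2) = 4 * k ^+ 2 * L ^+ 2 * Iint 0 1 E2.
  rewrite -IintZ; last exact: itg_cont.
  by apply: IintE => x _; rewrite /dpsi -E2sq; ring.
have I2 : Iint 0 1 (fun x => sin (psi x) ^+ 2) <= 4 * k ^+ 2 * Iint 0 1 E2.
  rewrite -IintZ; last exact: itg_cont.
  apply: Iint_le; [by apply: itg_cont; cont|by apply: itgZ; exact: itg_cont|].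
  move=> x /andP[x0 x1]; have -> : 4 * k ^+ 2 * E2 x = (2 * k * expR (L * (x - 1))) ^+ 2.
    by rewrite -E2sq; ring.
  have h : `|sin (psi x)| <= 2 * k * expR (L * (x - 1)).
    have := sin_lip (psi x) 0; rewrite sin0 !subr0 => /le_trans; apply.
    rewrite ger0_norm.
      by rewrite /psi ler_wpM2l ?mulr_ge0 ?(ltW k0)// gerBl expR_ge0.
    rewrite /psi mulr_ge0 ?mulr_ge0 ?(ltW k0)// subr_ge0 ler_expR.
    by have := mulr_ge0 (ltW L0) x0; lra.
  rewrite -[X in X <= _]ger0_norm ?sqr_ge0// normrX lerXn2r// nnegrE//.
  exact: le_trans h.
have I3 : Iint 0 1 E2 <= (2 * L)^-1.
  rewrite (Iint_FTC _ _ _ _ _ dE2)// {1}/E2 subrr mulr0 expR0 mul1r gerBl.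
  by rewrite divr_ge0 ?expR_ge0// mulr_ge0// ltW.
have {}I3 : k ^+ 2 * L ^+ 2 * Iint 0 1 E2 <= k ^+ 2 * L / 2.
  have -> : k ^+ 2 * L / 2 = k ^+ 2 * L ^+ 2 * (2 * L)^-1 by field; rewrite gt_eqF.
  by rewrite ler_wpM2l// mulr_ge0// sqr_ge0.
have {}I2 : L ^+ 2 / 8 * Iint 0 1 (fun x => sin (psi x) ^+ 2) <=
    L ^+ 2 / 8 * (4 * k ^+ 2 * Iint 0 1 E2).
  by rewrite ler_wpM2l// divr_ge0// sqr_ge0.
have psi1 : psi 1 = 2 * k * (1 - expR (- L)) by rewrite /psi subrr mulr0 expR0.
rewrite I1 psi1 kE; move: I2 I3; set I := Iint 0 1 E2; set J := Iint _ _ _.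
by clear; lra.
Qed.

Lemma near0_lin {R : realType} (c d : R) : 0 < d ->
  \forall e \near 0^'+, c * e <= d.
Proof.
move=> d0; have c1 : 0 < `|c| + 1 by rewrite ltr_wpDl.
near=> e.
have e0 : 0 < e by near: e; exact: nbhs_right_gt.
have : e <= d / (`|c| + 1) by near: e; apply: nbhs_right_le; rewrite divr_gt0.
rewrite ler_pdivlMr// => h; apply: le_trans h.
by rewrite mulrC ler_wpM2l ?(ltW e0)// ler_wpDr// ler_norm.
Unshelve. all: by end_near. Qed.

Lemma expRN_le_inv {R : realType} (L : R) : 0 < L -> expR (- L) <= L^-1.
Proof.
move=> L0; rewrite expRN lef_pV2 ?posrE ?expR_gt0//.
by apply: le_trans (expR_ge1Dx L); rewrite lerDr.
Qed.

Definition min_family {R : realType} (delta kappa : R -> R) (v dv phi dphi : R -> R -> R) :=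
  \forall e \near 0^'+, 0 < delta e /\ 0 < kappa e /\
    minimizer e (delta e) (kappa e) (v e) (dv e) (phi e) (dphi e) /\
    (forall x, 0 <= x <= 1 -> 0 <= v e x).

(** What (a) needs at a single [e], with a single tolerance; each asymptotic statement follows from
    a suitable [eta]. Errors on phase and energy are relative to their natural sizes [k] and
    [L k^2]. *)
Definition weak_profile {R : realType} (delta eta : R) (kappa : R -> R)
    (v dv phi dphi : R -> R -> R) (e : R) : Prop :=
  let L := Num.sqrt delta / e in let k := kappa e / L in
  exists V F Phi P,
  [/\ reduced e delta (kappa e) (v e) (dv e) (phi e) (dphi e) V F Phi P,
      (forall x, 0 <= x <= 1 -> `|1 - V x| <= eta),
      `|Phi 1 - 2 * k| <= eta * k,
      (forall x, 0 <= x <= 1 -> `|Phi x| <= 9 * k) &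
      `|Gfun e delta (kappa e) (v e) (dv e) (phi e) (dphi e) + L * k ^+ 2 / 2|
         <= eta * (L * k ^+ 2)] /\
  [/\ (forall x, 0 <= x <= 1 -> `|1 - V x| <= eta * e), 0 < k <= eta & eta^-1 <= L].

(** The gap between the bounds also controls the retained part of [Ev], by [2 L k^2] times a small
    number. As [L k^2] is of order [eps], [eps Ev] is [o(eps^2)], and this gives [1 - v = o(eps)] in
    place of the first estimate of order [sqrt eps]. *)
Lemma weak_twist_near {R : realType} (delta B eta : R) (kappa : R -> R)
    (v dv phi dphi : R -> R -> R) :
  0 < delta -> 0 < B -> 0 < eta <= 1 ->
  (\forall e \near 0^'+, kappa e <= B) ->
  min_family (fun=> delta) kappa v dv phi dphi ->
  \forall e \near 0^'+, weak_profile delta eta kappa v dv phi dphi e.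
Proof.
move=> d0 B0 /andP[eta0 eta1] hB hmin.
have [C hC] := abs_sin_prim_ex R.
set sd := Num.sqrt delta; have sd0 : 0 < sd by rewrite sqrtr_gt0.
(* The target for [om]: the first bound yields the relative error on [Phi 1], the second the rate
   for [1 - V]. *)
pose o := Num.min (eta ^+ 2 / 8) (eta ^+ 2 * sd / (64 * B ^+ 2)).
have o0 : 0 < o by rewrite lt_min !divr_gt0 ?mulr_gt0 ?exprn_gt0.
have o1 : 8 * o <= eta ^+ 2 by rewrite mulrC -ler_pdivlMr// ge_min lexx.
have o2 : o * (64 * B ^+ 2) <= eta ^+ 2 * sd.
  by rewrite -ler_pdivlMr ?mulr_gt0// ge_min lexx orbT.
pose theta := Num.min 2^-1 (o / 27).
have t0 : 0 < theta by rewrite lt_min invr_gt0 ltr0n divr_gt0.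
have t1 : theta <= 2^-1 by rewrite ge_min lexx.
have t2 : 27 * theta <= o by rewrite mulrC -ler_pdivlMr// ge_min lexx orbT.
pose s := Num.min (theta / 4) eta.
have s0 : 0 < s by rewrite lt_min eta0 divr_gt0.
have s1 : 4 * s <= theta by rewrite mulrC -ler_pdivlMr// ge_min lexx.
have s2 : s <= eta by rewrite ge_min lexx orbT.
have m1 : 0 < Num.min 100^-1 (Num.min eta (o / 207)).
  by rewrite !lt_min invr_gt0 ltr0n eta0 divr_gt0.
have m2 : 0 < Num.min 2^-1 (Num.min eta (o / 3)).
  by rewrite !lt_min invr_gt0 ltr0n eta0 divr_gt0.
near=> e; rewrite /weak_profile -/sd.
set L := sd / e; set k := kappa e / L.
have e0 : 0 < e by near: e; exact: nbhs_right_gt.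
have e1 : e <= 1 by near: e; apply: nbhs_right_le.
have e01 : 0 < e <= 1 by rewrite e0.
have [_ [k0 [hm vp]]] : 0 < delta /\ 0 < kappa e /\
   minimizer e delta (kappa e) (v e) (dv e) (phi e) (dphi e) /\
    (forall x, 0 <= x <= 1 -> 0 <= v e x) by near: e.
have kB : kappa e <= B by near: e.
have c1 : (16 * B ^+ 2) * e <= s ^+ 2 by near: e; apply: near0_lin; rewrite exprn_gt0.
have c2 : (8 * B ^+ 2) * e <= theta by near: e; exact: near0_lin.
have c3 : B / sd * e <= Num.min 100^-1 (Num.min eta (o / 207)).
  by near: e; exact: near0_lin.
have c4 : sd^-1 * e <= Num.min 2^-1 (Num.min eta (o / 3)).
  by near: e; exact: near0_lin.
have L0 : 0 < L by rewrite divr_gt0.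
have Li : L^-1 = sd^-1 * e by rewrite /L invf_div mulrC.
have kE : k = kappa e / sd * e by rewrite /k Li mulrA.
have kp : 0 < k by rewrite divr_gt0.
have {}c3 : k <= Num.min 100^-1 (Num.min eta (o / 207)).
  by apply: le_trans c3; rewrite kE !ler_pM2r ?invr_gt0.
have k1 : k <= 100^-1 by apply: le_trans c3 _; rewrite ge_min lexx.
have k2 : k <= eta by apply: le_trans c3 _; rewrite !ge_min lexx orbT.
have k3 : k <= o / 207 by apply: le_trans c3 _; rewrite !ge_min lexx !orbT.
have L1 : L^-1 <= 2^-1 by rewrite Li; apply: le_trans c4 _; rewrite ge_min lexx.
have L2 : L^-1 <= eta by rewrite Li; apply: le_trans c4 _; rewrite !ge_min lexx orbT.
have L3 : L^-1 <= o / 3 by rewrite Li; apply: le_trans c4 _; rewrite !ge_min lexx !orbT.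
have kap2 : kappa e ^+ 2 <= B ^+ 2 by rewrite lerXn2r// nnegrE ltW.
have es : 16 * (e * kappa e ^+ 2) <= s ^+ 2.
  by apply: le_trans c1; rewrite -mulrA ler_pM2l// mulrC ler_pM2r.
have shalf : 0 <= s <= 2^-1 by rewrite ltW//=; clear -s1 t1; lra.
have [V [F [Phi [P [hred Vs Vsq _]]]]] :=
  small_eps_reduced _ _ _ _ _ _ _ _ e01 d0 shalf hm vp es.
have ke : 8 * (kappa e ^+ 2 * e ^+ 2) <= theta.
  apply: le_trans c2; rewrite -mulrA ler_pM2l//; apply: ler_pM => //; rewrite ?sqr_ge0//.
  by rewrite expr2 ler_piMl// ltW.
have t01 : 0 < theta <= 1 by rewrite t0; clear -t1; lra.
have low := coupling _ _ _ _ _ _ _ _ _ _ _ _ _ e0 d0 hred t01 (ltW s0) s1 Vs ke.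
have dE : delta / e ^+ 2 = L ^+ 2 by rewrite /L expr_div_n sqr_sqrtr// ltW.
have kapE : kappa e = k * L by rewrite /k divfK// gt_eqF.
have up := upper_weak _ _ _ _ _ _ _ _ _ e0 L0 kp dE kapE hm.
have [_ _ _ cF dPhi Phi0 _ _ _ _ _ _] := hred.
have [dC C0] := hC.
have cS : continuous (fun x : R => `|sin x|) by cont.
have split x : 0 <= x <= 1 ->
    2 * L * (`|C (Phi x)| + `|C (Phi 1) - C (Phi x)|) <=
    Iint 0 1 (fun x => F x ^+ 2 + delta / e ^+ 2 * sin (Phi x) ^+ 2).
  move=> x01; apply: le_trans (calibration_split _ _ _ _ _ _ x01 (ltW L0) cF cS dPhi dC Phi0 C0) _.
  by rewrite le_eqVlt dE; apply/orP; left; apply/eqP; apply: IintE => y _; rewrite real_normK ?num_real.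
set G := Gfun _ _ _ _ _ _ _ in low up *.
set E := Ev e V (dv e) in low Vsq.
have E0 : 0 <= E := Ev_ge0 _ _ _.
set I := Iint 0 1 _ in low split.
pose r := expR (- L).
have rL : r <= L^-1 by exact: expRN_le_inv.
have key x : 0 <= x <= 1 ->
  E / (2 * L) + (1 - theta) / 4 * (`|C (Phi x)| + `|C (Phi 1) - C (Phi x)|) - k / 2 * Phi 1
    <= G / L.
  move=> x01; rewrite ler_pdivlMr//; apply: le_trans low.
  have := ler_wpM2l (_ : 0 <= (1 - theta) / 8) (split x x01).
  rewrite divr_ge0// ?subr_ge0; last by clear -t1; lra.
  move=> /(_ isT) h; rewrite kapE.
  have -> : forall X Y : R, (E / (2 * L) + (1 - theta) / 4 * X - k / 2 * Y) * L =
     E / 2 + (1 - theta) / 8 * (2 * L * X) - k * L / 2 * Y.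
    by move=> X Y; field; rewrite gt_eqF.
  by clear -h; lra.
have up' : G / L <= - k ^+ 2 / 2 + k ^+ 2 * r by rewrite ler_pdivrMr// mulrC.
have E20 : 0 <= E / (2 * L) by rewrite divr_ge0// mulr_ge0// ltW.
have r01 : 0 <= r <= 2^-1 by rewrite expR_ge0 (le_trans rL).
have k01 : 0 < k <= 100^-1 by rewrite kp.
have t01' : 0 <= theta <= 2^-1 by rewrite ltW.
have st x x01 := weak_twist_stability C k theta r (E / (2 * L)) (Phi 1) (Phi x) hC k01
  t01' r01 E20 (le_trans (key x x01) up').
have [_ st2 st3] := st 1 (ltac:(by rewrite ler01 lexx)).
set om := r + _ + _ in st st2 st3.
(* Each of the three terms of [om] is at most [o/3]; hence 27, 207 and 3 in the choices above. *)
have om0 : om <= o.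
  have : k ^+ 2 <= k by rewrite expr2 ler_piMl ?(ltW kp)//; clear -k1; lra.
  by rewrite /om; clear -k3 L3 rL t2; lra.
have kom : k ^+ 2 * om <= k ^+ 2 * o by rewrite ler_wpM2l// sqr_ge0.
exists V, F, Phi, P; split; split => //.
- by move=> x x01; exact: le_trans (Vs x x01) s2.
- rewrite -(@ler_pXn2r _ 2)// ?nnegrE ?(mulr_ge0 (ltW eta0) (ltW kp))//.
  rewrite -normrX ger0_norm ?sqr_ge0// exprMn.
  have := ler_wpM2l (sqr_ge0 k) o1; clear -st2 kom E20; lra.
- by move=> x x01; have [] := st x x01.
- have oe : o <= eta.
    have : eta ^+ 2 <= eta by rewrite expr2 ler_piMl// ltW.
    by clear -o1 eta0; lra.
  have koe : k ^+ 2 * o <= k ^+ 2 * eta by rewrite ler_wpM2l// sqr_ge0.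
  have kr : k ^+ 2 * r <= k ^+ 2 * om.
    rewrite ler_wpM2l ?sqr_ge0// /om; have := sqr_ge0 k; clear -t0; lra.
  have GL : `|G / L + k ^+ 2 / 2| <= eta * k ^+ 2.
    have k1' := key 1 (ltac:(by rewrite ler01 lexx)).
    by rewrite ler_norml; apply/andP; split; clear -k1' E20 st3 up' kom koe kr; lra.
  have -> : G + L * k ^+ 2 / 2 = L * (G / L + k ^+ 2 / 2) by field; rewrite gt_eqF.
  by rewrite normrM (ger0_norm (ltW L0)) mulrCA ler_pM2l.
- move=> x x01; rewrite -(@ler_pXn2r _ 2)// ?nnegrE ?(mulr_ge0 (ltW eta0) (ltW e0))//.
  rewrite -normrX ger0_norm ?sqr_ge0//; apply: le_trans (Vsq x x01) _.
  have EL : E <= 2 * L * (k ^+ 2 * o).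
    have : E / (2 * L) <= k ^+ 2 * o.
      by have := sqr_ge0 (Phi 1 - 2 * k); clear -st2 kom; lra.
    have L20 : 0 < 2 * L by rewrite mulr_gt0.
    by rewrite ler_pdivrMr// => h; rewrite mulrC.
  have LkE : L * k ^+ 2 = kappa e ^+ 2 / sd * e.
    by rewrite kE /L; field; rewrite !gt_eqF.
  have h1 : e * E <= 2 * (kappa e ^+ 2 / sd * e ^+ 2 * o).
    apply: le_trans (ler_wpM2l (ltW e0) EL) _.
    have -> : e * (2 * L * (k ^+ 2 * o)) = 2 * e * o * (L * k ^+ 2) by ring.
    by rewrite LkE le_eqVlt; apply/orP; left; apply/eqP; ring.
  have h2 : kappa e ^+ 2 / sd * o * 64 <= eta ^+ 2.
    apply: (@le_trans _ _ (o * (64 * B ^+ 2) / sd)); last by rewrite ler_pdivrMr.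
    have -> : kappa e ^+ 2 / sd * o * 64 = o * (64 * kappa e ^+ 2) / sd by ring.
    by rewrite ler_pM2r ?invr_gt0// ler_pM2l// ler_pM2l.
  have := ler_wpM2r (sqr_ge0 e) h2; rewrite exprMn; clear -h1; lra.
- by rewrite kp.
- by rewrite -[L]invrK lef_pV2 ?posrE ?invr_gt0.
Unshelve. all: by end_near. Qed.

Lemma flux_lip {R : realType} (eps delta kappa s m : R)
    (v dv phi dphi V F Phi P : R -> R) :
  0 < delta / eps ^+ 2 -> reduced eps delta kappa v dv phi dphi V F Phi P ->
  s <= 8^-1 -> (forall x, 0 <= x <= 1 -> `|1 - V x| <= s) ->
  (forall x, 0 <= x <= 1 -> `|sin (Phi x)| <= m) ->
  forall x y, 0 <= x -> x <= y -> y <= 1 ->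
    `|P y - P x| <= delta / eps ^+ 2 * (2 * m) * (y - x).
Proof.
move=> d0 hred s8 Vs sm x y x0 xy y1.
have dP := red_derP _ _ _ _ _ _ _ _ _ _ _ hred.
have in01 z : x <= z <= y -> 0 <= z <= 1.
  by move=> /andP[xz zy]; rewrite (le_trans x0)//= (le_trans zy).
have [c cxy ->] := mvt _ _ _ _ xy (fun z zxy => dP z (in01 z zxy)).
rewrite normrM (ger0_norm (_ : 0 <= y - x)) ?subr_ge0// ler_wpM2r ?subr_ge0//.
rewrite normrM (ger0_norm (ltW d0)) ler_wpM2l ?(ltW d0)//.
have [_ _ V4 _ _] := near1_bounds _ _ s8 (Vs c (in01 c cxy)).
rewrite normrM ger0_norm ?exprn_even_ge0//; apply: ler_pM => //.
  by rewrite exprn_even_ge0.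
rewrite normrM; apply: le_trans (sm c (in01 c cxy)).
by rewrite ler_piMr ?cos_max.
Qed.

Lemma sincos_lip {R : realType} (a b : R) :
  `|sin a * cos a - sin b * cos b| <= `|a - b|.
Proof.
have d (x : R) : is_derive x 1 (fun y => sin y * cos y) (cos x ^+ 2 - sin x ^+ 2).
  by derive_eq; ring.
have := lip_of_der _ _ 1 d; rewrite -[X in _ -> _ <= X]mul1r; apply => x.
have := cos2Dsin2 x; have := sqr_ge0 (cos x); have := sqr_ge0 (sin x).
by move=> *; rewrite ler_norml; apply/andP; split; lra.
Qed.

Lemma sincos_quad {R : realType} (x : R) : `|sin x * cos x - x| <= 2 * x ^+ 2.
Proof.
wlog x0 : x / 0 <= x => [H|].
  have [/H//|/ltW x0] := leP 0 x.
  have := H (- x); rewrite oppr_ge0 sinN cosN sqrrN mulNr -opprD normrN.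
  by apply.
have d (y : R) : is_derive y 1 (fun z => sin z * cos z - z) (- 2 * sin y ^+ 2).
  derive_eq; transitivity (cos y ^+ 2 - sin y ^+ 2 - 1); first by ring.
  by rewrite cos2sin2; ring.
have [c /andP[c0 cx]] := mvt _ _ _ _ x0 (fun y _ => d y).
rewrite sin0 mul0r subr0 subr0 subr0 => ->.
have sc : `|sin c| <= x.
  have := sin_lip c 0; rewrite sin0 !subr0 (ger0_norm c0) => h.
  exact: le_trans cx.
have -> : `|-2 * sin c ^+ 2 * x| = 2 * (`|sin c| * `|sin c| * x).
  rewrite [LHS]normrM (ger0_norm x0) [X in X * _]normrM normrN normrX expr2.
  by rewrite (ger0_norm (_ : 0 <= (2 : R)))// mulrA.
rewrite ler_pM2l// [leRHS]expr2 ler_wpM2r//; apply: le_trans sc.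
by rewrite ler_piMl ?sin_max.
Qed.

Lemma case_a (R : realType) :
  exists C : R, 0 < C /\
   forall (delta : R) (kappa : R -> R) (v dv phi dphi : R -> R -> R),
     0 < delta ->
     (exists B : R, \forall e \near 0^'+, kappa e <= B) ->
     (\forall e \near 0^'+, 0 < kappa e /\
        minimizer e delta (kappa e) (v e) (dv e) (phi e) (dphi e) /\
        (forall x, 0 <= x <= 1 -> 0 <= v e x)) ->
     [/\ sup_littleo (fun e x => v e x - 1) (fun e => e),
         asym_equiv (fun e => phi e 1)
                    (fun e => 2 * kappa e * (e / Num.sqrt delta)),
         (\forall e \near 0^'+, forall x, 0 < x < 1 ->
             `|phi e x| <= C * kappa e * (e / Num.sqrt delta)),
         asym_equiv (fun e => Gfun e delta (kappa e) (v e) (dv e) (phi e) (dphi e))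
                    (fun e => - (kappa e ^+ 2 * e / (2 * Num.sqrt delta)))
       & C1loc_conv
           (fun e x => Num.sqrt delta / (2 * kappa e * e) *
                       phi e (1 - e * x / Num.sqrt delta))
           (fun x => expR (- x))].
Proof.
(* The constant of the sup bound in [weak_twist_stability]. *)
exists 9; split => // delta kappa v dv phi dphi d0 [B0 hB0] hmin0.
pose B := Num.max B0 1; have Bp : 0 < B by rewrite lt_max ltr01 orbT.
have hB : \forall e \near 0^'+, kappa e <= B.
  by apply: filterS hB0 => e h; rewrite le_max h.
have hmin : min_family (fun=> delta) kappa v dv phi dphi.
  by apply: filterS hmin0 => e h; split.
set sd := Num.sqrt delta; have sd0 : 0 < sd by rewrite sqrtr_gt0.
have near_core (eta : R) : 0 < eta <= 1 ->
    \forall e \near 0^'+, weak_profile delta eta kappa v dv phi dphi e :=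
  fun he => weak_twist_near delta B eta kappa v dv phi dphi d0 Bp he hB hmin.
have kE (e : R) : 0 < e -> kappa e / (sd / e) = kappa e * (e / sd).
  by move=> e0; rewrite invf_div.
have LkE (e : R) : 0 < e -> sd / e * (kappa e / (sd / e)) ^+ 2 / 2 = kappa e ^+ 2 * e / (2 * sd).
  by move=> e0; field; rewrite !gt_eqF.
have kp (e : R) : 0 < e -> 0 < kappa e -> 0 < kappa e * (e / sd).
  by move=> *; rewrite !mulr_gt0// invr_gt0.
have hk : \forall e \near 0^'+, 0 < kappa e by apply: filterS hmin0 => e [].
have min1 (eta : R) : 0 < eta -> 0 < Num.min eta 1 <= 1.
  by move=> h; rewrite lt_min h ltr01 ge_min lexx orbT.
have i11 : 0 <= (1 : R) <= 1 by rewrite ler01 lexx.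
split.
- move=> eta eta0; near=> e => x /andP[x0 x1].
  have e0 : 0 < e by near: e; exact: nbhs_right_gt.
  have : weak_profile delta (Num.min eta 1) kappa v dv phi dphi e by near: e; apply: near_core; exact: min1.
  rewrite /weak_profile -/sd => -[V [F [Phi [P [[hred _ _ _ _] [Vs _ _]]]]]].
  have x01 : 0 <= x <= 1 by rewrite !ltW.
  rewrite (red_vE _ _ _ _ _ _ _ _ _ _ _ hred _ x01) distrC (gtr0_norm e0).
  by apply: le_trans (Vs x x01) _; rewrite ler_pM2r// ge_min lexx.
- apply: asym_equivP.
    near=> e; have e0 : 0 < e by near: e; exact: nbhs_right_gt.
    have k0 : 0 < kappa e by near: e.
    by rewrite -mulrA mulf_neq0// gt_eqF// kp.
  move=> eta eta0; near=> e.
  have e0 : 0 < e by near: e; exact: nbhs_right_gt.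
  have k0 : 0 < kappa e by near: e.
  have : weak_profile delta (Num.min eta 1) kappa v dv phi dphi e by near: e; apply: near_core; exact: min1.
  rewrite /weak_profile -/sd => -[V [F [Phi [P [[hred _ h _ _] _]]]]].
  rewrite (red_phiE _ _ _ _ _ _ _ _ _ _ _ hred _ i11) -mulrA -kE//.
  apply: le_trans h _; rewrite kE//.
  have kp2 : 0 <= 2 * (kappa e * (e / sd)) by rewrite (mulr_ge0 _ (ltW (kp _ e0 k0))).
  rewrite (ger0_norm kp2).
  have := ler_wpM2r (ltW (kp _ e0 k0)) (_ : Num.min eta 1 <= eta).
  rewrite ge_min lexx => /(_ isT) h; apply: le_trans h _.
  by have := mulr_ge0 (ltW eta0) (ltW (kp _ e0 k0)); lra.
- near=> e => x /andP[x0 x1].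
  have e0 : 0 < e by near: e; exact: nbhs_right_gt.
  have : weak_profile delta (Num.min 1 1) kappa v dv phi dphi e by near: e; apply: near_core; exact: min1.
  rewrite /weak_profile -/sd => -[V [F [Phi [P [[hred _ _ h _] _]]]]].
  have x01 : 0 <= x <= 1 by rewrite !ltW.
  rewrite (red_phiE _ _ _ _ _ _ _ _ _ _ _ hred _ x01) -mulrA -kE//; exact: h.
- apply: asym_equivP.
    near=> e; have e0 : 0 < e by near: e; exact: nbhs_right_gt.
    have k0 : 0 < kappa e by near: e.
    by rewrite oppr_eq0 gt_eqF// divr_gt0 ?mulr_gt0// exprn_gt0.
  move=> eta eta0; have eta20 : 0 < eta / 2 by rewrite divr_gt0.
  near=> e.
  have e0 : 0 < e by near: e; exact: nbhs_right_gt.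
  have k0 : 0 < kappa e by near: e.
  have : weak_profile delta (Num.min (eta / 2) 1) kappa v dv phi dphi e by near: e; apply: near_core; exact: min1.
  rewrite /weak_profile -/sd => -[V [F [Phi [P [[hred _ _ _ h] _]]]]].
  rewrite opprK -LkE// normrN; apply: le_trans h _.
  set X := _ * _ ^+ 2; have X0 : 0 <= X by exact: (mulr_ge0 (ltW (divr_gt0 sd0 e0)) (sqr_ge0 _)).
  rewrite (ger0_norm (_ : 0 <= X / 2)) ?divr_ge0//.
  have := ler_wpM2r X0 (_ : Num.min (eta / 2) 1 <= eta / 2).
  by rewrite ge_min lexx => /(_ isT) h; apply: le_trans h _; lra.
- move=> M eta M0 eta0.
  pose K := 2 * expR (2 * M) + 1; have K0 : 0 < K by rewrite addr_gt0 ?mulr_gt0 ?expR_gt0.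
  pose eta' := eta / K; have eta'0 : 0 < eta' by rewrite divr_gt0.
  have KE : 2 * eta' * expR (2 * M) + eta' = eta.
    by rewrite /eta' /K; field; rewrite gt_eqF.
  (* The flux error in [hP] requires [36 M]; in [hE], [5 * 9] from [V^4] and [2 * 81] from
     linearizing [sin * cos] make 207, at most [2 * 104]. The last bound ensures [M < L]. *)
  pose eta2 := Num.min 8^-1 (Num.min (eta' / (36 * M + 104)) (M + 1)^-1).
  have M104 : 0 < 36 * M + 104 by lra.
  have M10 : 0 < M + 1 by lra.
  have h0 : 0 < eta2 by rewrite !lt_min invr_gt0 ltr0n divr_gt0// invr_gt0.
  have h1 : eta2 <= 8^-1 by rewrite ge_min lexx.
  have h2 : eta2 * (36 * M + 104) <= eta'.
    by rewrite -ler_pdivlMr// !ge_min lexx orbT.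
  have h3 : eta2 <= (M + 1)^-1 by rewrite !ge_min lexx !orbT.
  have h01 : 0 < eta2 <= 1 by rewrite h0 (le_trans h1)// invf_le1// ler1n.
  near=> e.
  have e0 : 0 < e by near: e; exact: nbhs_right_gt.
  have k0 : 0 < kappa e by near: e.
  have : weak_profile delta eta2 kappa v dv phi dphi e by near: e; exact: near_core h01.
  rewrite /weak_profile -/sd => -[V [F [Phi [P [[hred Vs Phi1 Phis _] [_ /andP[kk0 kk] etaL]]]]]].
  set L := sd / e in Phi1 Phis kk0 kk etaL *; set k := kappa e / L in Phi1 Phis kk0 kk *.
  have L0 : 0 < L by rewrite divr_gt0.
  have ML : M < L.
    apply: lt_le_trans etaL; apply: (@lt_le_trans _ _ (M + 1)); first by rewrite ltrDl.
    by rewrite -[M + 1]invrK lef_pV2 ?posrE ?invr_gt0.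
  have dE : delta / e ^+ 2 = L ^+ 2 by rewrite /L expr_div_n sqr_sqrtr// ltW.
  have kapE : kappa e = k * L by rewrite /k divfK// gt_eqF.
  have Lpos : 0 < delta / e ^+ 2 by rewrite dE exprn_gt0.
  have sP x : 0 <= x <= 1 -> `|sin (Phi x)| <= 9 * k.
    move=> x01; apply: le_trans (Phis x x01).
    by have := sin_lip (Phi x) 0; rewrite sin0 !subr0.
  have fl := flux_lip _ _ _ _ _ _ _ _ _ _ _ _ _ Lpos hred h1 Vs sP.
  have P1 := red_P1 _ _ _ _ _ _ _ _ _ _ _ hred.
  have k20 : 0 < 2 * k by rewrite mulr_gt0.
  have d1 (t : R) : is_derive t 1 (fun x => expR (- x)) (- expR (- t)) by derive_eq; ring.
  have d2 (t : R) : is_derive t 1 (fun x => - expR (- x)) (expR (- t)) by derive_eq; ring.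
  have hP t : 0 <= t <= M -> `|P (1 + -1 * (t / L))| * (4 * eta2) <= eta' * (L * (2 * k)).
    move=> /andP[t0 tM]; have tL : 0 <= t / L by rewrite divr_ge0// ltW.
    have tL1 : t / L <= 1 by rewrite ler_pdivrMr// mul1r (le_trans tM)// ltW.
    have := fl (1 + -1 * (t / L)) 1 _ _ _; rewrite P1 sub0r normrN.
    have u0 : 0 <= 1 + -1 * (t / L) by clear -tL1; lra.
    have u1 : 1 + -1 * (t / L) <= 1 by clear -tL; lra.
    move=> /(_ u0 u1 (lexx _)).
    have -> : delta / e ^+ 2 * (2 * (9 * k)) * (1 - (1 + -1 * (t / L))) = 18 * (k * L * t).
      by rewrite dE; field; rewrite gt_eqF.
    move=> h; apply: le_trans (ler_wpM2r _ h) _; first by rewrite mulr_ge0// ltW.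
    have kL : 0 <= k * L by rewrite mulr_ge0 ?ltW.
    have q1 : k * L * t <= k * L * M by rewrite ler_wpM2l.
    have q2 := ler_wpM2r (ltW h0) q1.
    have q3 := ler_wpM2l kL h2.
    have q4 : 0 <= k * L * eta2 by rewrite mulr_ge0// ltW.
    by clear -q2 q3 q4; lra.
  have hE x : 0 <= x <= 1 ->
      `|V x ^+ 4 * (sin (Phi x) * cos (Phi x)) / (2 * k) - Phi x / (2 * k)| <= eta'.
    move=> x01; have [_ V4 _ _ _] := near1_bounds _ _ h1 (Vs x x01).
    rewrite -mulrBl normrM normfV (ger0_norm (ltW k20)) ler_pdivrMr//.
    set sc := sin _ * cos _.
    have -> : V x ^+ 4 * sc - Phi x = (V x ^+ 4 - 1) * sc + (sc - Phi x) by ring.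
    apply: le_trans (ler_normD _ _) _.
    have sc9 : `|sc| <= 9 * k.
      by rewrite normrM; apply: le_trans (sP x x01); rewrite ler_piMr ?cos_max.
    have := ler_pM (normr_ge0 _) (normr_ge0 _) V4 sc9; rewrite -normrM => q1.
    have q2 := sincos_quad (Phi x).
    have q3 : Phi x ^+ 2 <= 81 * (k * eta2).
      have : `|Phi x| ^+ 2 <= (9 * k) ^+ 2.
        by rewrite lerXn2r ?Phis// nnegrE// mulr_ge0// ltW.
      rewrite real_normK ?num_real// => h; apply: le_trans h _.
      by have := ler_wpM2l (ltW kk0) kk; rewrite exprMn; clear; lra.
    have q4 := ler_wpM2l (ltW kk0) h2.
    have q5 : 0 <= k * (eta2 * (36 * M)) by rewrite (mulr_ge0 (ltW kk0))// (mulr_ge0 (ltW h0))// mulr_ge0// ltW.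
    have q6 : 0 <= k * eta2 by rewrite mulr_ge0// ltW.
    by move: q1 q2 q3 q4 q5 q6; rewrite -/sc; clear; lra.
  have i1 : `|Phi 1 / (2 * k) - expR (- 0)| <= eta'.
    rewrite oppr0 expR0.
    have -> : Phi 1 / (2 * k) - 1 = (Phi 1 - 2 * k) / (2 * k) by field; rewrite gt_eqF.
    rewrite normrM normfV (ger0_norm (ltW k20)) ler_pdivrMr//.
    apply: le_trans Phi1 _; have q4 := ler_wpM2l (ltW kk0) h2.
    have q5 : 0 <= k * (eta2 * (36 * M)) by rewrite (mulr_ge0 (ltW kk0))// (mulr_ge0 (ltW h0))// mulr_ge0// ltW.
    have q6 : 0 <= k * eta2 by rewrite mulr_ge0// ltW.
    by clear -q4 q5 q6; lra.
  have i2 : `|-1 * (2 * kappa e + P 1) / (L * (2 * k)) - - expR (- 0)| <= eta'.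
    rewrite oppr0 expR0 P1 kapE.
    have -> : -1 * (2 * (k * L) + 0) / (L * (2 * k)) - -1 = 0 by field; rewrite !gt_eqF.
    by rewrite normr0 ltW.
  have [r1 r2] := layer e delta (kappa e) eta2 (2 * k) (-1) 1 M eta' _ _ _ _ V F Phi P
    (fun x => x) (fun x => expR (- x)) (fun x => - expR (- x)) e0 d0 hred h1 Vs k20
    (ltW eta'0) M0 ML (or_intror (conj erefl erefl)) (fun a b => lexx _)
    (fun t _ => der_cont _ _ _ (d1 t)) (fun t _ => der_cont _ _ _ (d2 t))
    (fun t _ => d1 t) (fun t _ => d2 t) hP hE i1 i2.
  rewrite KE in r1 r2.
  have FE : (fun t => (2 * k)^-1 * phi e (1 + -1 * (e * t / Num.sqrt delta))) =
     (fun x => sd / (2 * kappa e * e) * phi e (1 - e * x / sd)).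
    apply/funext => x; rewrite mulN1r; congr (_ * _).
    by rewrite /k /L; field; rewrite !gt_eqF.
  rewrite FE in r2; split => x xM.
    by have /= <- := congr1 (fun g => g x) FE; exact: r1.
  have [q1 q2] := r2 x xM; split => //.
  by have [_ ->] := derE (d1 x).
Unshelve. all: by end_near. Qed.

(** * Subcritical twist *)

Lemma sin_2atan {R : realType} (u : R) : sin (2 * atan u) = 2 * u / (1 + u ^+ 2).
Proof.
have [_ tu] := atan_def u.
have cn : cos (atan u) != 0.
  by rewrite gt_eqF// cos_gt0_pihalf// atan_gtNpi2 atan_ltpi2.
have E := cos2_tan2 cn; rewrite tu in E.
have sE : sin (atan u) = u * cos (atan u) by rewrite -{2}tu /tan divfK.
rewrite -E mulr_natl sin_mulr2n sE -mulr_natl; field; exact: cn.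
Qed.

(** The solution of [y' = - sin y] which, for [0 < p < pi/2], starts from [p]; it is the limit
    profile of (b) when [p = arcsin (2 k)]. *)
Definition kink {R : realType} (p x : R) : R := 2 * atan (tan (p / 2) * expR (- x)).

Lemma der_kink {R : realType} (p x : R) : is_derive x 1 (kink p) (- sin (kink p x)).
Proof.
rewrite /kink sin_2atan; set T := tan _.
have d1 : is_derive x 1 (fun y => T * expR (- y)) (- (T * expR (- x))).
  by derive_eq; ring.
have d2 := derO atan (fun y => T * expR (- y)) x _ _ (is_derive1_atan _) d1.
by derive_eq; field; rewrite gt_eqF// ltr_pwDl// sqr_ge0.
Qed.

Lemma kink0 {R : realType} (p : R) : 0 < p < pi / 2 -> kink p 0 = p.
Proof.
move=> /andP[p0 p2]; have := pi_gt0 R => pi0.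
rewrite /kink oppr0 expR0 mulr1 tanK; first by field.
by rewrite in_itv /=; apply/andP; split; lra.
Qed.

Lemma kink_bounds {R : realType} (p x : R) : 0 < p < pi / 2 -> 0 <= x ->
  0 <= kink p x <= p /\ kink p x <= 2 * tan (p / 2) * expR (- x).
Proof.
move=> p02 x0; have /andP[p0 p2] := p02; have := pi_gt0 R => pi0.
have T0 : 0 <= tan (p / 2).
  rewrite /tan divr_ge0//; first by apply: sin_ge0_pi; apply/andP; split; lra.
  by apply: cos_ge0_pihalf; apply/andP; split; lra.
have Te : 0 <= tan (p / 2) * expR (- x) by rewrite mulr_ge0 ?expR_ge0.
split.
  apply/andP; split; first by rewrite mulr_ge0// -(@atan0 R) le_atan.
  rewrite -[leRHS](kink0 p p02) /kink ler_wpM2l// le_atan// oppr0 expR0 mulr1.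
  by rewrite ler_piMr// expR_le1 oppr_le0.
rewrite /kink -mulrA ler_wpM2l//; set u := _ * _ in Te *.
have d (y : R) : is_derive y 1 (fun y => y - atan y) (1 - (1 + y ^+ 2)^-1).
  by have := is_derive1_atan y => h; derive_eq; ring.
have := le_of_der _ _ _ _ Te (fun y _ => d y); rewrite atan0 subr0 subr_ge0.
apply=> y _; rewrite subr_ge0 invf_le1 ?lerDl ?sqr_ge0//.
by rewrite ltr_pwDl// sqr_ge0.
Qed.

(** The competitor is the kink read backwards from 1, shifted to vanish at 0. Along the kink,
    kinetic and potential terms are equal and integrate exactly. The shift costs [k L (q 0) / 2],
    exponentially small relative to [L]. *)
Lemma upper_kink {R : realType} (eps delta kappa L k p : R) (C : R -> R)
    (v dv phi dphi : R -> R) : abs_sin_prim C ->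
  0 < eps -> 0 < L -> 0 < k -> 0 < p < pi / 2 ->
  delta / eps ^+ 2 = L ^+ 2 -> kappa = k * L -> minimizer eps delta kappa v dv phi dphi ->
  Gfun eps delta kappa v dv phi dphi <=
    L * (C p / 4 - k / 2 * p + k * tan (p / 2) * expR (- L)).
Proof.
move=> hC e0 L0 k0 p02 dE kE hm; have /andP[p0 p2] := p02.
have pi0 := pi_gt0 R.
pose q x := kink p (L * (1 - x)).
have dq (x : R) : is_derive x 1 q (L * sin (q x)).
  have dL : is_derive x 1 (fun x => L * (1 - x)) (- L) by derive_eq; ring.
  have d := derO (kink p) (fun x => L * (1 - x)) x _ _ (der_kink p _) dL.
  by apply: der_eq d _; rewrite /q; ring.
pose psi x := q x - q 0.
have dP (x : R) : is_derive x 1 psi (L * sin (q x)).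
  by have h := dq x; rewrite /psi; derive_eq; ring.
have cq := der_continuous _ _ dq.
have cpsi := der_continuous _ _ dP.
have P0 : psi 0 = 0 by rewrite /psi subrr.
have cd : continuous (fun x => L * sin (q x)) by cont.
apply: le_trans (competitor _ _ _ _ _ _ _ _ _ hm dP cd P0) _.
have -> : delta / (8 * eps ^+ 2) = L ^+ 2 / 8 by rewrite -dE; field; rewrite gt_eqF.
have q1 : q 1 = p by rewrite /q subrr mulr0 kink0.
have qin x : 0 <= x <= 1 -> 0 <= q x <= p.
  move=> /andP[x0 x1]; have [] // := kink_bounds p (L * (1 - x)) p02 _.
  by rewrite mulr_ge0 ?subr_ge0// ltW.
have q00 : 0 <= q 0 by have /andP[] := qin 0 (ltac:(by rewrite lexx ler01)).
have qmono x : 0 <= x <= 1 -> q 0 <= q x.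
  move=> /andP[x0 x1]; apply: (le_of_der _ _ _ _ x0 (fun y _ => dq y)) => y /andP[y0 yx].
  rewrite mulr_ge0 ?(ltW L0)//; apply: sin_ge0_pi.
  have /andP[h1 h2] : 0 <= q y <= p by apply: qin; rewrite y0 (le_trans yx).
  by rewrite h1; lra.
pose J := Iint 0 1 (fun x => sin (q x) ^+ 2).
have dcos (x : R) : is_derive x 1 (fun y => - cos (q y)) (L * sin (q x) ^+ 2).
  by have h := dq x; derive_eq; ring.
have JE : L * J = cos (q 0) - cos p.
  rewrite /J -IintZ; last by apply: itg_cont; cont.
  by rewrite (Iint_FTC _ _ _ _ ler01 dcos) ?q1; [ring|cont].
have I1 : Iint 0 1 (fun x => (L * sin (q x)) ^+ 2) = L ^+ 2 * J.
  rewrite /J -IintZ; last by apply: itg_cont; cont.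
  by apply: IintE => x _; ring.
(* The shift can only lower the potential, since [0 <= psi <= q <= p < pi/2] and the sine increases
   there. *)
have I2 : Iint 0 1 (fun x => sin (psi x) ^+ 2) <= J.
  apply: Iint_le; [by apply: itg_cont; cont..|move=> x x01].
  have /andP[h1 h2] := qin x x01; have h3 := qmono x x01.
  have h4 : 0 <= psi x by rewrite subr_ge0.
  have h5 : psi x <= q x by rewrite gerBl.
  rewrite lerXn2r// ?nnegrE.
  - by apply: sin_ge0_pi; rewrite h4; lra.
  - by apply: sin_ge0_pi; rewrite h1; lra.
  - by apply: sin_le_halfpi; lra.
have {}I2 : L ^+ 2 * Iint 0 1 (fun x => sin (psi x) ^+ 2) <= L ^+ 2 * J.
  by rewrite ler_wpM2l ?sqr_ge0.
have LJ : L ^+ 2 * J <= L * (1 - cos p).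
  by rewrite expr2 -mulrA ler_pM2l// JE lerD2r cos_le1.
have Cp : C p = 1 - cos p by apply: asp_cos => //; rewrite (ltW p0); lra.
have ps1 : psi 1 = p - q 0 by rewrite /psi q1.
have q0b : L * k * q 0 <= L * k * (2 * tan (p / 2) * expR (- L)).
  rewrite ler_wpM2l ?mulr_ge0 ?(ltW L0) ?(ltW k0)// /q subr0 mulr1.
  by have [] := kink_bounds p L p02 (ltW L0).
rewrite I1 Cp kE ps1; move: I2 LJ q0b; set I := Iint _ _ _; clear; lra.
Qed.

Definition kink_profile {R : realType} (k p eta : R) (C : R -> R) (delta kappa : R -> R)
    (v dv phi dphi : R -> R -> R) (e : R) : Prop :=
  let L := Num.sqrt (delta e) / e in
  exists V F Phi P,
  [/\ reduced e (delta e) (kappa e) (v e) (dv e) (phi e) (dphi e) V F Phi P,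
      (forall x, 0 <= x <= 1 -> `|1 - V x| <= eta),
      `|Phi 1 - p| <= eta,
      (forall x, 0 <= x <= 1 -> `|Phi x| <= p + eta) &
      `|Gfun e (delta e) (kappa e) (v e) (dv e) (phi e) (dphi e)
         - L * (C p / 4 - k / 2 * p)| <= eta * L] /\
  [/\ (forall x, 0 <= x <= 1 -> (1 - V x) ^+ 2 <= eta * Num.sqrt (delta e)),
      kappa e = k * L, 0 < delta e, 0 < kappa e & eta^-1 <= L].

(** The relation [delta = o(eps)] enters through [eps kappa^2 = k^2 delta / eps], and
    [eps^2 = o(delta)] through [1/L]. *)
Lemma kink_near {R : realType} (k eta : R) (C : R -> R) (delta kappa : R -> R)
    (v dv phi dphi : R -> R -> R) : abs_sin_prim C ->
  0 < k -> k < pi^-1 -> 0 < eta <= 1 ->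
  (\forall e \near 0^'+, kappa e = k * Num.sqrt (delta e) / e) ->
  small_o0 delta (fun e => e) -> small_o0 (fun e => e ^+ 2) delta ->
  min_family delta kappa v dv phi dphi ->
  \forall e \near 0^'+, kink_profile k (asin (2 * k)) eta C delta kappa v dv phi dphi e.
Proof.
move=> hC k0 kpi /andP[eta0 eta1] hk hde hed hmin.
have [p02 sp] := asin_in _ k0 kpi; set p := asin _ in p02 sp *.
have /andP[p0 p2] := p02.
(* 64 is the 32 of [sup_sqr_le] times the 2 in [Ev <= eta2 (2 L)]. *)
pose eta2 := eta / 64; have eta20 : 0 < eta2 by rewrite divr_gt0.
have [rho rho0 stab] := well_stability _ _ _ _ hC p02 sp k0 kpi eta20.
pose theta := Num.min rho 2^-1.
have t0 : 0 < theta by rewrite lt_min rho0 invr_gt0 ltr0n.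
have t1 : theta <= rho by rewrite ge_min lexx.
have t2 : theta <= 2^-1 by rewrite ge_min lexx orbT.
pose s := Num.min (theta / 4) eta.
have s0 : 0 < s by rewrite lt_min eta0 divr_gt0.
have s1 : 4 * s <= theta by rewrite mulrC -ler_pdivlMr// ge_min lexx.
have s2 : s <= eta by rewrite ge_min lexx orbT.
pose T := k * tan (p / 2).
have T1 : 0 < `|T| + 1 by rewrite ltr_wpDl.
pose l := Num.min eta (Num.min rho eta / (`|T| + 1)).
have re0 : 0 < Num.min rho eta by rewrite lt_min rho0.
have l0 : 0 < l by rewrite lt_min eta0 divr_gt0.
have k20 : 0 < 16 * k ^+ 2 by rewrite mulr_gt0// exprn_gt0.
pose d1 := Num.min (s ^+ 2 / (16 * k ^+ 2)) (theta / (16 * k ^+ 2)).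
have d10 : 0 < d1 by rewrite lt_min !divr_gt0// exprn_gt0.
have l20 : 0 < l ^+ 2 by rewrite exprn_gt0.
near=> e; rewrite /kink_profile.
have e0 : 0 < e by near: e; exact: nbhs_right_gt.
have e1 : e <= 1 by near: e; apply: nbhs_right_le.
have e01 : 0 < e <= 1 by rewrite e0.
have [de0 [ke0 [hm vp]]] : 0 < delta e /\ 0 < kappa e /\
   minimizer e (delta e) (kappa e) (v e) (dv e) (phi e) (dphi e) /\
    (forall x, 0 <= x <= 1 -> 0 <= v e x) by near: e.
have kapE' : kappa e = k * Num.sqrt (delta e) / e by near: e.
have c1 : `|delta e| <= d1 * `|e| by near: e; exact: hde.
have c2 : `|e ^+ 2| <= l ^+ 2 * `|delta e| by near: e; exact: hed.
rewrite !gtr0_norm// ?exprn_gt0// in c1 c2.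
set sd := Num.sqrt (delta e) in kapE' *.
have sd0 : 0 < sd by rewrite sqrtr_gt0.
have sd2 : sd ^+ 2 = delta e by rewrite sqr_sqrtr// ltW.
set L := sd / e; have L0 : 0 < L by rewrite divr_gt0.
have kapE : kappa e = k * L by rewrite kapE' mulrA.
have dE : delta e / e ^+ 2 = L ^+ 2 by rewrite /L expr_div_n sd2.
have Ll : L^-1 <= l.
  rewrite /L invf_div ler_pdivrMr// -(@ler_pXn2r _ 2)// ?nnegrE ?(ltW e0)//.
    by rewrite exprMn sd2.
  by rewrite mulr_ge0// ltW.
have L1 : L^-1 <= eta by apply: le_trans Ll _; rewrite ge_min lexx.
have L2 : L^-1 * (`|T| + 1) <= Num.min rho eta.
  by rewrite -ler_pdivlMr//; apply: le_trans Ll _; rewrite ge_min lexx orbT.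
have kap2 : e ^+ 2 * kappa e ^+ 2 = k ^+ 2 * delta e.
  by rewrite kapE' -sd2; field; rewrite gt_eqF.
have d1s : d1 * (16 * k ^+ 2) <= s ^+ 2 by rewrite -ler_pdivlMr// ge_min lexx.
have d1t : d1 * (16 * k ^+ 2) <= theta by rewrite -ler_pdivlMr// ge_min lexx orbT.
have c3 := ler_wpM2r (ltW k20) c1.
have es : 16 * (e * kappa e ^+ 2) <= s ^+ 2.
  rewrite -(ler_pM2l e0).
  have -> : e * (16 * (e * kappa e ^+ 2)) = 16 * (e ^+ 2 * kappa e ^+ 2) by ring.
  rewrite kap2; have := ler_wpM2l (ltW e0) d1s; clear -c3; lra.
have shalf : 0 <= s <= 2^-1 by rewrite ltW//=; clear -s1 t2; lra.
have [V [F [Phi [P [hred Vs Vsq _]]]]] :=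
  small_eps_reduced _ _ _ _ _ _ _ _ e01 de0 shalf hm vp es.
have ke : 8 * (kappa e ^+ 2 * e ^+ 2) <= theta.
  rewrite [_ ^+ 2 * e ^+ 2]mulrC kap2.
  have h : e * (d1 * (16 * k ^+ 2)) <= d1 * (16 * k ^+ 2).
    by rewrite ler_piMl// mulr_ge0// ltW.
  have : 0 <= k ^+ 2 * delta e by rewrite mulr_ge0 ?sqr_ge0// ltW.
  by clear -c3 h d1t; lra.
have t01 : 0 < theta <= 1 by rewrite t0; clear -t2; lra.
have low := coupling _ _ _ _ _ _ _ _ _ _ _ _ _ e0 de0 hred t01 (ltW s0) s1 Vs ke.
have up := upper_kink _ _ _ _ _ _ _ _ _ _ _ hC e0 L0 k0 p02 dE kapE hm.
have [_ _ _ cF dPhi Phi0 _ _ _ _ _ _] := hred.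
have [dC C0] := hC.
have cS : continuous (fun x : R => `|sin x|) by cont.
have split x : 0 <= x <= 1 ->
    2 * L * (`|C (Phi x)| + `|C (Phi 1) - C (Phi x)|) <=
    Iint 0 1 (fun x => F x ^+ 2 + delta e / e ^+ 2 * sin (Phi x) ^+ 2).
  move=> x01; apply: le_trans (calibration_split _ _ _ _ _ _ x01 (ltW L0) cF cS dPhi dC Phi0 C0) _.
  by rewrite le_eqVlt dE; apply/orP; left; apply/eqP; apply: IintE => y _; rewrite real_normK ?num_real.
set G := Gfun _ _ _ _ _ _ _ in low up *.
set E := Ev e V (dv e) in low Vsq.
have E0 : 0 <= E := Ev_ge0 _ _ _.
set I := Iint 0 1 _ in low split.
pose r := T * expR (- L).
have rL' : r <= Num.min rho eta.
  have h := expRN_le_inv L L0; apply: le_trans L2.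
  apply: (@le_trans _ _ ((`|T| + 1) * expR (- L))).
    by rewrite ler_wpM2r ?expR_ge0// ler_wpDr// ler_norm.
  by rewrite mulrC ler_wpM2r// ltW.
have rL : r <= rho by apply: le_trans rL' _; rewrite ge_min lexx.
have rr : r <= eta by apply: le_trans rL' _; rewrite ge_min lexx orbT.
have key x : 0 <= x <= 1 ->
  E / (2 * L) + (1 - theta) / 4 * (`|C (Phi x)| + `|C (Phi 1) - C (Phi x)|) - k / 2 * Phi 1
    <= G / L.
  move=> x01; rewrite ler_pdivlMr//; apply: le_trans low.
  have := ler_wpM2l (_ : 0 <= (1 - theta) / 8) (split x x01).
  rewrite divr_ge0// ?subr_ge0; last by clear -t2; lra.
  move=> /(_ isT) h; rewrite kapE.
  have -> : forall X Y : R, (E / (2 * L) + (1 - theta) / 4 * X - k / 2 * Y) * L =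
     E / 2 + (1 - theta) / 8 * (2 * L * X) - k * L / 2 * Y.
    by move=> X Y; field; rewrite gt_eqF.
  by clear -h; lra.
have up' : G / L <= C p / 4 - k / 2 * p + r by rewrite ler_pdivrMr// mulrC.
have L20 : 0 < 2 * L by rewrite mulr_gt0.
have E20 : 0 <= E / (2 * L) by rewrite divr_ge0// ltW.
have t01' : 0 <= theta <= rho by rewrite ltW.
have st x x01 := stab theta r (E / (2 * L)) (Phi 1) (Phi x) t01' rL E20
  (le_trans (key x x01) up').
have i11 : 0 <= (1 : R) <= 1 by rewrite ler01 lexx.
have [st1 _ st3 st4] := st 1 i11.
have e2e : eta2 <= eta by rewrite /eta2; clear -eta0; lra.
exists V, F, Phi, P; split; split => //.
- by move=> x x01; exact: le_trans (Vs x x01) s2.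
- exact: le_trans e2e.
- by move=> x x01; have [_ h _ _] := st x x01; apply: le_trans h _; rewrite lerD2l.
- have -> : G - L * (C p / 4 - k / 2 * p) = (G / L - (C p / 4 - k / 2 * p)) * L.
    by field; rewrite gt_eqF.
  rewrite normrM (gtr0_norm L0) ler_pM2r//.
  have k1' := key 1 i11.
  by rewrite ler_norml; apply/andP; split; clear -k1' E20 st4 up' e2e rr; lra.
- move=> x x01; apply: le_trans (Vsq x x01) _.
  have EL : E <= eta2 * (2 * L) by rewrite -ler_pdivrMr.
  have := ler_wpM2l (ltW e0) EL.
  have -> : e * (eta2 * (2 * L)) = 2 * eta2 * sd by rewrite /L; field; rewrite gt_eqF.
  by rewrite /eta2; clear; lra.
- by rewrite -[L]invrK lef_pV2 ?posrE ?invr_gt0.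
Unshelve. all: by end_near. Qed.

(** The threshold [s] depends only on [M], [eta] and the bound [c] on the rescaled flux at the
    chosen end: 0 at the right end for (b), of order 1 at the left end for (c). *)
Lemma pendulum_layer {R : realType} (M eta c : R) : 0 < M -> 0 < eta -> 0 <= c ->
  exists2 s, 0 < s <= 1 &
  forall (eps delta kappa sg x0 : R) (v dv phi dphi V F Phi P z1 z2 : R -> R),
  0 < eps -> 0 < delta -> reduced eps delta kappa v dv phi dphi V F Phi P ->
  let L := Num.sqrt delta / eps in
  s^-1 <= L -> (forall x, 0 <= x <= 1 -> `|1 - V x| <= s) ->
  (sg = 1 /\ x0 = 0) \/ (sg = -1 /\ x0 = 1) ->
  (forall t, 0 <= t <= M -> {for t, continuous z1}) ->
  (forall t, 0 <= t <= M -> {for t, continuous z2}) ->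
  (forall t : R, 0 < t <= M -> is_derive t 1 z1 (z2 t)) ->
  (forall t : R, 0 < t <= M -> is_derive t 1 z2 (sin (z1 t) * cos (z1 t))) ->
  `|P x0| <= L * c -> `|Phi x0 - z1 0| <= s ->
  `|sg * (2 * kappa + P x0) / L - z2 0| <= s ->
  let Psi := fun t => phi (x0 + sg * (eps * t / Num.sqrt delta)) in
  (forall t, 0 <= t <= M -> `|Psi t - z1 t| <= eta) /\
  (forall t, 0 < t <= M -> derivable Psi t 1 /\ `|derive1 Psi t - z2 t| <= eta).
Proof.
move=> M0 eta0 c0.
pose K := 2 * expR (2 * M) + 1; have K0 : 0 < K by rewrite addr_gt0 ?mulr_gt0 ?expR_gt0.
pose eta' := eta / K; have eta'0 : 0 < eta' by rewrite divr_gt0.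
have KE : 2 * eta' * expR (2 * M) + eta' = eta.
  by rewrite /eta' /K; field; rewrite gt_eqF.
(* [4 (c + 2 M)] pays for the flux multiplied by [1 - V^-2], and 5 for [V^4 - 1]. *)
pose N := 4 * (c + 2 * M) + 5.
have N5 : 5 <= N by rewrite /N; clear -c0 M0; lra.
have N0 : 0 < N by apply: lt_le_trans N5.
have M10 : 0 < M + 1 by rewrite addr_gt0.
pose s := Num.min 8^-1 (Num.min (eta' / N) (M + 1)^-1).
have h0 : 0 < s by rewrite !lt_min invr_gt0 ltr0n divr_gt0// invr_gt0.
have h1 : s <= 8^-1 by rewrite ge_min lexx.
have h2 : s * N <= eta' by rewrite -ler_pdivlMr// !ge_min lexx orbT.
have h3 : s <= (M + 1)^-1 by rewrite !ge_min lexx !orbT.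
exists s; first by rewrite h0 (le_trans h1)// invf_le1// ler1n.
move=> eps delta kappa sg x0 v dv phi dphi V F Phi P z1 z2 e0 d0 hred L sL Vs hsg cz1 cz2
  dz1 dz2 Px0 i1 i2 Psi.
have s5 : 5 * s <= eta' by have q5 := ler_wpM2l (ltW h0) N5; clear -h2 q5; lra.
have sd0 : 0 < Num.sqrt delta by rewrite sqrtr_gt0.
have L0 : 0 < L by rewrite divr_gt0.
have ML : M < L.
  apply: lt_le_trans sL; apply: (@lt_le_trans _ _ (M + 1)); first by rewrite ltrDl.
  by rewrite -[M + 1]invrK lef_pV2 ?posrE ?invr_gt0.
have dE : delta / eps ^+ 2 = L ^+ 2 by rewrite /L expr_div_n sqr_sqrtr// ltW.
have Lpos : 0 < delta / eps ^+ 2 by rewrite dE exprn_gt0.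
have sP x : 0 <= x <= 1 -> `|sin (Phi x)| <= 1 by move=> _; exact: sin_max.
have fl := flux_lip _ _ _ _ _ _ _ _ _ _ _ _ _ Lpos hred h1 Vs sP.
have hP t : 0 <= t <= M -> `|P (x0 + sg * (t / L))| * (4 * s) <= eta' * (L * 1).
  move=> /andP[t0 tM]; have tL : 0 <= t / L by rewrite divr_ge0// ltW.
  have tL1 : t / L <= 1 by rewrite ler_pdivrMr// mul1r (le_trans tM)// ltW.
  have h : `|P (x0 + sg * (t / L)) - P x0| <= 2 * (L * t).
    have -> : 2 * (L * t) = delta / eps ^+ 2 * (2 * 1) * (t / L).
      by rewrite dE; field; rewrite gt_eqF.
    case: hsg => -[-> ->].
      by rewrite mul1r add0r; have := fl _ _ (lexx 0) tL tL1; rewrite subr0.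
    have u0 : 0 <= 1 + -1 * (t / L) by clear -tL1; lra.
    have u1 : 1 + -1 * (t / L) <= 1 by clear -tL; lra.
    have := fl _ _ u0 u1 (lexx 1); rewrite distrC.
    by rewrite (_ : 1 - (1 + -1 * (t / L)) = t / L)//; ring.
  have q0 : `|P (x0 + sg * (t / L))| <= L * (c + 2 * M).
    have q1 : L * t <= L * M by rewrite ler_pM2l.
    have := ler_normD (P (x0 + sg * (t / L)) - P x0) (P x0); rewrite subrK.
    by move: Px0 h q1; clear; lra.
  apply: le_trans (ler_wpM2r _ q0) _; first by rewrite mulr_ge0// ltW.
  have q3 := ler_wpM2l (ltW L0) h2.
  have q4 : 0 <= L * s by rewrite mulr_ge0// ltW.
  by move: q3 q4; rewrite /N; clear; lra.
have hE x : 0 <= x <= 1 ->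
    `|V x ^+ 4 * (sin (Phi x) * cos (Phi x)) / 1
      - (fun y => sin y * cos y) (Phi x / 1)| <= eta'.
  move=> x01; have [_ V4 _ _ _] := near1_bounds _ _ h1 (Vs x x01).
  rewrite !divr1; set sc := sin _ * cos _.
  have -> : V x ^+ 4 * sc - sc = (V x ^+ 4 - 1) * sc by ring.
  have sc1 : `|sc| <= 1.
    by rewrite normrM -[1]mulr1 ler_pM ?sin_max ?cos_max.
  have := ler_pM (normr_ge0 _) (normr_ge0 _) V4 sc1; rewrite -normrM mulr1 => q1.
  exact: le_trans s5.
have ss : s <= eta' by clear -s5 h0; lra.
have j1 : `|Phi x0 / 1 - z1 0| <= eta' by rewrite divr1 (le_trans i1).
have j2 : `|sg * (2 * kappa + P x0) / (L * 1) - z2 0| <= eta' by rewrite mulr1 (le_trans i2).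
have := layer eps delta kappa s 1 sg x0 M eta' _ _ _ _ V F Phi P
  (fun y => sin y * cos y) z1 z2 e0 d0 hred h1 Vs ltr01 (ltW eta'0) M0 ML hsg sincos_lip
  cz1 cz2 dz1 dz2 hP hE j1 j2.
rewrite KE; set Psi1 := (X in let Psi := X in _).
by have -> : Psi1 = Psi by apply/funext => t; rewrite /Psi1 invr1 mul1r.
Qed.

Lemma case_b {R : realType} (kt : R) (delta kappa : R -> R) (v dv phi dphi : R -> R -> R) :
  0 < kt -> kt < pi^-1 ->
  (\forall e \near 0^'+, kappa e = kt * Num.sqrt (delta e) / e) ->
  small_o0 delta (fun e => e) ->
  small_o0 (fun e => e ^+ 2) delta ->
  min_family delta kappa v dv phi dphi ->
  [/\ sup_littleo (fun e x => 1 - v e x) (fun e => Num.sqrt (Num.sqrt (delta e))),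
      asym_equiv (fun e => phi e 1) (fun _ => asin (2 * kt)),
      asym_equiv (fun e => Gfun e (delta e) (kappa e) (v e) (dv e) (phi e) (dphi e))
                 (fun e => Num.sqrt (delta e) / e *
                    ((1 - Num.sqrt (1 - 4 * kt ^+ 2)) / 4 - kt / 2 * asin (2 * kt))),
      (exists r : R -> R, r e @[e --> 0^'+] --> 0 /\
         \forall e \near 0^'+, forall x, 0 < x < 1 ->
           `|phi e x| <= asin (2 * kt) * (1 + r e))
    & C1loc_conv (fun e x => phi e (1 - e * x / Num.sqrt (delta e)))
        (fun x => 2 * atan (tan (asin (2 * kt) / 2) * expR (- x)))].
Proof.
move=> k0 kpi hk hde hed hmin.
have [C hC] := abs_sin_prim_ex R.
have [p02 sp] := asin_in _ k0 kpi.
have cosp : cos (asin (2 * kt)) = Num.sqrt (1 - 4 * kt ^+ 2).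
  rewrite cos_asin; first by congr Num.sqrt; ring.
  by rewrite -sp sin_geN1 sin_le1.
rewrite -cosp; set p := asin (2 * kt) in p02 sp *; have /andP[p0 p2] := p02.
have near_core (eta : R) : 0 < eta <= 1 ->
    \forall e \near 0^'+, kink_profile kt p eta C delta kappa v dv phi dphi e :=
  fun he => kink_near kt eta C delta kappa v dv phi dphi hC k0 kpi he hk hde hed hmin.
have min1 (eta : R) : 0 < eta -> 0 < Num.min eta 1 <= 1.
  by move=> h; rewrite lt_min h ltr01 ge_min lexx orbT.
have minl (eta : R) : Num.min eta 1 <= eta by rewrite ge_min lexx.
have i11 : 0 <= (1 : R) <= 1 by rewrite ler01 lexx.
have Cp : C p = 1 - cos p.
  by apply: asp_cos => //; have := pi_gt0 R; rewrite (ltW p0); lra.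
set w := _ / 4 - _.
have wE : C p / 4 - kt / 2 * p = w by rewrite Cp.
(* The tangent bound with gap, evaluated at [y = 0]. A nonzero limit is what turns the absolute
   energy error into a relative one. *)
have w0 : w < 0.
  have [c c0 [_ /(_ 0)]] := asp_tangent _ _ _ _ hC p02 sp k0 kpi p0.
  by rewrite sub0r normrN ler_norm hC.2 normr0 => /(_ isT); rewrite -wE; lra.
split.
- move=> eta eta0; have e20 : 0 < eta ^+ 2 by rewrite exprn_gt0.
  near=> e => x /andP[x0 x1].
  have : kink_profile kt p (Num.min (eta ^+ 2) 1) C delta kappa v dv phi dphi e.
    by near: e; apply: near_core; exact: min1.
  rewrite /kink_profile => -[V [F [Phi [P [[hred _ _ _ _] [Vs _ _ _ _]]]]]].
  have x01 : 0 <= x <= 1 by rewrite !ltW.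
  rewrite (red_vE _ _ _ _ _ _ _ _ _ _ _ hred _ x01) (ger0_norm (sqrtr_ge0 _)).
  rewrite -(@ler_pXn2r _ 2)// ?nnegrE ?(mulr_ge0 (ltW eta0) (sqrtr_ge0 _))//.
  rewrite -normrX ger0_norm ?sqr_ge0// exprMn sqr_sqrtr ?sqrtr_ge0//.
  by apply: le_trans (Vs x x01) _; rewrite ler_wpM2r ?sqrtr_ge0.
- apply: asym_equivP; first by apply: nearW => e; rewrite gt_eqF.
  move=> eta eta0; have e20 : 0 < eta * p by rewrite mulr_gt0.
  near=> e.
  have : kink_profile kt p (Num.min (eta * p) 1) C delta kappa v dv phi dphi e.
    by near: e; apply: near_core; exact: min1.
  rewrite /kink_profile => -[V [F [Phi [P [[hred _ h _ _] _]]]]].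
  rewrite (red_phiE _ _ _ _ _ _ _ _ _ _ _ hred _ i11) (gtr0_norm p0).
  exact: le_trans h (minl _).
- apply: asym_equivP.
    near=> e; have e0 : 0 < e by near: e; exact: nbhs_right_gt.
    have d0 : 0 < delta e by near: e; apply: filterS hmin => e [].
    by rewrite mulf_neq0 ?(lt_eqF w0)// gt_eqF// divr_gt0// sqrtr_gt0.
  move=> eta eta0; have e20 : 0 < eta * - w by rewrite mulr_gt0// oppr_gt0.
  near=> e; have e0 : 0 < e by near: e; exact: nbhs_right_gt.
  have : kink_profile kt p (Num.min (eta * - w) 1) C delta kappa v dv phi dphi e.
    by near: e; apply: near_core; exact: min1.
  rewrite /kink_profile => -[V [F [Phi [P [[hred _ _ _ h] [_ _ d0 _ _]]]]]].
  rewrite wE in h; have L0 : 0 < Num.sqrt (delta e) / e by rewrite divr_gt0// sqrtr_gt0.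
  apply: le_trans h _; rewrite normrM (gtr0_norm L0) (ltr0_norm w0).
  set L := _ / e in L0 *; have -> : eta * (L * - w) = eta * - w * L by ring.
  by rewrite ler_pM2r.
- apply: sup_ratio => // eta eta0; near=> e => x /andP[x0 x1].
  have : kink_profile kt p (Num.min eta 1) C delta kappa v dv phi dphi e.
    by near: e; apply: near_core; exact: min1.
  rewrite /kink_profile => -[V [F [Phi [P [[hred _ _ h _] _]]]]].
  have x01 : 0 <= x <= 1 by rewrite !ltW.
  rewrite (red_phiE _ _ _ _ _ _ _ _ _ _ _ hred _ x01).
  by apply: le_trans (h x x01) _; rewrite lerD2l.
- move=> M eta M0 eta0; have [s s01 hs] := pendulum_layer M eta 0 M0 eta0 (lexx _).
  near=> e.
  have e0 : 0 < e by near: e; exact: nbhs_right_gt.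
  have : kink_profile kt p s C delta kappa v dv phi dphi e by near: e; exact: near_core.
  rewrite /kink_profile => -[V [F [Phi [P [[hred Vs Phi1 _ _] [_ kapE d0 _ sL]]]]]].
  have P1 := red_P1 _ _ _ _ _ _ _ _ _ _ _ hred.
  set L := _ / e in kapE sL.
  have L0 : 0 < L by rewrite divr_gt0// sqrtr_gt0.
  have d2 (t : R) : is_derive t 1 (fun x => - sin (kink p x))
      (sin (kink p t) * cos (kink p t)).
    by have h := der_kink p t; derive_eq; ring.
  have i0 : `|P 1| <= L * 0 by rewrite P1 normr0 mulr0.
  have i1 : `|Phi 1 - kink p 0| <= s by rewrite kink0.
  have i2 : `|-1 * (2 * kappa e + P 1) / L - - sin (kink p 0)| <= s.
    have /andP[/ltW s0 _] := s01; rewrite kink0// sp P1 kapE.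
    have -> : -1 * (2 * (kt * L) + 0) / L - - (2 * kt) = 0 by field; rewrite gt_eqF.
    by rewrite normr0.
  have := hs e (delta e) (kappa e) (-1) 1 _ _ _ _ V F Phi P
    (kink p) (fun x => - sin (kink p x)) e0 d0 hred sL Vs (or_intror (conj erefl erefl))
    (fun t _ => der_cont _ _ _ (der_kink p t)) (fun t _ => der_cont _ _ _ (d2 t))
    (fun t _ => der_kink p t) (fun t _ => d2 t) i0 i1 i2.
  set Psi := (X in let Psi := X in _).
  have -> : Psi = (fun x => phi e (1 - e * x / Num.sqrt (delta e))).
    by apply/funext => x; rewrite /Psi mulN1r.
  move=> [r1 r2]; split=> // x xM; have [q1 q2] := r2 x xM; split => //.
  by have [_] := derE (der_kink p x); rewrite /kink => ->.
Unshelve. all: by end_near. Qed.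

(** * Supercritical twist *)

(* [phi' = speed a phi] is the first integral of [phi'' = sin phi cos phi] with
   initial slope [a] at [phi = 0]. *)
Definition speed {R : realType} (a y : R) : R := Num.sqrt (a ^+ 2 + sin y ^+ 2).

Lemma speed_sq {R : realType} (a y : R) : speed a y ^+ 2 = a ^+ 2 + sin y ^+ 2.
Proof. by rewrite sqr_sqrtr// addr_ge0// sqr_ge0. Qed.

Lemma speed_cont {R : realType} (a : R) : continuous (speed a).
Proof. by rewrite /speed; cont. Qed.

Lemma speed_ge {R : realType} (a y : R) : a <= speed a y.
Proof.
rewrite (le_trans (ler_norm a))// -sqrtr_sqr ler_sqrt ?lerDl ?sqr_ge0//.
by rewrite addr_ge0// sqr_ge0.
Qed.

Lemma speed_le {R : realType} (a y : R) : 0 <= a -> speed a y <= a + 1.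
Proof.
move=> a0; rewrite -[leRHS]ger0_norm ?addr_ge0// -sqrtr_sqr ler_sqrt ?sqr_ge0//.
have : `|sin y| ^+ 2 <= 1 by rewrite expr_le1 ?sin_max.
by rewrite real_normK ?num_real//; lra.
Qed.

Lemma speed_lip {R : realType} (a b y : R) : `|speed a y - speed b y| <= `|a - b|.
Proof.
have H (c d : R) : speed c y <= speed d y + `|c - d|.
  have d0 : 0 <= speed d y := sqrtr_ge0 _.
  have dn : `|d| <= speed d y.
    by rewrite -sqrtr_sqr ler_sqrt ?lerDl ?sqr_ge0// addr_ge0// sqr_ge0.
  rewrite -(@ler_pXn2r _ 2)// ?nnegrE ?sqrtr_ge0 ?addr_ge0//.
  rewrite speed_sq sqrrD speed_sq real_normK ?num_real//.
  have h : d * (c - d) <= speed d y * `|c - d|.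
    by rewrite (le_trans (ler_norm _))// normrM ler_wpM2r.
  by rewrite mulr2n; lra.
have h1 := H a b; have h2 := H b a; rewrite distrC in h2.
by rewrite ler_norml; apply/andP; split; lra.
Qed.

(** Not a time: it is the increase of a primitive of [speed a] over half a period of [sin^2], so
    [period a = k pi] says that [speed a] has mean [2 k]. *)
Definition period {R : realType} (a : R) : R := Iint 0 (pi / 2) (speed a).

Lemma period_cont {R : realType} : continuous (@period R).
Proof.
move=> x; apply/cvgrPdist_le => e e0.
have p0 : 0 < (pi : R) / 2 by rewrite divr_gt0// pi_gt0.
have d0 : 0 < e / (pi / 2) by rewrite divr_gt0.
have : \forall t \near x, `|x - t| < e / (pi / 2) by exact: (nbhsx_ballx x _ d0).
apply: filterS => t; rewrite ltr_pdivlMr// => xt.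
have isp b : itg 0 (pi / 2) (speed b) by apply: itg_cont; exact: speed_cont.
rewrite /period -IintB//; apply: le_trans (Iint_abs _ _ _ _) _.
  by apply: itgD => //; exact: itgN.
apply: (@le_trans _ _ (Iint 0 (pi / 2) (fun=> `|x - t|))).
  apply: Iint_le => [| |y _]; last exact: speed_lip.
    apply: itg_cont; apply: contAbs; apply: contD; first exact: speed_cont.
    by apply: contN; exact: speed_cont.
  exact: itg_cont (contC _).
by rewrite Iint_cst ?subr0 ?(ltW p0)// ltW.
Qed.

(** The speeds differ by [b^2 - a^2] over their sum, which is at most [a + b + 2]; this uniform gap
    [c] keeps the inequality strict after integration. *)
Lemma period_lt {R : realType} (a b : R) : 0 <= a -> a < b -> period a < period b.
Proof.
move=> a0 ab; have p0 : 0 < (pi : R) / 2 by rewrite divr_gt0// pi_gt0.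
have b0 := le_lt_trans a0 ab.
have c0 : 0 < a + b + 2 by rewrite ltr_wpDl ?addr_ge0// ltW.
pose c := (b ^+ 2 - a ^+ 2) / (a + b + 2).
have cp : 0 < c.
  by rewrite divr_gt0// subr_gt0 ltrXn2r// nnegrE// ltW.
have isp x : itg 0 (pi / 2) (speed x) by apply: itg_cont; exact: speed_cont.
suff : period a + c * (pi / 2) <= period b.
  by apply: lt_le_trans; rewrite ltrDl mulr_gt0.
have -> : c * (pi / 2) = Iint 0 (pi / 2) (fun=> c) by rewrite Iint_cst ?subr0// ltW.
rewrite /period -IintD//; last exact: itg_cont (contC _).
apply: Iint_le => [|//|y _]; first by apply: itgD => //; exact: itg_cont (contC _).
have X0 : 0 < speed b y by apply: lt_le_trans (speed_ge b y).
have Y0 : 0 <= speed a y := sqrtr_ge0 _.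
have Xb := speed_le b y (ltW b0); have Ya := speed_le a y a0.
have XY : (speed b y - speed a y) * (speed b y + speed a y) = b ^+ 2 - a ^+ 2.
  by rewrite -subr_sqr !speed_sq; ring.
have d0 : 0 <= speed b y - speed a y.
  have : 0 <= (speed b y - speed a y) * (speed b y + speed a y).
    by rewrite XY subr_ge0 lerXn2r// ?nnegrE// ltW.
  by rewrite pmulr_lge0// ltr_pwDl.
rewrite addrC -lerBrDr /c -XY ler_pdivrMr// ler_wpM2l//; lra.
Qed.

(** Intermediate values on [0, 2 k]: at 0 the integrand is [|sin|], with integral 1, below [k pi];
    at [2 k] the integrand is at least [2 k]. *)
Lemma period_ex {R : realType} (k : R) : pi^-1 < k ->
  exists a, [/\ 0 < a <= 2 * k, period a = k * pi &
    forall b, 0 < b <= 2 * k -> period b = k * pi -> b = a].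
Proof.
move=> kpi; have pi0 := pi_gt0 R.
have p0 : 0 < (pi : R) / 2 by rewrite divr_gt0.
have k0 : 0 < k by apply: lt_trans kpi; rewrite invr_gt0.
have kp1 : 1 < k * pi by rewrite -ltr_pdivrMr// div1r.
have I0 : period 0 = 1 :> R.
  have [C [dC C0]] := abs_sin_prim_ex R.
  rewrite /period (IintE _ _ _ (fun y => `|sin y|)); last first.
    by move=> y _; rewrite /speed expr0n /= add0r sqrtr_sqr.
  rewrite (Iint_FTC _ _ C) ?(ltW p0)//; last by cont.
  rewrite C0 subr0 (asp_cos C)//; first by rewrite cos_pihalf subr0.
  by rewrite (ltW p0); lra.
have I1 : k * pi <= period (2 * k).
  have -> : k * pi = Iint 0 (pi / 2) (fun=> 2 * k).
    by rewrite Iint_cst ?(ltW p0)// subr0; field.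
  apply: Iint_le => [||y _]; last exact: speed_ge.
    exact: itg_cont (contC _).
  by apply: itg_cont; exact: speed_cont.
have k20 : 0 <= 2 * k by rewrite mulr_ge0// ltW.
have [] := @IVT _ period 0 (2 * k) (k * pi) k20 (continuous_subspaceT period_cont).
  by rewrite ge_min le_max I0 (ltW kp1) I1 orbT.
move=> a; rewrite in_itv /= => /andP[a0 a1] pa.
have a0' : 0 < a.
  rewrite lt_neqAle a0 andbT; apply/eqP => a0E.
  by move: pa kp1; rewrite -a0E I0 => <-; rewrite ltxx.
exists a; split => //; first by rewrite a0'.
move=> b /andP[b0 b1] pb; apply/eqP; rewrite eq_le; apply/andP; split; rewrite leNgt; apply/negP.
  by move=> /(period_lt _ _ (ltW a0')); rewrite pa pb ltxx.
by move=> /(period_lt _ _ (ltW b0)); rewrite pa pb ltxx.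
Qed.

(** As [speed a] is pi-periodic with mean [2 k], [T y - 2 k y] is periodic. This is why [a] is the
    right parameter: the calibration cancels the twist term whatever the end value of the phase, up
    to a bounded amount. *)
Lemma speed_prim_bound {R : realType} (a k : R) (T : R -> R) : 0 < a ->
  period a = k * pi -> (forall y : R, is_derive y 1 T (speed a y)) -> T 0 = 0 ->
  exists2 m, 0 <= m & forall y, `|T y - 2 * k * y| <= m.
Proof.
move=> a0 pa dT T0; have pi0 := pi_gt0 R.
have p0 : 0 < (pi : R) / 2 by rewrite divr_gt0.
have Tp2 : T (pi / 2) = k * pi.
  by rewrite -pa /period (Iint_FTC _ _ T _ (ltW p0))// ?T0 ?subr0//; exact: speed_cont.
have per y : speed a (y + pi) = speed a y by rewrite /speed sinDpi sqrrN.
have sym y : speed a (pi - y) = speed a y.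
  by rewrite /speed sinB sinpi cospi; congr (Num.sqrt (_ + _ ^+ 2)); ring.
have Tpi : T pi = 2 * k * pi.
  have d (y : R) : 0 <= y <= pi / 2 -> is_derive y 1 (fun z => T z + T (pi - z)) 0.
    move=> _; have d1 : is_derive y 1 (fun z => pi - z) (-1) by derive_eq; ring.
    have d2 := derO T (fun z => pi - z) y _ _ (dT _) d1.
    have d3 := dT y; derive_eq; rewrite sym; ring.
  have := eq_of_der0 _ _ _ (ltW p0) d.
  have -> : pi - pi / 2 = (pi : R) / 2 by field.
  by rewrite T0 subr0 Tp2; lra.
pose g y := T y - 2 * k * y.
have dg (y : R) : is_derive y 1 g (speed a y - 2 * k) by rewrite /g; derive_eq; ring.
have gper y : g (y + pi) = g y.
  have d (z : R) : is_derive z 1 (fun z => g (z + pi) - g z) 0.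
    have d1 : is_derive z 1 (fun z => z + pi) 1 by derive_eq; ring.
    have d2 := derO g (fun z => z + pi) z _ _ (dg _) d1.
    by derive_eq; rewrite per; ring.
  have E : g (y + pi) - g y = g (0 + pi) - g 0.
    have [y0|/ltW y0] := leP 0 y; first by have := eq_of_der0 _ _ _ y0 (fun y _ => d y).
    by have := eq_of_der0 _ _ _ y0 (fun y _ => d y).
  have : g (0 + pi) - g 0 = 0 by rewrite add0r /g T0 Tpi; ring.
  by move=> h; apply/eqP; rewrite -subr_eq0 E h.
have [m m0 gm] := cont_bounded 0 pi g (der_continuous _ _ dg).
exists m => // y; rewrite -/(g y).
have pos n z : 0 <= z -> z <= n%:R * pi -> `|g z| <= m.
  elim: n z => [|n IH] z z0.
    by rewrite mul0r => z1; apply: gm; rewrite z0 (le_trans z1)// ltW.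
  rewrite -natr1 mulrDl mul1r => zn; have [zp|/ltW zp] := leP z pi.
    by apply: gm; rewrite z0.
  by rewrite -[z](subrK pi) gper; apply: IH; lra.
have neg n z : - (n%:R * pi) <= z -> z <= 0 -> `|g z| <= m.
  elim: n z => [|n IH] z.
    rewrite mul0r oppr0 => z0 z1; apply: gm; rewrite z0 (le_trans z1)// ltW//.
  rewrite -natr1 mulrDl mul1r => zn z0; rewrite -gper.
  have [zp|/ltW zp] := leP 0 (z + pi); first by apply: gm; rewrite zp; lra.
  by apply: IH => //; lra.
have ub (z : R) : 0 <= z -> z <= (Num.truncn (z / pi)).+1%:R * pi.
  move=> z0; have zp : 0 <= z / pi by rewrite divr_ge0// ltW.
  by rewrite -ler_pdivrMr// ltW//; have /andP[] := truncn_itv zp.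
have [y0|/ltW y0] := leP 0 y; first exact: (pos _ _ y0 (ub y y0)).
by apply: (neg (Num.truncn (- y / pi)).+1 y _ y0); rewrite lerNl; apply: ub; rewrite oppr_ge0.
Qed.

(** Separation of variables: the solution is the inverse of [U], the primitive of [1/S] vanishing at
    0. The upper bound on [S] makes [U] grow at least linearly, hence onto. *)
Lemma flow_ex {R : realType} (S : R -> R) (m M : R) : continuous S -> 0 < m ->
  (forall y, m <= S y) -> (forall y, S y <= M) ->
  exists g : R -> R, g 0 = 0 /\ forall x : R, is_derive x 1 g (S (g x)).
Proof.
move=> cS m0 Sm SM.
have Sp y : 0 < S y by exact: lt_le_trans (Sm y).
have M0 : 0 < M by exact: lt_le_trans (SM 0).
have Sn y : S y != 0 by rewrite gt_eqF.
have cV : continuous (fun y => (S y)^-1) by exact: contV.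
have [U1 dU1] := prim_ex _ cV.
pose U y := U1 y - U1 0.
have dU (y : R) : is_derive y 1 U (S y)^-1 by rewrite /U; derive_eq; ring.
have U0 : U 0 = 0 by rewrite /U subrr.
have cU := der_continuous _ _ dU.
have Uinc a b : a < b -> U a < U b.
  by move=> ab; apply: (lt_of_der _ _ _ _ ab (fun y _ => dU y)) => y _; rewrite invr_gt0.
have Uinj : injective U.
  move=> a b E; apply/eqP; have [ab|ab|//] := ltgtP a b.
    by have := Uinc _ _ ab; rewrite E ltxx.
  by have := Uinc _ _ ab; rewrite E ltxx.
have dl (y : R) : is_derive y 1 (fun z => U z - z / M) ((S y)^-1 - M^-1).
  by have d := dU y; derive_eq; ring.
have dl0 y : 0 <= (S y)^-1 - M^-1 by rewrite subr_ge0 lef_pV2 ?posrE.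
have Uge y : 0 <= y -> y / M <= U y.
  move=> y0; have := le_of_der _ _ _ _ y0 (fun z _ => dl z) (fun z _ => dl0 z).
  by rewrite U0 mul0r subr0 subr_ge0.
have Ule y : y <= 0 -> U y <= y / M.
  move=> y0; have := le_of_der _ _ _ _ y0 (fun z _ => dl z) (fun z _ => dl0 z).
  by rewrite U0 mul0r subr0 subr_le0.
have surj x : exists y, U y = x.
  pose b := M * `|x|; have b0 : 0 <= b by rewrite mulr_ge0// ltW.
  have bM : b / M = `|x| by rewrite /b mulrAC divff ?mul1r// gt_eqF.
  have bb : - b <= b by rewrite ge0_cp.
  have [] := @IVT _ U (- b) b x bb (continuous_subspaceT cU).
    rewrite ge_min le_max; apply/andP; split; apply/orP; [left|right].
      apply: le_trans (Ule _ _) _; first by rewrite oppr_le0.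
      by rewrite mulNr bM lerNl -normrN ler_norm.
    by apply: le_trans (Uge _ b0); rewrite bM ler_norm.
  by move=> y _ E; exists y.
pose g x := projT1 (cid (surj x)).
have gK x : U (g x) = x by rewrite /g; case: cid.
have Kg y : g (U y) = y by apply: Uinj; rewrite gK.
exists g; split; first by apply: Uinj; rewrite gK U0.
move=> x; have : is_derive (U (g x)) 1 g ((S (g x))^-1)^-1.
  apply: (@is_derive_inverse _ U g).
  - by apply: (@filterE _ (nbhs (g x))) => y; exact: Kg.
  - by apply: (@filterE _ (nbhs (g x))) => y; exact: cU.
  - by rewrite invr_eq0.
by rewrite gK invrK.
Qed.

Lemma flow_ode_sol {R : realType} (a : R) (g : R -> R) : 0 < a -> g 0 = 0 ->
  (forall x : R, is_derive x 1 g (speed a (g x))) -> ode_sol a g.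
Proof.
move=> a0 g0 dg.
have gE : derive1 g = (fun x => speed a (g x)).
  by apply/funext => x; have [_ ->] := derE (dg x).
have sp x : 0 < speed a (g x) by exact: lt_le_trans (speed_ge _ _).
have d (x : R) : is_derive x 1 (fun y => speed a (g y)) (sin (g x) * cos (g x)).
  have h := dg x.
  have d1 : is_derive x 1 (fun y => a ^+ 2 + sin (g y) ^+ 2)
     (2 * (sin (g x) * (cos (g x) * speed a (g x)))) by derive_eq; rewrite /=; ring.
  have p : 0 < a ^+ 2 + sin (g x) ^+ 2 by rewrite ltr_pwDl ?sqr_ge0 ?exprn_gt0.
  have d2 := derO Num.sqrt (fun y => a ^+ 2 + sin (g y) ^+ 2) x _ _ (is_derive1_sqrt p) d1.
  apply: der_eq d2 _; rewrite -/(speed a (g x)); field.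
  by rewrite gt_eqF.
split => //.
- by move=> x _; rewrite gE; split; [case: (dg x)|case: (d x)].
- by rewrite gE g0 /speed sin0 expr0n addr0 sqrtr_sqr gtr0_norm.
- by move=> x _; rewrite gE; have [_ ->] := derE (d x).
Qed.

(** * Matching energy bounds and the initial slope above the threshold *)

Lemma upper_flow {R : realType} (eps delta kappa L k a m : R) (T g : R -> R)
    (v dv phi dphi : R -> R) :
  0 < eps -> 0 < L -> delta / eps ^+ 2 = L ^+ 2 -> kappa = k * L ->
  (forall y : R, is_derive y 1 T (speed a y)) -> T 0 = 0 ->
  (forall y, `|T y - 2 * k * y| <= m) ->
  g 0 = 0 -> (forall x : R, is_derive x 1 g (speed a (g x))) ->
  minimizer eps delta kappa v dv phi dphi ->
  Gfun eps delta kappa v dv phi dphi <= - (a ^+ 2 * L ^+ 2 / 8) + L * m / 4.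
Proof.
move=> e0 L0 dE kE dT T0 Tm g0 dg hm.
pose psi x := g (L * x).
have dP (x : R) : is_derive x 1 psi (L * speed a (psi x)).
  have d1 : is_derive x 1 (fun x => L * x) L by derive_eq; ring.
  have d2 := derO g (fun x => L * x) x _ _ (dg _) d1.
  by apply: der_eq d2 _; rewrite /psi; ring.
have cpsi := der_continuous _ _ dP.
have cs := speed_cont a.
have cd : continuous (fun x => L * speed a (psi x)) by cont.
have P0 : psi 0 = 0 by rewrite /psi mulr0.
apply: le_trans (competitor _ _ _ _ _ _ _ _ _ hm dP cd P0) _.
have -> : delta / (8 * eps ^+ 2) = L ^+ 2 / 8 by rewrite -dE; field; rewrite gt_eqF.
pose J := Iint 0 1 (fun x => speed a (psi x) ^+ 2).
have dTp (x : R) : is_derive x 1 (fun y => T (psi y)) (L * speed a (psi x) ^+ 2).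
  by apply: der_eq (derO T psi x _ _ (dT _) (dP x)) _; ring.
have JE : L * J = T (psi 1).
  rewrite /J -IintZ; last by apply: itg_cont; cont.
  by rewrite (Iint_FTC _ _ _ _ ler01 dTp) ?P0 ?T0 ?subr0//; cont.
have I1 : Iint 0 1 (fun x => (L * speed a (psi x)) ^+ 2) = L ^+ 2 * J.
  rewrite /J -IintZ; last by apply: itg_cont; cont.
  by apply: IintE => x _; ring.
have I2 : Iint 0 1 (fun x => sin (psi x) ^+ 2) = J - a ^+ 2.
  have -> : a ^+ 2 = Iint 0 1 (fun=> a ^+ 2) by rewrite Iint_cst// subr0 mulr1.
  rewrite /J -IintB; [|by apply: itg_cont; cont..].
  by apply: IintE => x _; rewrite speed_sq; ring.
rewrite I1 I2 kE.
have h : L * (T (psi 1) - 2 * k * psi 1) <= L * m.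
  by rewrite ler_pM2l// (le_trans (ler_norm _)).
have L2J : L ^+ 2 * J = L * T (psi 1) by rewrite -JE; ring.
by move: h L2J; set y := psi 1; clear; lra.
Qed.

(** Since [speed a Phi * F] is the derivative of [T Phi], the reduced energy is one eighth of
    [int (F - L speed)^2] minus [a^2 L^2 / 8], up to [O(L m)]; the upper bound then controls the
    square. The loss [theta] needs an a priori bound on [int F^2], supplied by [G <= 0] and
    [Phi(1)^2 <= int F^2]. *)
Lemma supercrit_energy {R : realType} (eps delta kappa L k a m theta : R) (T : R -> R)
    (v dv phi dphi V F Phi P : R -> R) :
  0 < L -> 0 < k -> 0 <= m ->
  delta / eps ^+ 2 = L ^+ 2 -> kappa = k * L ->
  (forall y : R, is_derive y 1 T (speed a y)) -> T 0 = 0 ->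
  (forall y, `|T y - 2 * k * y| <= m) ->
  reduced eps delta kappa v dv phi dphi V F Phi P -> 0 < theta <= 2^-1 ->
  Ev eps V dv / 2 + (1 - theta) / 8 *
    Iint 0 1 (fun x => F x ^+ 2 + delta / eps ^+ 2 * sin (Phi x) ^+ 2)
    - kappa / 2 * Phi 1 <= Gfun eps delta kappa v dv phi dphi ->
  Gfun eps delta kappa v dv phi dphi <= - (a ^+ 2 * L ^+ 2 / 8) + L * m / 4 ->
  Gfun eps delta kappa v dv phi dphi <= 0 -> 0 <= Ev eps V dv ->
  let G := Gfun eps delta kappa v dv phi dphi in
  [/\ Iint 0 1 (fun x => F x ^+ 2) <= 64 * kappa ^+ 2,
      Iint 0 1 (fun x => (F x - L * speed a (Phi x)) ^+ 2)
        <= 4 * L * m + 8 * theta * (8 * k ^+ 2 + 1) * L ^+ 2 &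
      `|G + a ^+ 2 * L ^+ 2 / 8| <= L * m / 4 + theta * (8 * k ^+ 2 + 1) * L ^+ 2].
Proof.
move=> L0 k0 m0 dE kE dT T0 Tm hred /andP[t0 t1] low up G0 E0 G.
have [cV Vp _ cF dPhi Phi0 _ _ _ _ _ _] := hred.
have cPhi := der_continuous _ _ dPhi.
have cs := speed_cont a.
rewrite dE in low; rewrite -/G in low up G0 *.
set X := Iint 0 1 (fun x => F x ^+ 2).
set J := Iint 0 1 (fun x => sin (Phi x) ^+ 2).
set D := Iint 0 1 (fun x => (F x - L * speed a (Phi x)) ^+ 2).
have X0 : 0 <= X by apply: Iint_ge0 => x _; exact: sqr_ge0.
have J0 : 0 <= J by apply: Iint_ge0 => x _; exact: sqr_ge0.
have D0 : 0 <= D by apply: Iint_ge0 => x _; exact: sqr_ge0.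
have J1 : J <= 1.
  have -> : (1 : R) = Iint 0 1 (fun=> 1) by rewrite Iint_cst// subr0 mulr1.
  apply: Iint_le => [||x _]; [by apply: itg_cont; cont..|].
  by rewrite sin2cos2 gerBl sqr_ge0.
have IE : Iint 0 1 (fun x => F x ^+ 2 + L ^+ 2 * sin (Phi x) ^+ 2) = X + L ^+ 2 * J.
  by rewrite IintD ?IintZ//; apply: itg_cont; cont.
have uE : Phi 1 = Iint 0 1 F by rewrite (Iint_FTC _ _ Phi F)// Phi0 subr0.
have uX : Phi 1 ^+ 2 <= X.
  have := Iint_sqr_le 0 1 F (lexx _) ler01 (lexx _) (L2on_cont _ _ _ cF).
  by rewrite -uE subr0 mul1r.
have kap0 : 0 < kappa by rewrite kE mulr_gt0.
have XJ0 : 0 <= L ^+ 2 * J by rewrite mulr_ge0// sqr_ge0.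
have X8 : X <= 8 * (kappa * Phi 1).
  have : 2^-1 * (X + L ^+ 2 * J) <= (1 - theta) * (X + L ^+ 2 * J).
    by rewrite ler_wpM2r ?addr_ge0//; clear -t1; lra.
  by move: low; rewrite IE => low h; clear -low h E0 G0 XJ0; lra.
have u8 : Phi 1 <= 8 * kappa.
  rewrite leNgt; apply/negP => lt.
  have up0 : 0 < Phi 1 by apply: lt_trans lt; rewrite mulr_gt0.
  have : Phi 1 * (8 * kappa) < Phi 1 * Phi 1 by rewrite ltr_pM2l.
  by move: uX X8; rewrite expr2; clear; lra.
have X64 : X <= 64 * kappa ^+ 2.
  have := ler_wpM2l (ltW kap0) u8; move: X8; rewrite expr2; clear; lra.
have dTp (x : R) : is_derive x 1 (fun y => T (Phi y)) (speed a (Phi x) * F x).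
  exact: (derO T Phi x _ _ (dT _) (dPhi x)).
have Tint : Iint 0 1 (fun x => speed a (Phi x) * F x) = T (Phi 1).
  by rewrite (Iint_FTC _ _ _ _ ler01 dTp) ?Phi0 ?T0 ?subr0//; cont.
have DE : X + L ^+ 2 * J = D + 2 * L * T (Phi 1) - L ^+ 2 * a ^+ 2.
  rewrite -IE -Tint.
  have -> : L ^+ 2 * a ^+ 2 = Iint 0 1 (fun=> L ^+ 2 * a ^+ 2).
    by rewrite Iint_cst// subr0 mulr1.
  rewrite /D -IintZ; last by apply: itg_cont; cont.
  rewrite -IintD; [|by apply: itg_cont; cont..].
  rewrite -IintB; [|by apply: itg_cont; cont..].
  apply: IintE => x _; have := speed_sq a (Phi x).
  set S := speed a _ => hS.
  have -> : sin (Phi x) ^+ 2 = S ^+ 2 - a ^+ 2 by rewrite hS; ring.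
  by ring.
have Tl : - (L * m) <= L * (T (Phi 1) - 2 * k * Phi 1).
  by rewrite -mulrN ler_pM2l//; have := Tm (Phi 1); rewrite ler_norml => /andP[].
have tX : theta * (X + L ^+ 2 * J) <= theta * (64 * k ^+ 2 * L ^+ 2 + L ^+ 2).
  rewrite ler_wpM2l ?(ltW t0)//; apply: lerD.
    by rewrite kE in X64; apply: le_trans X64 _; rewrite exprMn mulrA.
  by rewrite ler_piMr// sqr_ge0.
have tL : 0 <= theta * L ^+ 2 by rewrite mulr_ge0 ?sqr_ge0// ltW.
have main : D / 8 - L * m / 4 - a ^+ 2 * L ^+ 2 / 8 - theta * (8 * k ^+ 2 + 1) * L ^+ 2 <= G.
  move: low; rewrite IE kE => low.
  by clear -low tX Tl DE E0 tL; lra.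
split => //; first by clear -main up; lra.
have h1 : 0 <= theta * (8 * k ^+ 2 + 1) * L ^+ 2.
  by rewrite mulr_ge0 ?sqr_ge0// mulr_ge0 ?(ltW t0)// addr_ge0// mulr_ge0 ?sqr_ge0.
have h2 : 0 <= L * m by rewrite mulr_ge0// ltW.
rewrite ler_norml; apply/andP; split; first by clear -main D0 h2; lra.
by clear -up h1; lra.
Qed.

(* [q = 2 kappa + P] is [F] up to [1 - V^2], and [q^2 - L^2 sin^2 Phi], which is
   exactly conserved when [V = 1], is almost conserved in general. *)
Lemma supercrit_momentum {R : realType} (eps delta kappa L k a s tau D : R)
    (v dv phi dphi V F Phi P : R -> R) :
  0 < eps -> 0 < L -> 0 < k -> 0 < tau -> s <= 8^-1 ->
  delta / eps ^+ 2 = L ^+ 2 -> kappa = k * L ->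
  reduced eps delta kappa v dv phi dphi V F Phi P ->
  (forall x, 0 <= x <= 1 -> `|1 - V x| <= s) ->
  Ev eps V dv <= kappa ^+ 2 / 2 ->
  Iint 0 1 (fun x => F x ^+ 2) <= 64 * kappa ^+ 2 ->
  Iint 0 1 (fun x => (F x - L * speed a (Phi x)) ^+ 2) <= D ->
  let w := 130 * (eps * kappa ^+ 2) * L ^+ 2 + 1365 * s * kappa ^+ 2 + D / (2 * tau)
           + tau * (64 * k ^+ 2 + a ^+ 2 + 1) * L ^+ 2 in
  `|(2 * kappa + P 0) ^+ 2 - a ^+ 2 * L ^+ 2| <= w /\
  (w + 130 * (eps * kappa ^+ 2) * L ^+ 2 < a ^+ 2 * L ^+ 2 -> 0 < 2 * kappa + P 0).
Proof.
move=> e0 L0 k0 tau0 s8 dE kE hred Vs EV X64 DD w.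
have [cV Vp _ cF dPhi Phi0 _ cP P1 dP FE _] := hred.
have cPhi := der_continuous _ _ dPhi.
have cs := speed_cont a.
have kap0 : 0 < kappa by rewrite kE mulr_gt0.
set X := Iint 0 1 (fun x => F x ^+ 2) in X64.
pose q x := 2 * kappa + P x.
have qF x : q x = V x ^+ 2 * F x + 2 * kappa * (1 - V x ^+ 2).
  by rewrite /q FE; field; rewrite gt_eqF.
pose H x := q x ^+ 2 - L ^+ 2 * sin (Phi x) ^+ 2.
pose h x := 2 * L ^+ 2 * (sin (Phi x) * cos (Phi x)) * (q x * V x ^+ 4 - F x).
have cq : continuous q by rewrite /q; cont.
have ch : continuous h by rewrite /h; cont.
have dH (x : R) : 0 <= x <= 1 -> is_derive x 1 H (h x).
  move=> x01; have d := dP x x01; have d' := dPhi x; rewrite dE in d.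
  by rewrite /H /h /q; derive_eq; rewrite /=; ring.
pose B := Iint 0 1 (fun x => (1 - V x ^+ 2) ^+ 2).
have e20 : 0 < 4 * eps ^+ 2 by rewrite mulr_gt0// exprn_gt0.
have BE : B <= 2 * (eps ^+ 2 * kappa ^+ 2).
  have A0 : 0 <= 2^-1 * Iint 0 1 (fun x => dv x ^+ 2).
    by rewrite mulr_ge0// Iint_ge0// => x _; exact: sqr_ge0.
  have : (4 * eps ^+ 2)^-1 * B <= kappa ^+ 2 / 2.
    by apply: le_trans EV; rewrite /Ev lerDr.
  by rewrite ler_pdivrMl//; clear; lra.
pose Q x := 4 * (`|F x| + kappa).
have cQ : continuous Q by rewrite /Q; cont.
have QE : Iint 0 1 (fun x => Q x ^+ 2) <= 2080 * kappa ^+ 2.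
  apply: (@le_trans _ _ (Iint 0 1 (fun x => 32 * F x ^+ 2 + 32 * kappa ^+ 2))).
    apply: Iint_le => [||x _]; [by apply: itg_cont; cont..|].
    rewrite /Q -[F x ^+ 2](real_normK (num_real _)).
    by have := sqr_ge0 (`|F x| - kappa); clear; lra.
  rewrite IintD ?IintZ ?Iint_cst//; [|by apply: itg_cont; cont..].
  by rewrite -/X; move: X64; clear; lra.
pose W := Iint 0 1 (fun x => `|1 - V x ^+ 2| * Q x).
have cabs : continuous (fun x => `|1 - V x ^+ 2|) by cont.
have W0 : 0 <= W.
  by apply: Iint_ge0 => x _; rewrite !mulr_ge0// addr_ge0// ltW.
(* 65 rounds up the square root of [2 * 2080 = 4160], where [2080 = 32 * 64 + 32]. *)
have WE : W <= 65 * (eps * kappa ^+ 2).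
  rewrite -(@ler_pXn2r _ 2)// ?nnegrE//; last first.
    by rewrite mulr_ge0// mulr_ge0 ?sqr_ge0// ltW.
  apply: le_trans (cauchy_schwarz _ _ _ _ (L2on_cont _ _ _ cabs) (L2on_cont _ _ _ cQ)) _.
  have -> : Iint 0 1 (fun x => `|1 - V x ^+ 2| ^+ 2) = B.
    by apply: IintE => x _; rewrite real_normK ?num_real.
  apply: (@le_trans _ _ (2 * (eps ^+ 2 * kappa ^+ 2) * (2080 * kappa ^+ 2))).
    apply: ler_pM => //; apply: Iint_ge0 => x _; exact: sqr_ge0.
  have -> : 2 * (eps ^+ 2 * kappa ^+ 2) * (2080 * kappa ^+ 2) =
    4160 * (eps * kappa ^+ 2) ^+ 2 by ring.
  by rewrite exprMn; have := sqr_ge0 (eps * kappa ^+ 2); clear; lra.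
(* The derivative [h] of [H] carries a factor [1 - V^2], so the potential energy makes its integral
   small through Cauchy-Schwarz. *)
have hle x : 0 <= x <= 1 -> `|h x| <= L ^+ 2 * (`|1 - V x ^+ 2| * Q x).
  move=> x01; have [_ _ _ _ /andP[u1 u2]] := near1_bounds _ _ s8 (Vs x x01).
  have {u1 u2} [m1 m2] : 0 <= V x ^+ 2 /\ V x ^+ 2 <= 81 / 64.
    have := Vs x x01; rewrite ler_norml => /andP[h1 h2]; split; first exact: sqr_ge0.
    by rewrite expr2; have := Vp x => V0; clear -h1 h2 V0 s8; nra.
  have -> : h x = L ^+ 2 * ((2 * (sin (Phi x) * cos (Phi x))) * ((1 - V x ^+ 2) *
      (2 * kappa * V x ^+ 4 - F x * (V x ^+ 4 + V x ^+ 2 + 1)))).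
    by rewrite /h qF; ring.
  rewrite normrM (ger0_norm (sqr_ge0 L)) ler_wpM2l ?sqr_ge0//.
  have sc : `|2 * (sin (Phi x) * cos (Phi x))| <= 1.
    have -> : 2 * (sin (Phi x) * cos (Phi x)) = sin (Phi x + Phi x) by rewrite sinD; ring.
    exact: sin_max.
  rewrite normrM; apply: (@le_trans _ _ (1 * `|(1 - V x ^+ 2) *
      (2 * kappa * V x ^+ 4 - F x * (V x ^+ 4 + V x ^+ 2 + 1))|)).
    by rewrite ler_wpM2r.
  rewrite mul1r normrM ler_wpM2l//.
  have -> : V x ^+ 4 = V x ^+ 2 * V x ^+ 2 by ring.
  set n := V x ^+ 2 in m1 m2 *.
  apply: le_trans (ler_normB _ _) _.
  have nn : n * n <= 27 / 16 by clear -m1 m2; nra.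
  have nn0 : 0 <= n * n by rewrite mulr_ge0.
  have k1 : `|2 * kappa * (n * n)| <= 4 * kappa.
    have n4 : 0 <= 2 * kappa * (n * n) by rewrite mulr_ge0// mulr_ge0// ltW.
    rewrite (ger0_norm n4).
    by have := ler_wpM2l (ltW kap0) nn; clear -kap0; lra.
  have k2 : `|F x * (n * n + n + 1)| <= 4 * `|F x|.
    have n3 : 0 <= n * n + n + 1 by clear -m1 nn0; lra.
    rewrite normrM [leRHS]mulrC ler_wpM2l// (ger0_norm n3).
    by clear -nn m2; lra.
  by rewrite /Q; clear -k1 k2; lra.
have HH x y : 0 <= x -> x <= y -> y <= 1 -> `|H y - H x| <= L ^+ 2 * W.
  move=> x0 xy y1.
  have dH' (z : R) : x <= z <= y -> is_derive z 1 H (h z).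
    by move=> /andP[xz zy]; apply: dH; rewrite (le_trans x0)//= (le_trans zy).
  rewrite -(Iint_FTC_on _ _ H h xy dH' ch).
  apply: le_trans (Iint_abs _ _ _ (itg_cont _ _ _ ch)) _.
  have ca : continuous (fun z => `|h z|) by cont.
  apply: (@le_trans _ _ (Iint 0 1 (fun z => `|h z|))).
    rewrite (Iint_chasles 0 x 1)//; [|exact: le_trans y1|exact: itg_cont].
    rewrite (Iint_chasles x y 1)//; last exact: itg_cont.
    by rewrite addrCA lerDl addr_ge0// Iint_ge0.
  rewrite /W -IintZ; last by apply: itg_cont; cont.
  by apply: Iint_le => //; apply: itg_cont; cont.
have LW : L ^+ 2 * W <= 65 * (eps * kappa ^+ 2) * L ^+ 2.
  by rewrite mulrC ler_wpM2r ?sqr_ge0.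
have H0x x : 0 <= x <= 1 -> `|H 0 - H x| <= 65 * (eps * kappa ^+ 2) * L ^+ 2.
  by move=> /andP[x0 x1]; rewrite distrC; apply: le_trans (HH _ _ (lexx _) x0 x1) LW.
have H0E : H 0 = (2 * kappa + P 0) ^+ 2.
  by rewrite /H /q Phi0 sin0 expr0n mulr0 subr0.
(* The difference is [(q - F)(q + F) + (F - L S)(F + L S)]: the first product is small with
   [1 - V^2], the second is split by Young's inequality with weight [tau], which lets the deficit
   [D] in after integration. *)
have pw x : 0 <= x <= 1 -> `|H x - a ^+ 2 * L ^+ 2| <=
   (2 * tau)^-1 * (F x - L * speed a (Phi x)) ^+ 2 +
   (tau + 21 * s) * F x ^+ 2 + (tau * (a ^+ 2 + 1) * L ^+ 2 + 21 * s * kappa ^+ 2).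
  move=> x01; have [_ _ _ mV _] := near1_bounds _ _ s8 (Vs x x01).
  have s0 : 0 <= s by exact: le_trans (Vs x x01).
  have := speed_sq a (Phi x); set S := speed a _ => SE.
  set n := V x ^+ 2 in mV *; set f := F x.
  have -> : H x - a ^+ 2 * L ^+ 2 = (q x - f) * (q x + f) + (f - L * S) * (f + L * S).
    have -> : H x - a ^+ 2 * L ^+ 2 = q x ^+ 2 - L ^+ 2 * S ^+ 2 by rewrite SE /H; ring.
    by ring.
  apply: le_trans (ler_normD _ _) _.
  have b1 : `|q x - f| <= 3 * s * (2 * kappa + `|f|).
    have -> : q x - f = (1 - n) * (2 * kappa - f) by rewrite qF -/n -/f; ring.
    rewrite normrM; apply: ler_pM => //.
    apply: le_trans (ler_normB _ _) _.
    by rewrite (ger0_norm (_ : 0 <= 2 * kappa))// mulr_ge0// ltW.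
  have b2 : `|q x + f| <= kappa + 3 * `|f|.
    have -> : q x + f = (1 + n) * f + 2 * kappa * (1 - n) by rewrite qF -/n -/f; ring.
    apply: le_trans (ler_normD _ _) _; rewrite !normrM.
    have n1 : `|1 - n| <= 2^-1 by apply: le_trans mV _; clear -s8; lra.
    have n2 : `|1 + n| <= 3.
      move: n1; rewrite !ler_norml => /andP[n1 n2]; apply/andP; clear -n1 n2; split; lra.
    rewrite (ger0_norm (_ : 0 <= (2 : R)))// (gtr0_norm kap0).
    have := ler_wpM2r (normr_ge0 f) n2.
    have := ler_wpM2l (ltW kap0) n1; clear; lra.
  have b3 : `|(q x - f) * (q x + f)| <= 21 * s * f ^+ 2 + 21 * s * kappa ^+ 2.
    rewrite normrM; apply: le_trans (ler_pM (normr_ge0 _) (normr_ge0 _) b1 b2) _.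
    rewrite -[f ^+ 2](real_normK (num_real _)); set g := `|f|.
    have : (2 * kappa + g) * (kappa + 3 * g) <= 7 * (g ^+ 2 + kappa ^+ 2).
      by have := sqr_ge0 (g - kappa); have := sqr_ge0 g; have := sqr_ge0 kappa; clear; nra.
    by move=> /(ler_wpM2l s0); clear; lra.
  have b4 : `|(f - L * S) * (f + L * S)| <= (2 * tau)^-1 * (f - L * S) ^+ 2
      + tau / 2 * (f + L * S) ^+ 2.
    rewrite normrM -[(f - L * S) ^+ 2](real_normK (num_real _)).
    rewrite -[(f + L * S) ^+ 2](real_normK (num_real _)).
    set x1 := `|f - L * S|; set x2 := `|f + L * S|.
    rewrite -subr_ge0.
    have -> : (2 * tau)^-1 * x1 ^+ 2 + tau / 2 * x2 ^+ 2 - x1 * x2 =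
      (x1 - tau * x2) ^+ 2 / (2 * tau) by field; rewrite gt_eqF.
    by rewrite divr_ge0 ?sqr_ge0// mulr_ge0// ltW.
  have b5 : tau / 2 * (f + L * S) ^+ 2 <= tau * f ^+ 2 + tau * (a ^+ 2 + 1) * L ^+ 2.
    have : (f + L * S) ^+ 2 <= 2 * f ^+ 2 + 2 * L ^+ 2 * (a ^+ 2 + 1).
      have : L ^+ 2 * S ^+ 2 <= L ^+ 2 * (a ^+ 2 + 1).
        rewrite ler_wpM2l ?sqr_ge0// SE lerD2l sin2cos2 gerBl; exact: sqr_ge0.
      by have := sqr_ge0 (f - L * S); clear; lra.
    by move=> /(ler_wpM2l (ltW tau0)); clear; lra.
  by clear -b3 b4 b5; lra.
have s0 : 0 <= s by have := Vs 0 (ltac:(by rewrite lexx ler01)); exact: le_trans.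
(* [pw] is informative only on average; the small oscillation of [H] transfers its mean to the point
   0. *)
have bound : `|H 0 - a ^+ 2 * L ^+ 2| <= w.
  have cD : continuous (fun x => (F x - L * speed a (Phi x)) ^+ 2) by cont.
  have -> : `|H 0 - a ^+ 2 * L ^+ 2| = Iint 0 1 (fun=> `|H 0 - a ^+ 2 * L ^+ 2|).
    by rewrite Iint_cst// subr0 mulr1.
  apply: (@le_trans _ _ (Iint 0 1 (fun x => (2 * tau)^-1 * (F x - L * speed a (Phi x)) ^+ 2 +
   (tau + 21 * s) * F x ^+ 2 + (tau * (a ^+ 2 + 1) * L ^+ 2 + 21 * s * kappa ^+ 2
    + 65 * (eps * kappa ^+ 2) * L ^+ 2)))).
    apply: Iint_le => [||x x01]; [by apply: itg_cont; cont..|].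
    have := ler_normD (H 0 - H x) (H x - a ^+ 2 * L ^+ 2).
    rewrite addrA subrK => /le_trans; apply.
    by have := H0x x x01; have := pw x x01; clear; lra.
  rewrite IintD; [|by apply: itg_cont; cont..].
  rewrite IintD; [|by apply: itg_cont; cont..].
  rewrite !IintZ ?Iint_cst; [|done|by apply: itg_cont; cont..].
  rewrite subr0 mulr1 -/X.
  have c1 := ler_wpM2l (_ : 0 <= (2 * tau)^-1) DD.
  rewrite invr_ge0 mulr_ge0 ?(ltW tau0)// in c1; have {}c1 := c1 isT.
  have c2 : (tau + 21 * s) * X <= (tau + 21 * s) * (64 * kappa ^+ 2).
    by rewrite ler_wpM2l// addr_ge0 ?mulr_ge0// ltW.
  have c3 : 0 <= eps * kappa ^+ 2 * L ^+ 2 by rewrite !mulr_ge0 ?sqr_ge0// ltW.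
  have c4 : tau * kappa ^+ 2 = tau * k ^+ 2 * L ^+ 2 by rewrite kE; ring.
  rewrite /w [D / _]mulrC.
  by move: c1 c2 c3 c4; set e := eps * _; set t := _^-1 * _; set t2 := _^-1 * D; clear; lra.
split; first by rewrite -H0E.
(* The sign of [q 0] comes from the other end, where [q 1 = 2 kappa > 0]: if [q 0] were not
   positive, [q] would vanish somewhere and [H <= 0] there, against [H] being close to [a^2 L^2]. *)
move=> wlt; rewrite ltNge; apply/negP => q0.
have k20 : 0 < 2 * kappa by rewrite mulr_gt0.
have q1 : q 1 = 2 * kappa by rewrite /q P1 addr0.
have [] := @IVT _ q 0 1 0 ler01 (continuous_subspaceT cq).
  by rewrite ge_min le_max q1 (ltW k20) /q q0 orbT.
move=> x; rewrite in_itv /= => x01 qx.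
have Hx : H x <= 0.
  by rewrite /H qx expr0n sub0r oppr_le0 mulr_ge0// sqr_ge0.
have := H0x x x01; have := bound; rewrite !ler_norml => /andP[b1 _] /andP[_ b2].
have c3 : 0 <= eps * kappa ^+ 2 * L ^+ 2 by rewrite !mulr_ge0 ?sqr_ge0// ltW.
by clear -b1 b2 wlt Hx c3; lra.
Qed.

Definition flow_profile {R : realType} (k a eta : R) (delta kappa : R -> R)
    (v dv phi dphi : R -> R -> R) (e : R) : Prop :=
  let L := Num.sqrt (delta e) / e in
  exists V F Phi P,
  [/\ reduced e (delta e) (kappa e) (v e) (dv e) (phi e) (dphi e) V F Phi P,
      (forall x, 0 <= x <= 1 -> `|1 - V x| <= eta),
      (forall x, 0 <= x <= 1 -> (1 - V x) ^+ 2 <= 16 * k ^+ 2 * (delta e / e)),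
      `|Gfun e (delta e) (kappa e) (v e) (dv e) (phi e) (dphi e) + a ^+ 2 * L ^+ 2 / 8|
        <= eta * L ^+ 2 &
      `|(2 * kappa e + P 0) / L - a| <= eta] /\
  [/\ kappa e = k * L, 0 < delta e & eta^-1 <= L].

Lemma flow_near {R : realType} (k a eta : R) (delta kappa : R -> R)
    (v dv phi dphi : R -> R -> R) :
  0 < k -> 0 < a -> period a = k * pi -> 0 < eta ->
  (\forall e \near 0^'+, kappa e = k * Num.sqrt (delta e) / e) ->
  small_o0 delta (fun e => e) -> small_o0 (fun e => e ^+ 2) delta ->
  min_family delta kappa v dv phi dphi ->
  \forall e \near 0^'+, flow_profile k a eta delta kappa v dv phi dphi e.
Proof.
move=> k0 a0 pa eta0 hk hde hed hmin.
have [T1 dT1] := prim_ex _ (speed_cont a).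
pose T y := T1 y - T1 0.
have dT (y : R) : is_derive y 1 T (speed a y).
  by have h := dT1 y; rewrite /T; derive_eq; ring.
have T0 : T 0 = 0 by rewrite /T subrr.
have [m m0 Tm] := speed_prim_bound _ _ _ a0 pa dT T0.
have [g [g0 dg]] := flow_ex _ _ _ (speed_cont a) a0 (speed_ge a)
  (fun y => speed_le a y (ltW a0)).
have k2p : 0 < k ^+ 2 by rewrite exprn_gt0.
have a2p : 0 < a ^+ 2 by rewrite exprn_gt0.
pose K1 := 64 * k ^+ 2 + a ^+ 2 + 1; have K1p : 0 < K1 by rewrite /K1; clear -k2p a2p; lra.
pose K2 := 8 * k ^+ 2 + 1; have K2p : 0 < K2 by rewrite /K2; clear -k2p; lra.
(* The allowed error on [q^2], relative to [L^2]: [a^2/4] keeps [q] positive, [eta a] gives the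
   slope up to [eta]. Then [tau] is fixed before [theta] and [l], because the deficit, of order
   [theta + 1/L] relative to [L^2], enters divided by [tau]. *)
pose et := Num.min (a ^+ 2 / 4) (eta * a).
have et0 : 0 < et by rewrite lt_min divr_gt0// mulr_gt0.
have et1 : et <= a ^+ 2 / 4 by rewrite ge_min lexx.
have et2 : et <= eta * a by rewrite ge_min lexx orbT.
pose tau := et / (4 * K1); have tau0 : 0 < tau by rewrite divr_gt0// mulr_gt0.
have tauE : tau * K1 = et / 4 by rewrite /tau; field; rewrite gt_eqF.
pose theta := Num.min 2^-1 (Num.min (et * tau / (32 * K2)) (eta / (2 * K2))).
have pos2 (c z : R) : 0 < c -> 0 < z -> 0 < c * z by exact: mulr_gt0.
have t0 : 0 < theta.
  have h1 : 0 < et * tau / (32 * K2) by apply: divr_gt0; exact: pos2.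
  have h2 : 0 < eta / (2 * K2) by apply: divr_gt0 => //; exact: pos2.
  by rewrite /theta !lt_min h1 h2 invr_gt0 ltr0n.
have t1 : theta <= 2^-1 by rewrite ge_min lexx.
have t2 : theta * (32 * K2) <= et * tau.
  by rewrite -ler_pdivlMr ?mulr_gt0// !ge_min lexx orbT.
have t3 : theta * (2 * K2) <= eta.
  by rewrite -ler_pdivlMr ?mulr_gt0// !ge_min lexx !orbT.
(* [c3] and [c4] are eight times the terms with 1365 and 130 in [supercrit_momentum]; the
   existential keeps them opaque. *)
have [c3 c3E] : exists c : R, c = 10920 * k ^+ 2 by exists (10920 * k ^+ 2).
have c3p : 0 < c3 by rewrite c3E; apply: mulr_gt0 k2p; rewrite ltr0n.
have [c4 c4E] : exists c : R, c = 1040 * k ^+ 2 by exists (1040 * k ^+ 2).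
have c4p : 0 < c4 by rewrite c4E; apply: mulr_gt0 k2p; rewrite ltr0n.
pose s := Num.min (Num.min (theta / 4) eta) (Num.min 8^-1 (et / c3)).
have s0 : 0 < s.
  have h1 : 0 < theta / 4 by exact: divr_gt0.
  have h2 : 0 < et / c3 := divr_gt0 et0 c3p.
  by rewrite /s !lt_min h1 h2 eta0 invr_gt0 ltr0n.
have s1 : 4 * s <= theta by rewrite mulrC -ler_pdivlMr// !ge_min lexx.
have s2 : s <= eta by rewrite !ge_min lexx orbT.
have s3 : s <= 8^-1 by rewrite !ge_min lexx !orbT.
have s4 : s * c3 <= et.
  by rewrite -ler_pdivlMr// !ge_min lexx !orbT.
have m16 : 0 < 16 * m + 1 by rewrite ltr_wpDl// mulr_ge0.
pose l := Num.min eta (Num.min (et * tau / (16 * m + 1)) (eta / (16 * m + 1))).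
have l0 : 0 < l.
  have h1 : 0 < et * tau / (16 * m + 1) by apply: divr_gt0 => //; exact: pos2.
  have h2 : 0 < eta / (16 * m + 1) by exact: divr_gt0.
  by rewrite /l !lt_min h1 h2 eta0.
have l20 : 0 < l ^+ 2 by rewrite exprn_gt0.
pose d1 := Num.min (s ^+ 2 / (16 * k ^+ 2)) (Num.min (et / c4) (theta / (8 * k ^+ 2))).
have d10 : 0 < d1.
  have h1 : 0 < s ^+ 2 / (16 * k ^+ 2) by apply: divr_gt0; [exact: exprn_gt0|exact: pos2].
  have h2 : 0 < et / c4 := divr_gt0 et0 c4p.
  have h3 : 0 < theta / (8 * k ^+ 2) by apply: divr_gt0 => //; exact: pos2.
  by rewrite /d1 !lt_min h1 h2 h3.
have d2 : d1 * (16 * k ^+ 2) <= s ^+ 2 by rewrite -ler_pdivlMr ?mulr_gt0// !ge_min lexx.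
have d3 : d1 * c4 <= et by rewrite -ler_pdivlMr// !ge_min lexx orbT.
have d4 : d1 * (8 * k ^+ 2) <= theta by rewrite -ler_pdivlMr ?mulr_gt0// !ge_min lexx !orbT.
near=> e; rewrite /flow_profile.
have e0 : 0 < e by near: e; exact: nbhs_right_gt.
have e1 : e <= 1 by near: e; apply: nbhs_right_le.
have e01 : 0 < e <= 1 by rewrite e0.
have [de0 [ke0 [hm vp]]] : 0 < delta e /\ 0 < kappa e /\
   minimizer e (delta e) (kappa e) (v e) (dv e) (phi e) (dphi e) /\
    (forall x, 0 <= x <= 1 -> 0 <= v e x) by near: e.
have kapE' : kappa e = k * Num.sqrt (delta e) / e by near: e.
have c1 : `|delta e| <= d1 * `|e| by near: e; exact: hde.
have c2 : `|e ^+ 2| <= l ^+ 2 * `|delta e| by near: e; exact: hed.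
rewrite !gtr0_norm// ?exprn_gt0// in c1 c2.
set sd := Num.sqrt (delta e) in kapE' *.
have sd0 : 0 < sd by rewrite sqrtr_gt0.
have sd2 : sd ^+ 2 = delta e by rewrite sqr_sqrtr// ltW.
set L := sd / e; have L0 : 0 < L by rewrite divr_gt0.
have kapE : kappa e = k * L by rewrite kapE' mulrA.
have dE : delta e / e ^+ 2 = L ^+ 2 by rewrite /L expr_div_n sd2.
have Ll : L^-1 <= l.
  rewrite /L invf_div ler_pdivrMr// -(@ler_pXn2r _ 2)// ?nnegrE ?(ltW e0)//.
    by rewrite exprMn sd2.
  by rewrite mulr_ge0// ltW.
have L1 : L^-1 <= eta by apply: le_trans Ll _; rewrite ge_min lexx.
have L2 : L^-1 * (16 * m + 1) <= et * tau.
  by rewrite -ler_pdivlMr//; apply: le_trans Ll _; rewrite !ge_min lexx orbT.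
have L3 : L^-1 * (16 * m + 1) <= eta.
  by rewrite -ler_pdivlMr//; apply: le_trans Ll _; rewrite !ge_min lexx !orbT.
have Li0 : 0 <= L^-1 by rewrite invr_ge0 ltW.
pose x := delta e / e.
have x0 : 0 < x by rewrite divr_gt0.
have xd : x <= d1 by rewrite ler_pdivrMr.
have ek : e * kappa e ^+ 2 = k ^+ 2 * x.
  by rewrite kapE' /x -sd2; field; rewrite gt_eqF.
have xk (c : R) : 0 <= c -> x * (c * k ^+ 2) <= d1 * (c * k ^+ 2).
  by move=> c0; rewrite ler_wpM2r// mulr_ge0// ltW.
have es : 16 * (e * kappa e ^+ 2) <= s ^+ 2.
  by rewrite ek; have := xk 16 (ltac:(by [])); clear -d2; lra.
have shalf : 0 <= s <= 2^-1 by rewrite ltW//=; clear -s1 t1; lra.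
have [V [F [Phi [P [hred Vs Vsq EV]]]]] :=
  small_eps_reduced _ _ _ _ _ _ _ _ e01 de0 shalf hm vp es.
have ke : 8 * (kappa e ^+ 2 * e ^+ 2) <= theta.
  have -> : kappa e ^+ 2 * e ^+ 2 = e * (k ^+ 2 * x) by rewrite -ek; ring.
  have h : e * (k ^+ 2 * x) <= k ^+ 2 * x by rewrite ler_piMl// mulr_ge0// ltW.
  by have := xk 8 (ltac:(by [])); clear -d4 h; lra.
have t01 : 0 < theta <= 1 by rewrite t0; clear -t1; lra.
have t01' : 0 < theta <= 2^-1 by rewrite t0.
have low := coupling _ _ _ _ _ _ _ _ _ _ _ _ _ e0 de0 hred t01 (ltW s0) s1 Vs ke.
have up := upper_flow _ _ _ _ _ _ _ _ _ _ _ _ _ e0 L0 dE kapE dT T0 Tm g0 dg hm.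
have [X64 DD GG] := supercrit_energy _ _ _ _ _ _ _ _ _ _ _ _ _ _ _ _ _ L0 k0 m0 dE kapE dT T0
  Tm hred t01' low up (Gfun_le0 _ _ _ _ _ _ _ hm) (Ev_ge0 _ _ _).
have := supercrit_momentum _ _ _ _ _ _ _ tau _ _ _ _ _ _ _ _ _ e0 L0 k0 tau0 s3 dE kapE
  hred Vs EV X64 DD.
set w := _ + _ * L ^+ 2 => -[w1 w2].
have L20 : 0 <= L ^+ 2 := sqr_ge0 _.
have LiL : L = L^-1 * L ^+ 2 by field; rewrite gt_eqF.
have q1 : 130 * (e * kappa e ^+ 2) * L ^+ 2 <= et / 8 * L ^+ 2.
  by rewrite ek ler_wpM2r//; have := ler_wpM2r (ltW c4p) xd; rewrite c4E; rewrite c4E in d3; clear -d3; lra.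
have q2 : 1365 * s * kappa e ^+ 2 <= et / 8 * L ^+ 2.
  have -> : 1365 * s * kappa e ^+ 2 = (s * c3) / 8 * L ^+ 2.
    by rewrite kapE c3E; field.
  by rewrite ler_wpM2r// ler_pM2r// invr_gt0.
have q3 : (4 * L * m + 8 * theta * (8 * k ^+ 2 + 1) * L ^+ 2) / (2 * tau) <= et / 4 * L ^+ 2.
  have tau2 : 0 < 2 * tau by rewrite mulr_gt0.
  rewrite (ler_pdivrMr _ _ tau2) -/K2.
  have r1 := ler_wpM2r L20 L2; have r2 := ler_wpM2r L20 t2.
  have r3 := mulr_ge0 Li0 L20.
  have r4 : 4 * L * m = 4 * m * (L^-1 * L ^+ 2) by rewrite -LiL; ring.
  by rewrite r4; clear -r1 r2 r3; lra.
have q4 : tau * (64 * k ^+ 2 + a ^+ 2 + 1) * L ^+ 2 = et / 4 * L ^+ 2 by rewrite -/K1 tauE.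
have etL : 0 < et * L ^+ 2 by rewrite mulr_gt0// exprn_gt0.
have wle : w <= 3 / 4 * (et * L ^+ 2) by rewrite /w q4; clear -q1 q2 q3; lra.
have etaL : et * L ^+ 2 <= a ^+ 2 / 4 * L ^+ 2 by rewrite ler_wpM2r.
have qp : 0 < 2 * kappa e + P 0.
  by apply: w2; clear -wle q1 etaL etL; lra.
set q := 2 * kappa e + P 0 in w1 qp *.
exists V, F, Phi, P; split; split => //.
- by move=> y y01; exact: le_trans (Vs y y01) s2.
- move=> y y01; apply: le_trans (Vsq y y01) _; rewrite -/x.
  by have := ler_wpM2l (ltW e0) EV; rewrite -mulrA -ek; clear; lra.
- apply: le_trans GG _; rewrite -/K2.
  have r1 := ler_wpM2r L20 L3; have r2 := ler_wpM2r L20 t3.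
  have r3 := mulr_ge0 Li0 L20.
  have r4 : L * m = m * (L^-1 * L ^+ 2) by rewrite -LiL mulrC.
  by have := mulr_ge0 (ltW eta0) L20; rewrite r4; clear -r1 r2 r3; lra.
- have aL : 0 < a * L by rewrite mulr_gt0.
  have -> : q / L - a = (q - a * L) / L by field; rewrite gt_eqF.
  rewrite normrM normfV (gtr0_norm L0) ler_pdivrMr// -(ler_pM2r aL).
  have -> : eta * L * (a * L) = eta * a * L ^+ 2 by ring.
  (* Positivity of [q] bounds [q + a L] below by [a L], so the estimate on [q^2] passes to [q]. *)
  apply: (@le_trans _ _ (`|q - a * L| * (q + a * L))); first by rewrite ler_wpM2l// lerDr ltW.
  rewrite -[X in _ * X <= _](gtr0_norm (addr_gt0 qp aL)) -normrM.
  have -> : (q - a * L) * (q + a * L) = q ^+ 2 - a ^+ 2 * L ^+ 2 by ring.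
  apply: le_trans w1 _; apply: (@le_trans _ _ (et * L ^+ 2)); last by rewrite ler_wpM2r.
  by clear -wle etL; lra.
- by rewrite -[L]invrK lef_pV2 ?posrE ?invr_gt0.
Unshelve. all: by end_near. Qed.

Lemma case_c {R : realType} (kt : R) (delta kappa : R -> R) (v dv phi dphi : R -> R -> R) :
  pi^-1 < kt ->
  (\forall e \near 0^'+, kappa e = kt * Num.sqrt (delta e) / e) ->
  small_o0 (fun e => e ^+ 2) delta ->
  small_o0 delta (fun e => e) ->
  min_family delta kappa v dv phi dphi ->
  (exists C : R, 0 < C /\ \forall e \near 0^'+, forall x, 0 < x < 1 ->
      `|v e x - 1| <= C * Num.sqrt (delta e / e)) /\
  exists a : R,
    [/\ 0 < a <= 2 * kt, period a = kt * pi,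
        (forall b : R, 0 < b <= 2 * kt -> period b = kt * pi -> b = a),
        asym_equiv (fun e => Gfun e (delta e) (kappa e) (v e) (dv e) (phi e) (dphi e))
                   (fun e => - (a ^+ 2 * delta e / (8 * e ^+ 2)))
      & (exists phi0 : R -> R, ode_sol a phi0) /\
        (forall phi0 : R -> R, ode_sol a phi0 ->
           C1loc_conv (fun e x => phi e (e * x / Num.sqrt (delta e))) phi0)].
Proof.
move=> kpi hk hed hde hmin.
have k0 : 0 < kt by apply: lt_trans kpi; rewrite invr_gt0 pi_gt0.
have [a [ab pa uniq]] := period_ex _ kpi.
have /andP[a0 _] := ab.
have near_core (eta : R) : 0 < eta ->
    \forall e \near 0^'+, flow_profile kt a eta delta kappa v dv phi dphi e :=
  fun he => flow_near kt a eta delta kappa v dv phi dphi k0 a0 pa he hk hde hed hmin.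
split.
  (* The square root of [16 kt^2], from [(1 - v)^2 <= 16 eps kappa^2] and
     [eps kappa^2 = kt^2 delta / eps]. *)
  exists (4 * kt); split; first by rewrite mulr_gt0.
  near=> e => x /andP[x0 x1].
  have : flow_profile kt a 1 delta kappa v dv phi dphi e.
    by near: e; apply: near_core.
  rewrite /flow_profile => -[V [F [Phi [P [[hred _ Vsq _ _] [_ d0 _]]]]]].
  have x01 : 0 <= x <= 1 by rewrite !ltW.
  rewrite (red_vE _ _ _ _ _ _ _ _ _ _ _ hred _ x01) distrC.
  have k4 : 0 <= 4 * kt by rewrite mulr_ge0// ltW.
  have q0 : 0 <= delta e / e by rewrite divr_ge0// ltW.
  rewrite -(@ler_pXn2r _ 2)// ?nnegrE ?(mulr_ge0 k4 (sqrtr_ge0 _))//.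
  rewrite -normrX ger0_norm ?sqr_ge0// exprMn sqr_sqrtr//.
  by have := Vsq x x01; rewrite exprMn -natrX.
exists a; split => //.
  have a2 : 0 < a ^+ 2 by rewrite exprn_gt0.
  apply: asym_equivP.
    near=> e; have e0 : 0 < e by near: e; exact: nbhs_right_gt.
    have d0 : 0 < delta e by near: e; apply: filterS hmin => e [].
    rewrite oppr_eq0 gt_eqF// divr_gt0//; first exact: mulr_gt0.
    by rewrite mulr_gt0// exprn_gt0.
  move=> eta eta0; have e20 : 0 < eta * (a ^+ 2 / 8) by rewrite mulr_gt0// divr_gt0.
  near=> e; have e0 : 0 < e by near: e; exact: nbhs_right_gt.
  have : flow_profile kt a (eta * (a ^+ 2 / 8)) delta kappa v dv phi dphi e.
    by near: e; apply: near_core.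
  rewrite /flow_profile => -[V [F [Phi [P [[_ _ _ h _] [_ d0 _]]]]]].
  have E : a ^+ 2 * delta e / (8 * e ^+ 2) = a ^+ 2 * (Num.sqrt (delta e) / e) ^+ 2 / 8.
    by rewrite expr_div_n sqr_sqrtr ?(ltW d0)//; field; rewrite gt_eqF.
  rewrite E normrN opprK; apply: le_trans h _; rewrite ger0_norm.
    by rewrite (_ : eta * (a ^+ 2 / 8) * _ = eta * (a ^+ 2 * (Num.sqrt (delta e) / e) ^+ 2 / 8))//; ring.
  by rewrite divr_ge0// mulr_ge0// sqr_ge0.
split.
  have [g [g0 dg]] := flow_ex _ _ _ (speed_cont a) a0 (speed_ge a)
    (fun y => speed_le a y (ltW a0)).
  by exists g; exact: flow_ode_sol.
move=> phi0 [phi00 phid phi0a phiode] M eta M0 eta0.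
have d1 (t : R) : 0 <= t -> is_derive t 1 phi0 (derive1 phi0 t).
  by move=> t0; rewrite derive1E; apply: derivableP; have [] := phid t t0.
have d2 (t : R) : 0 <= t -> is_derive t 1 (derive1 phi0) (derive1 (derive1 phi0) t).
  by move=> t0; rewrite (derive1E (derive1 phi0)); apply: derivableP; have [] := phid t t0.
have c0 : 0 <= a + 1 + 2 * kt by clear -a0 k0; lra.
have [s /andP[s0 s1] hs] := pendulum_layer M eta _ M0 eta0 c0.
near=> e.
have e0 : 0 < e by near: e; exact: nbhs_right_gt.
have : flow_profile kt a s delta kappa v dv phi dphi e by near: e; exact: near_core.
rewrite /flow_profile => -[V [F [Phi [P [[hred Vs _ _ Pa] [kapE d0 sL]]]]]].
set L := _ / e in Pa kapE sL.
have L0 : 0 < L by rewrite divr_gt0// sqrtr_gt0.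
have i0 : `|P 0| <= L * (a + 1 + 2 * kt).
  have E : P 0 = L * ((2 * kappa e + P 0) / L - a + (a - 2 * kt)).
    by rewrite kapE; field; rewrite gt_eqF.
  rewrite E normrM (gtr0_norm L0) ler_pM2l//; apply: le_trans (ler_normD _ _) _.
  have q : `|a - 2 * kt| <= a + 2 * kt.
    by rewrite ler_norml; clear -a0 k0; apply/andP; split; lra.
  by move: Pa q s1; clear; lra.
have i1 : `|Phi 0 - phi0 0| <= s.
  by rewrite (red_Phi0 _ _ _ _ _ _ _ _ _ _ _ hred) phi00 subr0 normr0 ltW.
have i2 : `|1 * (2 * kappa e + P 0) / L - derive1 phi0 0| <= s by rewrite phi0a mul1r.
have := hs e (delta e) (kappa e) 1 0 _ _ _ _ V F Phi P phi0 (derive1 phi0)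
  e0 d0 hred sL Vs (or_introl (conj erefl erefl))
  (fun t ht => der_cont _ _ _ (d1 t (proj1 (andP ht))))
  (fun t ht => der_cont _ _ _ (d2 t (proj1 (andP ht))))
  (fun t ht => d1 t (ltW (proj1 (andP ht))))
  (fun t ht => der_eq _ _ _ _ (d2 t (ltW (proj1 (andP ht)))) (phiode t (proj1 (andP ht))))
  i0 i1 i2.
set Psi := (X in let Psi := X in _).
suff -> : Psi = (fun x => phi e (e * x / Num.sqrt (delta e))) by [].
by apply/funext => x; rewrite /Psi add0r mul1r.
Unshelve. all: by end_near. Qed.

Theorem theorem3 (R : realType) :
  (* (a) kappa bounded, delta fixed *)
  (exists C : R, 0 < C /\
   forall (delta : R) (kappa : R -> R) (v dv phi dphi : R -> R -> R),
     0 < delta ->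
     (exists B : R, \forall e \near 0^'+, kappa e <= B) ->
     (\forall e \near 0^'+, 0 < kappa e /\
        minimizer e delta (kappa e) (v e) (dv e) (phi e) (dphi e) /\
        (forall x, 0 <= x <= 1 -> 0 <= v e x)) ->
     [/\ sup_littleo (fun e x => v e x - 1) (fun e => e),
         asym_equiv (fun e => phi e 1)
                    (fun e => 2 * kappa e * (e / Num.sqrt delta)),
         (\forall e \near 0^'+, forall x, 0 < x < 1 ->
             `|phi e x| <= C * kappa e * (e / Num.sqrt delta)),
         asym_equiv (fun e => Gfun e delta (kappa e) (v e) (dv e) (phi e) (dphi e))
                    (fun e => - (kappa e ^+ 2 * e / (2 * Num.sqrt delta)))
       & C1loc_conv
           (fun e x => Num.sqrt delta / (2 * kappa e * e) *
                       phi e (1 - e * x / Num.sqrt delta))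
           (fun x => expR (- x))]) /\
  (* (b) kappa = kt sqrt(delta)/eps, kt < 1/pi *)
  (forall (kt : R) (delta kappa : R -> R) (v dv phi dphi : R -> R -> R),
     0 < kt -> kt < pi^-1 ->
     (\forall e \near 0^'+, kappa e = kt * Num.sqrt (delta e) / e) ->
     small_o0 delta (fun e => e) ->
     small_o0 (fun e => e ^+ 2) delta ->
     (\forall e \near 0^'+, 0 < delta e /\ 0 < kappa e /\
        minimizer e (delta e) (kappa e) (v e) (dv e) (phi e) (dphi e) /\
        (forall x, 0 <= x <= 1 -> 0 <= v e x)) ->
     [/\ sup_littleo (fun e x => 1 - v e x) (fun e => Num.sqrt (Num.sqrt (delta e))),
         asym_equiv (fun e => phi e 1) (fun _ => asin (2 * kt)),
         asym_equiv (fun e => Gfun e (delta e) (kappa e) (v e) (dv e) (phi e) (dphi e))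
                    (fun e => Num.sqrt (delta e) / e *
                       ((1 - Num.sqrt (1 - 4 * kt ^+ 2)) / 4 - kt / 2 * asin (2 * kt))),
         (exists r : R -> R, r e @[e --> 0^'+] --> 0 /\
            \forall e \near 0^'+, forall x, 0 < x < 1 ->
              `|phi e x| <= asin (2 * kt) * (1 + r e))
       & C1loc_conv (fun e x => phi e (1 - e * x / Num.sqrt (delta e)))
           (fun x => 2 * atan (tan (asin (2 * kt) / 2) * expR (- x)))]) /\
  (* (c) kappa = kt sqrt(delta)/eps, kt > 1/pi *)
  (forall (kt : R) (delta kappa : R -> R) (v dv phi dphi : R -> R -> R),
     pi^-1 < kt ->
     (\forall e \near 0^'+, kappa e = kt * Num.sqrt (delta e) / e) ->
     small_o0 (fun e => e ^+ 2) delta ->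
     small_o0 delta (fun e => e) ->
     (\forall e \near 0^'+, 0 < delta e /\ 0 < kappa e /\
        minimizer e (delta e) (kappa e) (v e) (dv e) (phi e) (dphi e) /\
        (forall x, 0 <= x <= 1 -> 0 <= v e x)) ->
     (exists C : R, 0 < C /\ \forall e \near 0^'+, forall x, 0 < x < 1 ->
         `|v e x - 1| <= C * Num.sqrt (delta e / e)) /\
     exists a0 : R,
       [/\ 0 < a0 <= 2 * kt,
           Iint 0 (pi / 2) (fun y => Num.sqrt (a0 ^+ 2 + sin y ^+ 2)) = kt * pi,
           (forall b : R, 0 < b <= 2 * kt ->
              Iint 0 (pi / 2) (fun y => Num.sqrt (b ^+ 2 + sin y ^+ 2)) = kt * pi ->
              b = a0),
           asym_equiv (fun e => Gfun e (delta e) (kappa e) (v e) (dv e) (phi e) (dphi e))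
                      (fun e => - (a0 ^+ 2 * delta e / (8 * e ^+ 2)))
         & ((exists K : R, \forall e \near 0^'+, delta e <= K * (e * Num.sqrt e)) ->
            (exists phi0 : R -> R, ode_sol a0 phi0) /\
            (forall phi0 : R -> R, ode_sol a0 phi0 ->
               C1loc_conv (fun e x => phi e (e * x / Num.sqrt (delta e))) phi0))]).
Proof.
split; [exact: case_a|split => kt delta kappa v dv phi dphi].
  exact: case_b.
move=> kpi hk hed hde hmin.
have [h1 [a [ab pa uniq hG conv]]] := case_c _ _ _ _ _ _ _ kpi hk hed hde hmin.
by split=> //; exists a; split.
Qed.
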